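(* Let $\{(N_k,B_k)\}_{k=1}^\infty$ be a sequence of admissible pairs with $0\in B_k\subseteq\{0,1,2,\dots\}$ for all $k\ge1$, satisfying $$\sup\{N_k^{-1}b: k\ge1,\ b\in B_k\}<\infty.$$ Then for every sequence $\mathbf{n}=\{n_k\}_{k=1}^\infty$ of positive integers: (i) the mapping $\mu^{\mathbf{n}}:\Omega\times\mathcal{B}(\mathbb{R})\to[0,+\infty]$, $(\boldsymbol{\omega},B)\mapsto\mu^{\mathbf{n}}(\boldsymbol{\omega})(B)$, is well defined (i.e. the infinite convolution $\mu^{\mathbf{n}}(\boldsymbol{\omega})$ exists for every $\boldsymbol{\omega}\in\Omega$) and is a random measure; (ii) for every Bernoulli measure $\mathbb{P}$ on $\Omega$, $\mu^{\mathbf{n}}(\boldsymbol{\omega})$ is a spectral measure for $\mathbb{P}$-a.e. $\boldsymbol{\omega}\in\Omega$; (iii) if $\mathbf{n}$ is unbounded, $\mu^{\mathbf{n}}$ is a spectral random measure.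
   Context: $\Omega=\mathbb{N}^{\mathbb{N}}$ with index set $\mathbb{N}=\{1,2,3,\dots\}$ is the set of infinite sequences $\boldsymbol{\omega}=\omega_1\omega_2\cdots$ of positive integers, with the metric $d(\boldsymbol{\alpha},\boldsymbol{\beta})=2^{-|\boldsymbol{\alpha}\wedge\boldsymbol{\beta}|}$, where $|\boldsymbol{\alpha}\wedge\boldsymbol{\beta}|$ is the length of the maximal common initial segment ($d=0$ if the sequences are equal). $\mathcal{F}$ is the Borel $\sigma$-algebra of $\Omega$; $\mathcal{B}(\mathbb{R})$ is the Borel $\sigma$-algebra of $\mathbb{R}$. Bernoulli measure: given a probability vector $\mathbf{p}=(p_1,p_2,\dots)$ ($p_j\ge0$, $\sum_{j\ge1}p_j=1$), the associated Bernoulli measure $\mathbb{P}$ is the Borel probability measure on $\Omega$ with $\mathbb{P}(\{\boldsymbol{\omega}:\omega_1=\alpha_1,\dots,\omega_k=\alpha_k\})=p_{\alpha_1}\cdots p_{\alpha_k}$ for all finite words $\alpha_1\cdots\alpha_k$. Admissible pair: for an integer $N\ge2$ and a finite $B\subset\mathbb{Z}$ with $\#B\ge2$, $(N,B)$ is an admissible pair if there is $L\subset\mathbb{Z}$ such that the matrix $\left[\frac{1}{\sqrt{\#B}}e^{-2\pi i\,bl/N}\right]_{b\in B,\,l\in L}$ is unitary (in particular $\#L=\#B$). For a finite nonempty $A\subset\mathbb{R}$, $\delta_A=\frac{1}{\#A}\sum_{a\in A}\delta_a$ with $\delta_a$ the Dirac measure at $a$; $cA=\{ca:a\in A\}$;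 $*$ is convolution. For $\boldsymbol{\omega}\in\Omega$, put $$\mu^{\mathbf{n}}_{k}(\boldsymbol{\omega}) =\delta_{N_{\omega_{1}}^{-n_{1}}B_{\omega_{1}}} * \delta_{N_{\omega_{1}}^{-n_{1}}N_{\omega_{2}}^{-n_{2}}B_{\omega_{2}}} * \cdots * \delta_{N_{\omega_{1}}^{-n_{1}}\cdots N_{\omega_{k}}^{-n_{k}}B_{\omega_{k}}}.$$ The infinite convolution $\mu^{\mathbf{n}}(\boldsymbol{\omega})$ is said to exist if $\mu^{\mathbf{n}}_k(\boldsymbol{\omega})$ converges weakly, as $k\to\infty$, to a Borel probability measure on $\mathbb{R}$, and $\mu^{\mathbf{n}}(\boldsymbol{\omega})$ denotes this limit. A mapping $M:\Omega\times\mathcal{B}(\mathbb{R})\to[0,+\infty]$ is a random measure if $\boldsymbol{\omega}\mapsto M(\boldsymbol{\omega},A)$ is $\mathcal{F}$-measurable for every $A\in\mathcal{B}(\mathbb{R})$ and $M(\boldsymbol{\omega})=M(\boldsymbol{\omega},\cdot)$ is a measure for every $\boldsymbol{\omega}\in\Omega$. A Borel probability measure $\nu$ on $\mathbb{R}$ is a spectral measure if there is $\Lambda\subset\mathbb{R}$ such that $\{e^{2\pi i\lambda x}:\lambda\in\Lambda\}$ is an orthonormal basis of $L^2(\nu)$. A random measure $M$ is a spectral random measure if $M(\boldsymbol{\omega})$ is a spectral measure for all $\boldsymbol{\omega}\in\Omega$. *)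

(* Defs.v *)
From HB Require Import structures.
From mathcomp Require Import all_boot all_order all_algebra finmap.
From mathcomp Require Import all_classical all_reals all_analysis measurable_realfun.
From mathcomp Require Import complex spectral.

Set Implicit Arguments.
Unset Strict Implicit.
Unset Printing Implicit Defensive.
Import Order.TTheory GRing.Theory Num.Theory.
Import numFieldNormedType.Exports.

Local Open Scope classical_set_scope.
Local Open Scope ring_scope.

(* Indices and letters are numbered from 0: position k and letter j stand for
   omega_(k+1) and the positive integer j+1. The parameter R is the field in
   which the metric takes its values. *)
Definition words (R : realType) : Type := nat -> nat.

HB.instance Definition _ (R : realType) :=
  Pointed.copy (words R) (nat -> nat).

Section words_metric.
Context {R : realType}.
Implicit Types a b c : words R.

(* The least index at which two distinct words differ is the length of their
   maximal common initial segment. *)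
Definition words_dist a b : R :=
  if pselect (exists k, a k != b k) is left ab then 2 ^- ex_minn ab else 0.

Let words_dist_ge0 a b : 0 <= words_dist a b.
Proof.
by rewrite /words_dist; case: pselect => [ab|//]; rewrite invr_ge0 exprn_ge0.
Qed.

Let words_distxx a : words_dist a a = 0.
Proof.
rewrite /words_dist; case: pselect => // aa.
by exfalso; case: aa => k; rewrite eqxx.
Qed.

Let words_dist_eq0 a b : words_dist a b = 0 -> a = b.
Proof.
rewrite /words_dist; case: pselect => [ab /eqP|nab _].
  by rewrite invr_eq0 expf_eq0 pnatr_eq0 andbF.
apply/funext => k; apply/eqP/negPn/negP => abk; apply: nab; by exists k.
Qed.

Let words_distC a b : words_dist a b = words_dist b a.
Proof.
rewrite /words_dist; case: pselect => [ab|nab]; case: pselect => [ba|nba] //.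
- case: ex_minnP => m ma mmin; case: ex_minnP => p pb pmin; congr (2 ^- _).
  by apply/eqP; rewrite eqn_leq mmin 1?eq_sym// pmin// eq_sym.
- by exfalso; apply: nba; case: ab => k kab; exists k; rewrite eq_sym.
- by exfalso; apply: nab; case: ba => k kab; exists k; rewrite eq_sym.
Qed.

Let words_dist_triangle b a c :
  words_dist a c <= words_dist a b + words_dist b c.
Proof.
rewrite {1}/words_dist; case: pselect => [ac|_]; last by rewrite addr_ge0.
case: ex_minnP => m mac _.
have key x y : x m != y m -> 2 ^- m <= words_dist x y.
  move=> xy; rewrite /words_dist; case: pselect => [e|]; last first.
    by case; exists m.
  case: ex_minnP => p _ /(_ _ xy) pm.
  by rewrite lef_pV2 ?posrE ?exprn_gt0// ler_weXn2l// ler1n.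
have [abm|abm] := eqVneq (a m) (b m).
  by rewrite (le_trans (key b c _)) -?abm// lerDr.
by rewrite (le_trans (key _ _ abm))// lerDl.
Qed.

HB.instance Definition _ := isMetric.Build R (words R) words_distxx
  words_dist_eq0 words_distC words_dist_triangle.

End words_metric.

Definition borel_words (R : realType) :=
  g_sigma_algebraType (@open (words R)).

Definition cylinder (R : realType) (s : seq nat) : set (borel_words R) :=
  [set w | forall i, (i < size s)%N -> w i = nth 0%N s i].

Definition probability_vector (R : realType) (p : nat -> R) : Prop :=
  (forall j, 0 <= p j) /\ (\sum_(0 <= j <oo) (p j)%:E = 1)%E.

Definition bernoulli_measure (R : realType) (p : nat -> R)
    (P : probability (borel_words R) R) : Prop :=
  forall s : seq nat, P (@cylinder R s) = (\prod_(j <- s) p j)%:E.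

(* t |-> exp (2 i pi t) *)
Definition cexp2pi (R : realType) (t : R) : R[i] :=
  (cos (2 * pi * t) +i* sin (2 * pi * t))%C.

(* For a rectangular matrix M, M \is unitarymx only says M M^* = 1; together
   with #L = #B it is unitarity. *)
Definition admissible_pair (R : realType) (N : nat) (B : {fset int}) : Prop :=
  [/\ (2 <= N)%N, (2 <= #|` B|)%N &
    exists L : {fset int}, #|` L| = #|` B| /\
      (\matrix_(i < #|` B|, j < #|` L|)
        ((Num.sqrt (#|` B|%:R : R))^-1%:C%C *
         cexp2pi (- ((nth 0 B i)%:~R * (nth 0 L j)%:~R / N%:R))))
      \is unitarymx].

Section uniform_fset.
Context {R : realType}.
Local Open Scope ereal_scope.
Implicit Type A : {fset R}.

Definition uniform_fset A (E : set R) : \bar R :=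
  (#|` A|%:R^-1)%:E * \sum_(a <- A) \d_a E.

Let uniform_fset0 A : uniform_fset A set0 = 0.
Proof. by rewrite /uniform_fset big1 ?mule0// => a _; rewrite measure0. Qed.

Let uniform_fset_ge0 A E : 0 <= uniform_fset A E.
Proof.
by rewrite /uniform_fset mule_ge0 ?lee_fin ?invr_ge0// sume_ge0.
Qed.

Let uniform_fset_sigma_additive A : semi_sigma_additive (uniform_fset A).
Proof.
have r0 : (0 <= (#|` A|%:R : R)^-1)%R by rewrite invr_ge0.
pose mu := mscale (NngNum r0)
  (msum (fun k => [the {measure set R -> \bar R} of
                   \d_(nth 0%R A k)]) #|` A|).
have -> : uniform_fset A = mu.
  apply/funext => E; rewrite /uniform_fset /mu /mscale /= /msum.
  by rewrite (big_nth 0%R) big_mkord.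
exact: measure_semi_sigma_additive.
Qed.

HB.instance Definition _ A := isMeasure.Build _ _ _ (uniform_fset A)
  (uniform_fset0 A) (uniform_fset_ge0 A) (@uniform_fset_sigma_additive A).

Let uniform_fset_finite A : fin_num_fun (uniform_fset A).
Proof.
move=> E mE; rewrite /uniform_fset fin_numM// sum_fin_num.
by apply/allP => _ /mapP[a _ ->]; rewrite diracE.
Qed.

HB.instance Definition _ A := Measure_isFinite.Build _ _ _ (uniform_fset A)
  (@uniform_fset_finite A).

End uniform_fset.

Section convolution.
Context {R : realType}.
Local Open Scope ereal_scope.
Variables mu nu : {finite_measure set R -> \bar R}.

Definition convolution : set R -> \bar R :=
  pushforward (mu \x nu) (fun xy : R * R => (xy.1 + xy.2)%R).

Let addp (xy : R * R) : R := (xy.1 + xy.2)%R.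

Let measurable_addp : measurable_fun setT addp.
Proof. exact: measurable_funD. Qed.

HB.instance Definition _ := isMeasurableFun.Build _ _ _ _ _ measurable_addp.

Let convolutionE : convolution = pushforward (mu \x nu) addp.
Proof. by []. Qed.

Let convolution0 : convolution set0 = 0.
Proof. by rewrite convolutionE measure0. Qed.

Let convolution_ge0 A : 0 <= convolution A.
Proof. exact: measure_ge0. Qed.

Let convolution_sigma_additive : semi_sigma_additive convolution.
Proof. rewrite convolutionE; exact: measure_semi_sigma_additive. Qed.

HB.instance Definition _ := isMeasure.Build _ _ _ convolution
  convolution0 convolution_ge0 convolution_sigma_additive.

Let convolution_finite : fin_num_fun convolution.
Proof.
apply: lty_fin_num_fun.
suff : (mu \x nu) setT < +oo by [].
rewrite -setXTT product_measure1E// ltey_eq fin_numM// fin_num_measure//.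
Qed.

HB.instance Definition _ := Measure_isFinite.Build _ _ _ convolution
  convolution_finite.

End convolution.

Section infinite_convolution.
Context {R : realType}.
Variables (N : nat -> nat) (B : nat -> {fset int}) (n : nat -> nat).
Implicit Type w : words R.

(* N_(w_1)^(- n_1) ... N_(w_(k+1))^(- n_(k+1)) B_(w_(k+1)) *)
Definition digit_set w (k : nat) : {fset R} :=
  [fset (\prod_(i < k.+1) (N (w i))%:R ^- n i) * b%:~R | b in B (w k)]%fset.

(* The convolution of the first k factors; the empty one is the unit \d_0. *)
Fixpoint partial_convolution w (k : nat) :
    {finite_measure set R -> \bar R} :=
  match k with
  | 0 => \d_(0 : R)
  | k'.+1 =>
      convolution (partial_convolution w k') (uniform_fset (digit_set w k'))
  end.

Definition weak_cvg
    (mu : nat -> {finite_measure set R -> \bar R})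
    (nu : probability R R) : Prop :=
  forall f : R -> R, continuous f -> bounded_fun f ->
    (\int[mu k]_x f x) @[k --> \oo] --> \int[nu]_x f x.

Definition infinite_convolution_exists w : Prop :=
  exists nu, weak_cvg (partial_convolution w) nu.

(* The weak limit, or an arbitrary probability measure if there is none. *)
Definition infinite_convolution w : probability R R :=
  get [set nu | weak_cvg (partial_convolution w) nu].

End infinite_convolution.

Section complex_L2.
Context {R : realType} (nu : {measure set R -> \bar R}).
Implicit Types f g : R -> R[i].

Definition cLnorm2 f : \bar R :=
  'N[nu]_2%:E[EFin \o (fun x => Normc.normc (f x))].

Definition cL2 f : Prop :=
  [/\ measurable_fun [set: R] (fun x => complex.Re (f x)),
      measurable_fun [set: R] (fun x => complex.Im (f x)) &
      (cLnorm2 f < +oo)%E].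

Definition cRintegral f : R[i] :=
  (\int[nu]_x complex.Re (f x) +i* \int[nu]_x complex.Im (f x))%C.

Definition cinner f g : R[i] := cRintegral (fun x => f x * (g x)^*%C).

Definition orthonormal_basis (I : choiceType) (D : set I) (e : I -> R -> R[i]) :
    Prop :=
  [/\ forall i, D i -> cL2 (e i),
      forall i j, D i -> D j -> cinner (e i) (e j) = (i == j)%:R &
      forall f, cL2 f -> forall eps : R, 0 < eps ->
        exists (s : seq I) (c : I -> R[i]), (forall i, i \in s -> D i) /\
          (cLnorm2 (fun x => f x - \sum_(i <- s) c i * e i x)%R
             < eps%:E)%E].

Definition spectral_measure : Prop :=
  nu setT = 1%E /\
  exists Lam : set R, orthonormal_basis Lam (fun l x => cexp2pi (l * x)).

End complex_L2.

(* That each M w is a measure is part of the type of M. *)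
Definition random_measure (R : realType)
    (M : borel_words R -> {measure set R -> \bar R}) : Prop :=
  forall A, measurable A -> measurable_fun setT (fun w => M w A).

Definition spectral_random_measure (R : realType)
    (M : borel_words R -> {measure set R -> \bar R}) : Prop :=
  random_measure M /\ forall w, spectral_measure (M w).

(* Main.v *)
Require Import Defs.
From HB Require Import structures.
From mathcomp Require Import all_boot all_order all_algebra finmap.
From mathcomp Require Import all_classical all_reals all_analysis.
From mathcomp Require Import measurable_realfun complex spectral.
From mathcomp Require Import ring lra zify.

(** Write F m for the Fourier transform x |-> \int e(x t) dm(t) of a measure m,
    where e(t) = exp (2 i pi t). Fix a word, put Q_i = N_(w_i)^(n_i), P_m for
    the product of the first m of the Q_i, and let mu_m be the uniform measure
    on the atoms of the first m factors.

    Existence. All digits are nonnegative, so when u is uniform on [0, 1[ and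
    X_m(u) is the atom of mu_m of rank [u #atoms], the sequence X_m(u) is
    nondecreasing; it is bounded, and the law of its limit is the infinite
    convolution mu, carried by [0, 2 C] ([weak_limit_exists]). Integrals
    against mu are limits of functions of finitely many letters, which gives
    the measurability in the word ([measurable_weak_limit]).

    Spectrality. Up to scaling, mu = mu_m * nu_m where nu_m is the infinite
    convolution along the shifted data, so that
    |F mu (x)|^2 = |F mu_m (x)|^2 |F nu_m (x / P_m)|^2. Admissibility gives
    finite sets of integers s_m with \sum_(l in s_m) |F mu_m (x + l)|^2 = 1,
    the condition of Jorgensen and Pedersen for s_m to be a spectrum of mu_m.
    If d divides all digits, P_m / d is a period of F mu_m, and every l in s_m
    may be moved by a multiple of it. Assume that, for some eps > 0 and
    infinitely many m, every class of R modulo Z / d contains a point where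
    |F nu_m|^2 >= eps ([lower_mod]). Then the spectra can be chosen increasing
    with |F nu_m (l / P_m)|^2 bounded below, the identity above passes to the
    limit, and all characters are in the closed span of those indexed by the
    union of the s_m. Trigonometric polynomials are dense in L2 of a
    compactly supported law ([approx_I2]), so this union is a spectrum of mu
    ([spectral_of_lower_mod]).

    Lower bounds. If n is unbounded, then for infinitely many m the measure
    nu_m is concentrated near 0 and F nu_m is bounded below on [0, 1[: d = 1
    does
    ([lower_mod_large]). If n is bounded, let d be the gcd of the digits of
    the letters of positive probability; d is an integral combination of
    digits of finitely many such letters. Almost surely, a block of letters
    carrying these digits is repeated T + 1 times at infinitely many positions
    ([ae_words]). If |F nu_m|^2 were tiny on a class modulo Z / d, then every
    block would create one more such class for the shifted data, because two
    elements of the spectrum of the block carry a substantial part of the unit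
    sum, unless the point is near Z / d, where F nu_m is near 1
    ([block_split], [tree_points]). This yields T + 1 points of [0, 1],
    separated by a constant depending on T only, where the transform of a
    measure on [0, 2 C] is tiny. The real part of such a transform is a
    mixture of cosines of frequency at most 2 C, whose value at 0 is given by
    Lagrange interpolation at the T + 1 points up to an error
    (4 pi C)^(T + 1) / (T + 1)!: for large T this contradicts its being 1
    ([interpolation_cos], [lower_mod_blocks]). *)

Set Implicit Arguments.
Unset Strict Implicit.
Unset Printing Implicit Defensive.
Import Order.TTheory GRing.Theory Num.Theory.
Import numFieldNormedType.Exports.

Local Open Scope classical_set_scope.
Local Open Scope ring_scope.

(** * Squared modulus and the character t |-> exp (2 i pi t) *)

Section modulus.
Context {R : realType}.
Implicit Types z w : R[i].

Definition sqn z : R := complex.Re z ^+ 2 + complex.Im z ^+ 2.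

Lemma sqn_ge0 z : 0 <= sqn z.
Proof. by rewrite addr_ge0 ?sqr_ge0. Qed.

Lemma sqnM z w : sqn (z * w) = sqn z * sqn w.
Proof. by case: z w => [a b] [c d]; rewrite /sqn /=; ring. Qed.

Lemma sqn1 : sqn 1 = 1.
Proof. by rewrite /sqn /=; ring. Qed.

Lemma sqn0 : sqn 0 = 0.
Proof. by rewrite /sqn /=; ring. Qed.

Lemma sqn_eq0 z : sqn z = 0 -> z = 0.
Proof.
move=> /eqP; rewrite paddr_eq0 ?sqr_ge0// !sqrf_eq0 => /andP[/eqP a0 /eqP b0].
by case: z a0 b0 => a b /= -> ->.
Qed.

Lemma sqnJ z : sqn (z^*)%C = sqn z.
Proof. by case: z => a b; rewrite /sqn /= sqrrN. Qed.

Lemma sqnD z w : sqn (z + w) <= 2 * sqn z + 2 * sqn w.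
Proof.
case: z w => [a b] [c d]; rewrite /sqn /= -subr_ge0.
rewrite (_ : _ - _ = (a - c) ^+ 2 + (b - d) ^+ 2); last by ring.
by rewrite addr_ge0 ?sqr_ge0.
Qed.

Lemma sqnE z : sqn z = complex.Re (z * (z^*)%C).
Proof. by case: z => a b; rewrite /sqn /=; ring. Qed.

Lemma normc_sqn z : Normc.normc z = Num.sqrt (sqn z).
Proof. by case: z. Qed.

Lemma sqn_prod (I : Type) (r : seq I) (F : I -> R[i]) :
  sqn (\prod_(i <- r) F i) = \prod_(i <- r) sqn (F i).
Proof. by elim/big_ind2: _ => //; [exact: sqn1|move=> x y z t <- <-; exact: sqnM]. Qed.

Lemma ReD z w : complex.Re (z + w) = complex.Re z + complex.Re w.
Proof. by case: z w => [a b] [c d]. Qed.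
Lemma ImD z w : complex.Im (z + w) = complex.Im z + complex.Im w.
Proof. by case: z w => [a b] [c d]. Qed.
Lemma ReM z w : complex.Re (z * w) =
  complex.Re z * complex.Re w - complex.Im z * complex.Im w.
Proof. by case: z w => [a b] [c d]. Qed.
Lemma ImM z w : complex.Im (z * w) =
  complex.Re z * complex.Im w + complex.Im z * complex.Re w.
Proof. by case: z w => [a b] [c d]. Qed.
Lemma ReN z : complex.Re (- z) = - complex.Re z. Proof. by case: z. Qed.
Lemma ImN z : complex.Im (- z) = - complex.Im z. Proof. by case: z. Qed.

Lemma Re_sum (I : Type) (r : seq I) (F : I -> R[i]) :
  complex.Re (\sum_(i <- r) F i) = \sum_(i <- r) complex.Re (F i).
Proof. by elim/big_ind2: _ => // x y z t <- <-; rewrite ReD. Qed.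
Lemma Im_sum (I : Type) (r : seq I) (F : I -> R[i]) :
  complex.Im (\sum_(i <- r) F i) = \sum_(i <- r) complex.Im (F i).
Proof. by elim/big_ind2: _ => // x y z t <- <-; rewrite ImD. Qed.

Lemma ReZ (a : R) z : complex.Re (a%:C%C * z) = a * complex.Re z.
Proof. by rewrite ReM /= mul0r subr0. Qed.
Lemma ImZ (a : R) z : complex.Im (a%:C%C * z) = a * complex.Im z.
Proof. by rewrite ImM /= mul0r addr0. Qed.
Lemma sqnZ (a : R) z : sqn (a%:C%C * z) = a ^+ 2 * sqn z.
Proof. by rewrite /sqn ReZ ImZ; ring. Qed.

Lemma complexP z w : complex.Re z = complex.Re w ->
  complex.Im z = complex.Im w -> z = w.
Proof. by case: z w => [a b] [c d] /= -> ->. Qed.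

End modulus.

Section character.
Context {R : realType}.
Implicit Type t : R.
Local Notation e := (@cexp2pi R).

Lemma cexp2piD (s t : R) : e (s + t) = e s * e t.
Proof.
apply: complexP; rewrite ?ReM ?ImM /= mulrDr ?cosD ?sinD//; ring.
Qed.

Lemma cexp2pi0 : e 0 = 1.
Proof. by rewrite /cexp2pi mulr0 cos0 sin0. Qed.

Lemma cexp2piN t : e (- t) = (e t)^*%C.
Proof. by rewrite /cexp2pi mulrN cosN sinN. Qed.

Lemma sqn_cexp2pi t : sqn (e t) = 1.
Proof. by rewrite /sqn /= cos2Dsin2. Qed.

Lemma cexp2pi_nat n : e n%:R = 1.
Proof.
elim: n => [|n IH]; first exact: cexp2pi0.
rewrite -addn1 natrD cexp2piD IH mul1r /cexp2pi mulr1.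
by rewrite (_ : 2 * pi = pi *+ 2) ?cos2pi ?sin2pi// mulr2n; ring.
Qed.

Lemma cexp2pi_int (k : int) : e k%:~R = 1.
Proof.
case: k => n; first by rewrite -pmulrn cexp2pi_nat.
by rewrite NegzE mulrNz cexp2piN -pmulrn cexp2pi_nat /= oppr0.
Qed.

Lemma Re_cexp2pi t : complex.Re (e t) = cos (2 * pi * t). Proof. by []. Qed.
Lemma cos2pi_int t (k : int) : cos (2 * pi * (t + k%:~R)) = cos (2 * pi * t).
Proof. by rewrite -!Re_cexp2pi cexp2piD cexp2pi_int mulr1. Qed.

Lemma cos_lip (a b : R) : `|cos a - cos b| <= `|a - b|.
Proof.
wlog ab : a b / b <= a.
  move=> H; case: (leP b a) => [/H//|/ltW /H].
  by rewrite distrC (distrC b).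
have [|c _ ->] := @MVT_segment R cos (fun x => - sin x) b a ab.
  by apply: continuous_subspaceT; exact: continuous_cos.
by rewrite normrM normrN ler_piMl// sin_max.
Qed.

Lemma sin_lip (a b : R) : `|sin a - sin b| <= `|a - b|.
Proof.
by rewrite -!cosBpihalf (le_trans (cos_lip _ _))// opprB addrA subrK.
Qed.

End character.

(** * Fourier transforms of finite averages of Dirac masses *)

Section averages.
Context {R : realType}.
Local Notation e := (@cexp2pi R).
Implicit Types s r : seq R.

Definition avg (T : Type) (s : seq T) (V : T -> R) : R :=
  (size s)%:R^-1 * \sum_(x <- s) V x.

Definition ft s (x : R) : R[i] :=
  ((size s)%:R^-1)%:C%C * \sum_(t <- s) e (x * t).

Lemma avg_cst (T : Type) (s : seq T) (c : R) :
  (0 < size s)%N -> avg s (fun=> c) = c.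
Proof.
move=> s0; rewrite /avg big_const_seq count_predT iter_addr_0 -[c *+ _]mulr_natl.
by rewrite mulrA mulVf ?mul1r// pnatr_eq0 -lt0n.
Qed.

Lemma norm_avg_le (T : eqType) (s : seq T) (V : T -> R) (c : R) :
  0 <= c -> (forall t, t \in s -> `|V t| <= c) -> `|avg s V| <= c.
Proof.
move=> c0 Vc; rewrite /avg normrM ger0_norm ?invr_ge0//.
have [/eqP s0|s0] := posnP (size s).
  by rewrite (eqP s0) invr0 mul0r.
rewrite -(avg_cst c s0) /avg ler_wpM2l ?invr_ge0//.
rewrite (le_trans (ler_norm_sum _ _ _))// big_seq [leRHS]big_seq.
exact: ler_sum.
Qed.

Lemma avgB (T : Type) (s : seq T) (V W : T -> R) :
  avg s V - avg s W = avg s (fun t => V t - W t).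
Proof. by rewrite /avg sumrB mulrBr. Qed.

Lemma avg_sumZ (T I : Type) (r : seq I) (s : seq T) (c : I -> R)
    (V : I -> T -> R) :
  \sum_(i <- r) c i * avg s (V i) = avg s (fun t => \sum_(i <- r) c i * V i t).
Proof.
rewrite /avg exchange_big mulr_sumr /=; apply: eq_bigr => i _.
by rewrite mulrCA mulr_sumr.
Qed.

Lemma Re_ft s x : complex.Re (ft s x) = avg s (fun t => cos (2 * pi * (x * t))).
Proof. by rewrite /ft ReZ Re_sum. Qed.
Lemma Im_ft s x : complex.Im (ft s x) = avg s (fun t => sin (2 * pi * (x * t))).
Proof. by rewrite /ft ImZ Im_sum. Qed.

Lemma ft0 s : (0 < size s)%N -> ft s 0 = 1.
Proof.
move=> s0; apply: complexP; rewrite ?Re_ft ?Im_ft /= -[RHS](avg_cst _ s0).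
  by congr avg; apply/funext => t; rewrite mul0r mulr0 cos0.
by congr avg; apply/funext => t; rewrite mul0r mulr0 sin0.
Qed.

Lemma ft_add s r x : ft [seq a + b | a <- s, b <- r] x = ft s x * ft r x.
Proof.
rewrite /ft size_allpairs natrM invfM rmorphM /= big_allpairs_dep.
rewrite mulrACA; congr (_ * _); rewrite big_distrl /=; apply: eq_bigr => a _.
by rewrite big_distrr /=; apply: eq_bigr => b _; rewrite mulrDr cexp2piD.
Qed.

Lemma ft_scale s (c x : R) : ft [seq t / c | t <- s] x = ft s (x / c).
Proof.
rewrite /ft size_map big_map; congr (_ * _); apply: eq_bigr => t _.
by rewrite mulrA mulrAC.
Qed.

Lemma ft_periodic s (T x : R) :
  (forall t, t \in s -> e (T * t) = 1) -> ft s (x + T) = ft s x.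
Proof.
move=> sT; rewrite /ft; congr (_ * _); apply: eq_big_seq => t ts.
by rewrite mulrDl cexp2piD sT// mulr1.
Qed.

Lemma Re_ft_le1 s x : `|complex.Re (ft s x)| <= 1.
Proof. by rewrite Re_ft norm_avg_le// => t _; exact: cos_max. Qed.
Lemma Im_ft_le1 s x : `|complex.Im (ft s x)| <= 1.
Proof. by rewrite Im_ft norm_avg_le// => t _; exact: sin_max. Qed.

Lemma sqn_ftE s x : sqn (ft s x) =
  (size s)%:R ^- 2 * \sum_(t <- s) \sum_(u <- s) cos (2 * pi * (x * (t - u))).
Proof.
rewrite /ft sqnZ exprVn; congr (_ * _).
rewrite /sqn Re_sum Im_sum !expr2 !big_distrlr /= -big_split /=.
apply: eq_bigr => t _; rewrite -big_split /=; apply: eq_bigr => u _.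
by rewrite mulrBr [in RHS]mulrBr cosB.
Qed.

Lemma sqn_ft_le1 s x : sqn (ft s x) <= 1.
Proof.
have [/eqP s0|s0] := posnP (size s).
  by rewrite sqn_ftE (eqP s0) expr0n/= invr0 mul0r.
rewrite sqn_ftE mulrC ler_pdivrMr ?exprn_gt0 ?ltr0n// mul1r.
apply: (@le_trans _ _ (\sum_(t <- s) \sum_(u <- s) 1)).
  by apply: ler_sum => t _; apply: ler_sum => u _; exact: cos_le1.
by rewrite !big_const_seq !count_predT !iter_addr_0 -mulrnA natrM expr2.
Qed.

(** Each term 1 - cos (2 pi x (t - u)) of the expansion of 1 - |ft s x|^2 is
    nonnegative; keep the one with t = b and u = 0. *)
Lemma sqn_ft_atom s x b : uniq s -> 0 \in s -> b \in s ->
  1 - cos (2 * pi * (x * b)) <= (size s)%:R ^+ 2 * (1 - sqn (ft s x)).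
Proof.
move=> us s0 bs.
have n0 : (size s)%:R != 0 :> R by rewrite pnatr_eq0; case: s s0 {us bs}.
rewrite mulrBr sqn_ftE mulVKf ?expf_neq0// mulr1.
rewrite (_ : (size s)%:R ^+ 2 = \sum_(t <- s) \sum_(u <- s) (1 : R)); last first.
  by rewrite !big_const_seq !count_predT !iter_addr_0 -mulrnA natrM expr2.
rewrite -sumrB (bigD1_seq b)//= -sumrB (bigD1_seq 0)//= subr0.
rewrite -addrA lerDl addr_ge0//; last first.
  apply: sumr_ge0 => t _; rewrite -sumrB; apply: sumr_ge0 => u _.
  by rewrite subr_ge0 cos_le1.
by apply: sumr_ge0 => u _; rewrite subr_ge0 cos_le1.
Qed.

Section lipschitz.
Variables (s : seq R) (A : R).
Hypothesis sA : forall t, t \in s -> 0 <= t <= A.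
Hypothesis A0 : 0 <= A.

Let bound t x y : t \in s ->
  `|2 * pi * (x * t) - 2 * pi * (y * t)| <= 2 * pi * A * `|x - y|.
Proof.
move=> /sA/andP[t0 tA].
rewrite -mulrBr -mulrBl !normrM (ger0_norm t0) ger0_norm// (ger0_norm (pi_ge0 _)).
by rewrite -!mulrA !ler_pM2l ?pi_gt0// mulrC ler_wpM2r.
Qed.

Let c0 (x y : R) : 0 <= 2 * pi * A * `|x - y|.
Proof. by rewrite !mulr_ge0// pi_ge0. Qed.

Lemma Re_ft_lip x y :
  `|complex.Re (ft s x) - complex.Re (ft s y)| <= 2 * pi * A * `|x - y|.
Proof.
rewrite !Re_ft avgB norm_avg_le ?c0// => t ts.
by rewrite (le_trans (cos_lip _ _))// bound.
Qed.

Lemma Im_ft_lip x y :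
  `|complex.Im (ft s x) - complex.Im (ft s y)| <= 2 * pi * A * `|x - y|.
Proof.
rewrite !Im_ft avgB norm_avg_le ?c0// => t ts.
by rewrite (le_trans (sin_lip _ _))// bound.
Qed.

End lipschitz.

Lemma sqn_lip (z w : R[i]) (K : R) :
  `|complex.Re z| <= 1 -> `|complex.Im z| <= 1 ->
  `|complex.Re w| <= 1 -> `|complex.Im w| <= 1 ->
  `|complex.Re z - complex.Re w| <= K -> `|complex.Im z - complex.Im w| <= K ->
  `|sqn z - sqn w| <= 4 * K.
Proof.
case: z w => [a b] [c d] /=; rewrite /sqn /= => a1 b1 c1 d1 ac bd.
rewrite opprD addrACA !subr_sqr (le_trans (ler_normD _ _))// !normrM.
rewrite (_ : 4 * K = K * 2 + K * 2); last by ring.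
have h x y : `|x| <= 1 -> `|y| <= 1 -> `|x + y| <= 2 :> R.
  by move=> x1 y1; rewrite (le_trans (ler_normD _ _))// (_ : 2 = 1 + 1)// lerD.
by apply: lerD; apply: ler_pM => //; exact: h.
Qed.

End averages.

(** * Convolutions of digit sets and their spectra *)

Section masks.
Context {R : realType}.

Definition digits (B : {fset int}) : seq R := [seq b%:~R | b <- B].

Lemma size_digits B : size (digits B) = #|` B|.
Proof. by rewrite size_map. Qed.

Lemma digits_uniq B : uniq (digits B).
Proof. by rewrite map_inj_uniq ?fset_uniq//; exact: intr_inj. Qed.

Lemma digits0 (B : {fset int}) : 0 \in B -> 0 \in digits B.
Proof. by move=> b0; apply/mapP; exists 0. Qed.

(** The form in which admissibility is used: Parseval's identity, for the
    uniform measure on the digits and the characters indexed by L / N, at the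
    character indexed by - t / N. *)
Definition spectral_digits N B := [/\ (2 <= N)%N, (2 <= #|` B|)%N &
  exists L : seq int, [/\ size L = #|` B|, 0 \in L &
    forall t, \sum_(l <- L) sqn (ft (digits B) ((t + l%:~R) / N%:R)) = 1]].

(** Unitarity of the matrix M of an admissible pair preserves the norm of the
    unit row v = (e(b t / N) / sqrt #B)_b, and the entries of v M are the
    values of the transform of the digits on a translate of L / N. *)
Lemma admissible_spectral N B : admissible_pair R N B -> spectral_digits N B.
Proof.
move=> [N2 B2 [L [LB /unitarymxP]]]; set M := (X in X *m _ = _) => MM.
have key t : \sum_(l <- L) sqn (ft (digits B) ((t - l%:~R) / N%:R)) = 1.
  pose sq : R := (Num.sqrt (#|` B|%:R : R))^-1.
  pose v := \row_(i < #|` B|)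
    (sq%:C%C * cexp2pi ((nth 0 B i)%:~R * t / N%:R)) : 'rV[R[i]]_(#|` B|).
  have sq2 : sq * sq = #|` B|%:R^-1.
    by rewrite -invfM -expr2 sqr_sqrtr.
  have vv : complex.Re ((v *m v ^t*)%sesqui 0 0) = 1.
    rewrite mxE Re_sum (eq_bigr (fun=> #|` B|%:R^-1)) => [|i _].
      rewrite sumr_const card_ord -[LHS]mulr_natl mulfV// pnatr_eq0; lia.
    by rewrite !mxE -sqnE sqnZ sqn_cexp2pi mulr1 expr2 sq2.
  have vM : (v *m M *m (v *m M) ^t*)%sesqui = (v *m v ^t*)%sesqui.
    by rewrite trmx_mul map_mxM mulmxA -(mulmxA v) MM mulmx1.
  rewrite -[RHS]vv -vM mxE Re_sum (big_nth 0) big_mkord; apply: eq_bigr => j _.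
  rewrite !mxE -sqnE; congr sqn.
  rewrite /ft size_digits big_map (big_nth 0) big_mkord big_distrr/=.
  apply: eq_bigr => i _; rewrite !mxE mulrACA -rmorphM/= sq2; congr (_ * _).
  rewrite -cexp2piD; congr cexp2pi; ring.
split=> //; exists [seq (nth 0 L 0) - l | l <- L]; split.
- by rewrite size_map.
- apply/mapP; exists (nth 0 L 0); last by rewrite subrr.
  by apply: mem_nth; change (0 < #|` L|)%N; lia.
move=> t; rewrite big_map -[RHS](key (t + (nth 0 L 0)%:~R)).
by apply: eq_bigr => l _; rewrite intrB addrA.
Qed.

(** If L is a spectrum for N, then N ^ (n - 1) L is one for N ^ n. *)
Lemma spectral_digits_expn N B n : spectral_digits N B -> (0 < n)%N ->
  spectral_digits (N ^ n) B.
Proof.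
move=> [N2 B2 [L [LB L0 HL]]]; case: n => // n _.
have N0 : N%:R != 0 :> R by rewrite pnatr_eq0; lia.
split=> //.
  by rewrite (leq_trans N2)// -{1}(expn1 N) leq_pexp2l//; lia.
exists [seq (N ^ n)%:Z * l | l <- L]; split; first by rewrite size_map.
  by apply/mapP; exists 0; rewrite ?mulr0.
move=> t; rewrite big_map -[RHS](HL (t / N%:R ^+ n)); apply: eq_bigr => l _.
congr (sqn (ft _ _)); rewrite intrM -pmulrn !natrX exprS.
by field; rewrite N0 expf_neq0.
Qed.

End masks.

Section sequences.
Context {R : realType}.
Local Notation e := (@cexp2pi R).
Implicit Types (Q : nat -> nat) (B : nat -> {fset int}) (m k : nat).

Definition denom Q k : R := \prod_(i < k) (Q i)%:R.

Fixpoint atoms Q B k : seq R :=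
  if k is k'.+1 then
    [seq x + y | x <- atoms Q B k', y <- [seq b / denom Q k | b <- digits (B k')]]
  else [:: 0].

Definition shift (T : Type) m (u : nat -> T) : nat -> T := fun i => u (m + i)%N.

(** The data of an infinite convolution whose k-th factor is uniform on the
    quotients of B k by Q 0 ... Q k; C controls the support. *)
Definition hadamard (C : R) Q B := forall i, [/\ @spectral_digits R (Q i) (B i),
  0 \in B i & forall b, b \in B i -> 0 <= b /\ b%:~R <= C * (Q i)%:R].

Lemma hadamard_shift C Q B m : hadamard C Q B -> hadamard C (shift m Q) (shift m B).
Proof. by move=> QB i; exact: QB. Qed.

Lemma shift0 (T : Type) (u : nat -> T) : shift 0 u = u.
Proof. by []. Qed.

Lemma shiftD (T : Type) m k (u : nat -> T) : shift k (shift m u) = shift (m + k) u.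
Proof. by apply/funext => i; rewrite /shift addnA. Qed.

Lemma denom0 Q : denom Q 0 = 1.
Proof. by rewrite /denom big_ord0. Qed.

Lemma denomS Q k : denom Q k.+1 = denom Q k * (Q k)%:R.
Proof. by rewrite /denom big_ord_recr. Qed.

Lemma denom_shift Q m k : denom Q (m + k) = denom Q m * denom (shift m Q) k.
Proof.
by elim: k => [|k IH]; rewrite ?addn0 ?denom0 ?mulr1// addnS !denomS IH mulrA.
Qed.

Section hadamard.
Variables (C : R) (Q : nat -> nat) (B : nat -> {fset int}).
Hypothesis QB : hadamard C Q B.

Lemma hadamard_Q i : (2 <= Q i)%N. Proof. by have [[]] := QB i. Qed.
Lemma hadamard_B i : (2 <= #|` B i|)%N. Proof. by have [[]] := QB i. Qed.
Lemma hadamard_C : 0 <= C.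
Proof.
have [_ /[swap] + B0] := QB 0 => /(_ _ B0)[_]; rewrite pmulr_lge0//.
by rewrite ltr0n (leq_trans _ (hadamard_Q 0)).
Qed.

Lemma denom_ge k : 2 ^+ k <= denom Q k.
Proof.
elim: k => [|k IH]; first by rewrite denom0.
by rewrite denomS exprSr ler_pM// ?exprn_ge0// ler_nat hadamard_Q.
Qed.

Lemma denom_gt0 k : 0 < denom Q k.
Proof. by rewrite (lt_le_trans _ (denom_ge k))// exprn_gt0. Qed.

Lemma denom_neq0 k : denom Q k != 0. Proof. by rewrite gt_eqF ?denom_gt0. Qed.

Lemma size_atoms k : size (atoms Q B k) = (\prod_(i < k) #|` B i|)%N.
Proof.
elim: k => [|k IH]; first by rewrite big_ord0.
by rewrite /= size_allpairs IH size_map size_digits big_ord_recr.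
Qed.

Lemma size_atoms_gt0 k : (0 < size (atoms Q B k))%N.
Proof.
rewrite size_atoms prodn_gt0// => i.
by rewrite (leq_trans _ (hadamard_B i)).
Qed.

Lemma ft_atomsS k x :
  ft (atoms Q B k.+1) x = ft (atoms Q B k) x * ft (digits (B k)) (x / denom Q k.+1).
Proof. by rewrite /= ft_add ft_scale. Qed.

Lemma mem_atomsS k t : t \in atoms Q B k.+1 ->
  exists x b, [/\ x \in atoms Q B k, b \in B k & t = x + b%:~R / denom Q k.+1].
Proof.
by move=> /allpairsP[[x y] /= [xk /mapP[_ /mapP[b bB ->] ->] ->]]; exists x, b.
Qed.

Lemma atoms_bound k t : t \in atoms Q B k -> 0 <= t <= 2 * C.
Proof.
have C0 := hadamard_C.
suff : forall t, t \in atoms Q B k -> 0 <= t <= 2 * C * (1 - 2 ^- k).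
  move=> /[apply] /andP[-> /=] /le_trans; apply.
  by rewrite ler_piMr ?mulr_ge0// gerBl.
elim: k {t} => [t|k IH t].
  by rewrite mem_seq1 => /eqP ->; rewrite expr0 invr1 subrr mulr0 lexx.
move=> /mem_atomsS[x [b [/IH/andP[x0 xC] bB ->]]].
have [_ _ /(_ _ bB)[b0 bC]] := QB k.
rewrite addr_ge0//=; last by rewrite divr_ge0 ?ler0z// ltW ?denom_gt0.
have h : b%:~R / denom Q k.+1 <= C * 2 ^- k.
  rewrite ler_pdivrMr ?denom_gt0// (le_trans bC)// denomS mulrA.
  rewrite ler_wpM2r//; rewrite -mulrA ler_peMr// -ler_pdivrMl ?invr_gt0 ?exprn_gt0//.
  by rewrite invrK mulr1 denom_ge.
rewrite (le_trans (lerD xC h))// exprS invfM.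
by rewrite le_eqVlt; apply/orP; left; apply/eqP; field; rewrite expf_neq0.
Qed.

Lemma ft_atoms0 k : ft (atoms Q B k) 0 = 1.
Proof. by rewrite ft0 ?size_atoms_gt0. Qed.

Lemma atoms_lattice (d : int) k t :
  (forall i b, b \in B i -> (d %| b)%Z) -> t \in atoms Q B k ->
  exists z : int, t * denom Q k = z%:~R * d%:~R.
Proof.
move=> dB; elim: k t => [t|k IH t].
  by rewrite mem_seq1 => /eqP ->; exists 0; rewrite !mul0r.
move=> /mem_atomsS[x [b [/IH[z xz] /dB/dvdzP[y ->] ->]]].
exists (z * (Q k)%:Z + y); rewrite mulrDl divfK ?denom_neq0// denomS mulrA xz.
by rewrite intrD !intrM -pmulrn; ring.
Qed.

(** All atoms are in d Z / denom Q m. *)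
Lemma ft_atoms_periodic (d : int) m x (k : int) : d != 0 ->
  (forall i b, b \in B i -> (d %| b)%Z) ->
  ft (atoms Q B m) (x + denom Q m * (k%:~R / d%:~R)) = ft (atoms Q B m) x.
Proof.
move=> d0 dB; apply: ft_periodic => t /(atoms_lattice dB)[z tz].
rewrite (_ : _ * t = (k * z)%:~R) ?cexp2pi_int//.
rewrite (_ : _ * t = k%:~R / d%:~R * (t * denom Q m)); last by ring.
by rewrite tz intrM; field; rewrite intr_eq0.
Qed.

Lemma ft_atoms_periodic1 m x (k : int) :
  ft (atoms Q B m) (x + denom Q m * k%:~R) = ft (atoms Q B m) x.
Proof.
rewrite -[RHS](@ft_atoms_periodic 1 m x k)//; by rewrite divr1.
Qed.

(** Jorgensen--Pedersen condition: s is a spectrum of the uniform measure on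
    atoms Q B m as soon as these squares add up to 1. *)
Definition spec m (s : seq R) :=
  forall x, \sum_(l <- s) sqn (ft (atoms Q B m) (x + l)) = 1.

Lemma spec0 : spec 0 [:: 0].
Proof.
by move=> x; rewrite big_seq1 /ft /= big_seq1 invr1 mul1r sqn_cexp2pi.
Qed.

(** Take the products with a spectrum L of the next digit set scaled by denom Q m:
    translating by denom Q m L leaves the transform of the first m factors
    unchanged, so that the sum over L can be carried out first. *)
Lemma spec_step m s : spec m s -> exists L : seq int,
  [/\ size L = #|` B m|, 0 \in L &
    spec m.+1 [seq l + denom Q m * l'%:~R | l <- s, l' <- L]].
Proof.
move=> sm; have [[_ _ [L [LB L0 HL]]] _ _] := QB m.
exists L; split => // x; rewrite big_allpairs_dep -[RHS](sm x).
apply: eq_bigr => l _.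
under eq_bigr do rewrite ft_atomsS sqnM addrA ft_atoms_periodic1.
rewrite -big_distrr/= -[RHS]mulr1; congr (_ * _).
rewrite -[RHS](HL ((x + l) / denom Q m)); apply: eq_bigr => j _; congr (sqn (ft _ _)).
by rewrite denomS; field; rewrite denom_neq0 pnatr_eq0 -lt0n (leq_trans _ (hadamard_Q m)).
Qed.

(** Since 0 belongs to the spectra of the digit sets, longer products have
    spectra containing the given one. *)
Lemma spec_extend m k s : spec m s ->
  exists s', {subset s <= s'} /\ spec (m + k) s'.
Proof.
move=> sm; elim: k => [|k [s' [ss' /spec_step[L [_ L0 HL]]]]].
  by exists s; split => //; rewrite addn0.
exists [seq l + denom Q (m + k) * l'%:~R | l <- s', l' <- L]; split.
  move=> l /ss' ls'; apply/allpairsP; exists (l, 0) => /=; split => //.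
  by rewrite mulr0 addr0.
by rewrite addnS.
Qed.

Lemma spec_int k : exists s : seq int,
  size s = (\prod_(i < k) #|` B i|)%N /\ spec k [seq l%:~R | l <- s].
Proof.
elim: k => [|k [s [sk /spec_step[L [LB _ HL]]]]].
  by exists [:: 0]; rewrite big_ord0; split => //; exact: spec0.
have [z Hz] : exists z : int, denom Q k = z%:~R.
  by exists (\prod_(i < k) (Q i)%:Z); rewrite rmorph_prod.
exists [seq l + z * l' | l <- s, l' <- L]; split.
  by rewrite size_allpairs sk LB big_ord_recr.
move: HL; rewrite allpairs_mapl map_allpairs; congr (spec _ _).
apply: eq_allpairs => //.
by move=> l l'; rewrite intrD intrM Hz.
Qed.

(** The freedom used to place the points of a spectrum where the transform of
    the remaining factors is not small. *)
Lemma spec_translate (d : int) m s (g : R -> int) : d != 0 ->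
  (forall i b, b \in B i -> (d %| b)%Z) -> spec m s ->
  spec m [seq l + denom Q m * ((g l)%:~R / d%:~R) | l <- s].
Proof.
move=> d0 dB sm x; rewrite big_map -[RHS](sm x); apply: eq_bigr => l _.
by rewrite addrA (ft_atoms_periodic _ _ _ d0).
Qed.

(** At x = - l each occurrence of l contributes 1 to a sum equal to 1. *)
Lemma spec_uniq m s : spec m s -> uniq s.
Proof.
move=> sm; apply: count_mem_uniq => l.
have [ls|/count_memPn//] := boolP (l \in s).
apply/eqP; rewrite eqn_leq -has_count; apply/andP; split; last first.
  by apply/hasP; exists l => /=.
rewrite -(ler_nat R) -[leRHS](sm (- l)) (bigID (pred1 l))/=.
rewrite (eq_bigr (fun=> 1%:R)) => [|i /eqP ->]; last first.
  by rewrite addNr ft_atoms0 sqn1.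
rewrite -natr_sum sum1_count lerDl.
by apply: sumr_ge0 => i _; exact: sqn_ge0.
Qed.

(** At x = - l' the term of l' is already 1, so all others vanish. *)
Lemma spec_orthogonal m s l l' : spec m s -> l \in s -> l' \in s -> l != l' ->
  ft (atoms Q B m) (l - l') = 0.
Proof.
move=> sm ls l's ll'; have us := spec_uniq sm.
move: (sm (- l')); rewrite (bigD1_seq l')//= addNr ft_atoms0 sqn1.
move=> /(canRL (addKr _)); rewrite addNr => /eqP.
rewrite psumr_eq0 => [/allP/(_ l ls)|*]; last exact: sqn_ge0.
by rewrite ll' => /eqP/sqn_eq0; rewrite addrC.
Qed.

End hadamard.

Lemma ft_atoms_shift C Q B m k x : hadamard C Q B ->
  ft (atoms Q B (m + k)) x =
  ft (atoms Q B m) x * ft (atoms (shift m Q) (shift m B) k) (x / denom Q m).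
Proof.
move=> QB; elim: k => [|k IH].
  have ft1 y : ft [:: 0] y = 1 by rewrite /ft /= big_seq1 invr1 mulr0 cexp2pi0 mul1r.
  by rewrite addn0 /= ft1 mulr1.
rewrite addnS ft_atomsS// IH ft_atomsS -?mulrA//.
by rewrite -addnS denom_shift invfM (mulrA x).
Qed.

End sequences.

(** * Bounded functions on a probability space *)

Section bounded_functions.
Context d (T : measurableType d) (R : realType) (P : probability T R).
Implicit Types f g : T -> R.

Lemma bounded_integrable f C : measurable_fun setT f ->
  (forall x, `|f x| <= C) -> P.-integrable setT (EFin \o f).
Proof.
move=> mf fC; apply: measurable_bounded_integrable => //.
  by rewrite ltey_eq fin_num_measure.
by exists C; split; [exact: num_real|move=> M CM x _; exact: le_trans (fC x) (ltW CM)].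
Qed.

Lemma Rintegral_cst_prob (c : R) : \int[P]_x c = c.
Proof.
by rewrite /Rintegral integral_cst//= probability_setT mule1.
Qed.

Lemma bounded_cvg_Rintegral (f_ : nat -> T -> R) f C :
  (forall k, measurable_fun setT (f_ k)) -> (forall k x, `|f_ k x| <= C) ->
  (forall x, f_ k x @[k --> \oo] --> f x) ->
  measurable_fun setT f /\ \int[P]_x f_ k x @[k --> \oo] --> \int[P]_x f x.
Proof.
move=> mf_ f_C f_f.
have mf : measurable_fun setT f.
  by apply: (measurable_fun_cvg mf_) => x _; exact: f_f.
split => //.
have [|||||intf _ cf] := @dominated_convergence _ _ _ P setT measurableT
    (fun k => EFin \o f_ k) (EFin \o f) (EFin \o cst C).
- by move=> k; exact/measurable_EFinP.
- exact/measurable_EFinP.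
- by apply: aeW => x _; apply/cvg_EFin; [exact: nearW|exact: f_f].
- exact: finite_measure_integrable_cst.
- by apply: aeW => x k _ /=; rewrite lee_fin.
apply: fine_cvg; rewrite /Rintegral fineK//.
exact: integrable_fin_num.
Qed.

Lemma Rintegral_sum_indic (I : eqType) (r : seq I) (c : I -> R) (E : I -> set T) :
  (forall i, i \in r -> measurable (E i)) ->
  \int[P]_x (\sum_(i <- r) c i * \1_(E i) x) = \sum_(i <- r) c i * fine (P (E i)).
Proof.
elim: r => [|i r IH] mE.
  by under eq_Rintegral do rewrite big_nil; rewrite Rintegral_cst_prob big_nil.
have mEr j : j \in r -> measurable (E j).
  by move=> jr; apply: mE; rewrite inE jr orbT.
have mEi : measurable (E i) by apply: mE; rewrite mem_head.
have intI A : measurable A -> P.-integrable setT (EFin \o \1_A).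
  by move=> mA; exact: integrable_indic.
under eq_Rintegral do rewrite big_cons.
rewrite RintegralD//; last 2 first.
- rewrite (_ : _ \o _ = fun x => (c i)%:E * (EFin \o \1_(E i)) x)%E//.
  exact/integrableZl/intI.
- rewrite (_ : _ \o _ = fun x => (\sum_(j <- r)
      (if j \in r then (c j)%:E * (EFin \o \1_(E j)) x else 0))%E); last first.
    apply/funext => x /=; rewrite -sumEFin; apply: eq_big_seq => j jr.
    by rewrite jr.
  apply: integrable_sum => // j _; have [jr|_] := boolP (j \in r); last exact: integrable0.
  exact/integrableZl/intI/mEr.
rewrite IH// big_cons RintegralZl//; last exact: intI.
by rewrite /Rintegral integral_indic// setIT.
Qed.

End bounded_functions.

(** * Existence of the infinite convolution *)

Lemma nth_allpairs (S T U : Type) (f : S -> T -> U) s r x0 y0 z0 i j :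
  (i < size s)%N -> (j < size r)%N ->
  nth z0 [seq f x y | x <- s, y <- r] (i * size r + j) =
  f (nth x0 s i) (nth y0 r j).
Proof.
elim: s i => // x s IH [|i] /=; rewrite ?ltnS => si rj.
  by rewrite mul0n add0n nth_cat size_map rj (nth_map y0).
rewrite nth_cat size_map mulSn -addnA ltnNge leq_addr/= addKn.
exact: IH.
Qed.

Definition unit_leb (R : realType) : set R -> \bar R :=
  mrestr (@lebesgue_measure R) (measurable_itv `[0, 1[).

Section unit_leb.
Variable R : realType.

Let unit_leb0 : @unit_leb R set0 = 0%E.
Proof. by rewrite /unit_leb measure0. Qed.

Let unit_leb_ge0 A : (0 <= @unit_leb R A)%E.
Proof. exact: measure_ge0. Qed.

Let unit_leb_sigma_additive : semi_sigma_additive (@unit_leb R).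
Proof.
exact: (@measure_semi_sigma_additive _ _ _
  (mrestr (@lebesgue_measure R) (measurable_itv `[0, 1[))).
Qed.

HB.instance Definition _ := isMeasure.Build _ _ _ (@unit_leb R)
  unit_leb0 unit_leb_ge0 unit_leb_sigma_additive.

Let unit_leb_setT : @unit_leb R setT = 1%E.
Proof.
by rewrite /unit_leb /mrestr setTI lebesgue_measure_itv/= lte01 oppr0 adde0.
Qed.

HB.instance Definition _ := Measure_isProbability.Build _ _ R
  (@unit_leb R) unit_leb_setT.

End unit_leb.

Section random_digits.
Context {R : realType}.

Let clip (u : R) : R := if 0 <= u < 1 then u else 0.

Let clip_itv u : 0 <= clip u < 1.
Proof. by rewrite /clip; case: ifPn => // _; rewrite lexx ltr01. Qed.

Let clipE : clip = fun u => u * \1_(`[0, 1[%classic : set R) u.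
Proof.
apply/funext => u; rewrite /clip indicE mem_setE in_itv/=.
by case: ifP => _; rewrite ?mulr1 ?mulr0.
Qed.

Let mclip : measurable_fun setT clip.
Proof. by rewrite clipE; apply: measurable_funM => //; exact: measurable_indic. Qed.

(** Under Lebesgue measure on the unit interval, [rank q] is uniform on
    {0, ..., q - 1}; the quotient of [rank (q b) u] by b is [rank q u], so that
    one u indexes compatible atoms at all levels. *)
Definition rank (q : nat) (u : R) : nat := Num.truncn (clip u * q%:R).

Lemma rank_eq q u i : (0 < q)%N ->
  (rank q u == i) = (i%:R / q%:R <= clip u < i.+1%:R / q%:R).
Proof.
move=> q0; have /andP[u0 _] := clip_itv u.
by rewrite /rank truncn_eq ?mulr_ge0// ler_pdivrMr ?ltr0n// ltr_pdivlMr ?ltr0n.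
Qed.

Lemma rank_lt q u : (0 < q)%N -> (rank q u < q)%N.
Proof.
move=> q0; have /andP[u0 u1] := clip_itv u.
by rewrite /rank truncn_lt_nat ?mulr_ge0// gtr_pMl// ltr0n.
Qed.

Lemma rankM q b u : (0 < q)%N -> (0 < b)%N -> (rank (q * b) u %/ b)%N = rank q u.
Proof.
move=> q0 b0; apply/eqP; rewrite eq_sym rank_eq//.
have /andP[+ +] : (rank (q * b) u)%:R / (q * b)%:R <= clip u <
   (rank (q * b) u).+1%:R / (q * b)%:R.
  by rewrite -rank_eq// muln_gt0 q0.
set j := rank _ _ => h1 h2; have qb0 : 0 < (q * b)%:R :> R.
  by rewrite ltr0n muln_gt0 q0.
apply/andP; split.
  rewrite (le_trans _ h1)// ler_pdivlMr// mulrC mulrA.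
  rewrite ler_pdivrMr ?ltr0n// -!natrM ler_nat.
  have := leq_trunc_div j b; nia.
rewrite (lt_le_trans h2)// ler_pdivrMr// mulrAC ler_pdivlMr ?ltr0n//.
rewrite -!natrM ler_nat; have := ltn_ceil j b0; nia.
Qed.

Lemma measurable_rank q i : (0 < q)%N -> measurable [set u | rank q u = i].
Proof.
move=> q0; rewrite (_ : [set _ | _] =
    setT `&` clip @^-1` `[i%:R / q%:R, i.+1%:R / q%:R[%classic).
  exact: mclip.
rewrite setTI; apply/seteqP; split => u /=; rewrite in_itv/= -rank_eq//.
  by move=> ->.
by move/eqP.
Qed.

Lemma rank_law q i : (i < q)%N -> unit_leb [set u : R | rank q u = i] = (q%:R^-1)%:E.
Proof.
move=> iq; have q0 : (0 < q)%N by apply: leq_ltn_trans iq.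
rewrite /unit_leb /mrestr.
have qR0 : 0 < q%:R :> R by rewrite ltr0n.
rewrite (_ : _ `&` _ = `[i%:R / q%:R, i.+1%:R / q%:R[%classic); last first.
  apply/seteqP; split => u /=; rewrite !in_itv/=.
    by move=> [/eqP + u01]; rewrite rank_eq// /clip u01.
  move=> /[dup]/andP[h1 h2] h; have u01 : 0 <= u < 1.
    rewrite (le_trans _ h1) ?divr_ge0//=.
    by rewrite (lt_le_trans h2)// ler_pdivrMr// mul1r ler_nat.
  by split => //; apply/eqP; rewrite rank_eq// /clip u01.
rewrite lebesgue_measure_itv/= lte_fin ltr_pM2r ?invr_gt0// ltr_nat ltnSn.
by rewrite -EFinD -mulrBl -natr1 addrAC subrr add0r mul1r.
Qed.

Lemma measurable_fun_rank q (h : nat -> R) : (0 < q)%N ->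
  measurable_fun setT (fun u => h (rank q u)) /\
  (fun u => h (rank q u)) =
    (fun u => \sum_(i <- iota 0 q) h i * \1_[set u | rank q u = i] u).
Proof.
move=> q0.
have E : (fun u => h (rank q u)) =
    (fun u => \sum_(i <- iota 0 q) h i * \1_[set u | rank q u = i] u).
  apply/funext => u; rewrite (bigD1_seq (rank q u)) ?iota_uniq//=; last first.
    by rewrite mem_iota /= add0n rank_lt.
  rewrite indicE mem_set//= mulr1 big1 ?addr0// => i iu.
  by rewrite indicE memNset ?mulr0//= => /esym/eqP; rewrite (negbTE iu).
split => //; rewrite E.
apply: measurable_sum => i; apply: measurable_funM => //.
by apply: measurable_indic; exact: measurable_rank.
Qed.

Lemma Rintegral_rank q (h : nat -> R) : (0 < q)%N ->
  \int[@unit_leb R]_u h (rank q u) = q%:R^-1 * \sum_(i <- iota 0 q) h i.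
Proof.
move=> q0; have [_ ->] := measurable_fun_rank h q0.
rewrite (Rintegral_sum_indic _ h (E := fun i => [set u | rank q u = i])) => [|i _]; last first.
  exact: measurable_rank.
rewrite big_distrr/= big_seq [RHS]big_seq; apply: eq_bigr => i.
rewrite mem_iota/= add0n => iq.
by rewrite (rank_law iq)/= mulrC.
Qed.

Variables (C : R) (Q : nat -> nat) (B : nat -> {fset int}).
Hypothesis QB : hadamard C Q B.

Let q k := size (atoms (R := R) Q B k).
Let X k (u : R) : R := nth 0 (atoms Q B k) (rank (q k) u).

Let q0 k : (0 < q k)%N. Proof. exact: (size_atoms_gt0 QB). Qed.

Let X_mem k u : X k u \in atoms Q B k.
Proof. by rewrite mem_nth// rank_lt. Qed.

(** Numbering the atoms lexicographically, the descendants of the j-th atom of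
    level k are those of rank j b, ..., j b + b - 1 at level k + 1, where b is
    the number of digits; they are to the right of their parent. *)
Let X_nd u : {homo X ^~ u : m k / (m <= k)%N >-> m <= k}.
Proof.
apply: homo_leq => [//|? ? ?|k]; first exact: le_trans.
have b0 : (0 < #|` B k|)%N by rewrite (leq_trans _ (hadamard_B QB k)).
have qS : q k.+1 = (q k * #|` B k|)%N.
  by rewrite /q /= size_allpairs size_map size_digits.
rewrite /X; set j := rank (q k.+1) u.
have jE : (j %/ #|` B k| = rank (q k) u)%N by rewrite /j qS rankM.
have jlt : (j %% #|` B k| < #|` B k|)%N by rewrite ltn_mod.
rewrite (divn_eq j #|` B k|) jE /=; move: (j %% _)%N jlt => {jE} c cB.
have sB : #|` B k| = size [seq b / denom Q k.+1 | b <- digits (R := R) (B k)].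
  by rewrite size_map size_digits.
rewrite sB in cB *; rewrite (nth_allpairs _ 0 0)//; last exact: rank_lt.
rewrite lerDl.
have /mapP[_ /mapP[b bB ->] ->] : nth 0 [seq b / denom Q k.+1 | b <- digits (R := R) (B k)]
    c \in [seq b / denom Q k.+1 | b <- digits (R := R) (B k)].
  by rewrite mem_nth.
have [_ _ /(_ _ bB)[b_ge0 _]] := QB k.
by rewrite divr_ge0 ?ler0z// ltW// (denom_gt0 QB).
Qed.

(** The atoms indexed by the ranks of a uniform random variable u form a
    nondecreasing bounded sequence; its limit has the wanted law. *)
Lemma weak_limit_exists : exists nu : probability R R,
  forall g : R -> R, continuous g -> bounded_fun g ->
    avg (atoms Q B k) g @[k --> \oo] --> \int[nu]_x g x.
Proof.
have cX u : cvgn (X ^~ u).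
  apply: (nondecreasing_is_cvgn (X_nd u)).
  by exists (2 * C) => _ [k _ <-]; have /andP[] := atoms_bound QB (X_mem k u).
pose Y u := limn (X ^~ u).
have mX k : measurable_fun setT (X k).
  by have [] := measurable_fun_rank (nth 0 (atoms Q B k)) (q0 k).
have mY : measurable_fun setT Y.
  by apply: (measurable_fun_cvg mX) => u _; exact: cX.
pose Ym : {mfun R >-> R} := HB.pack Y (isMeasurableFun.Build _ _ _ _ Y mY).
exists (distribution (@unit_leb R) Ym) => g cg [M [_ gM]].
have gM1 x : `|g x| <= `|M| + 1.
  by apply: gM => //; rewrite ltr_pwDr// ler_norm.
have mg : measurable_fun setT g by exact: continuous_measurable_fun.
have -> : \int[distribution (@unit_leb R) Ym]_x g x = \int[@unit_leb R]_u g (Y u).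
  rewrite /Rintegral integral_pushforward//.
    exact/measurable_EFinP.
  apply: (@bounded_integrable _ _ _ _ (g \o Y) (`|M| + 1)) => [|x]; last exact: gM1.
  exact: measurableT_comp.
have [_ cv] := @bounded_cvg_Rintegral _ _ _ (@unit_leb R) (fun k => g \o X k) (g \o Y)
  (`|M| + 1) (fun k => measurableT_comp mg (mX k)) (fun k x => gM1 _)
  (fun u => cvg_comp _ _ (cX u) (cg (Y u))).
rewrite (_ : (fun k => avg (atoms Q B k) g) =
  (fun k => \int[@unit_leb R]_u (g \o X k) u)); first exact: cv.
apply/funext => k; rewrite (@Rintegral_rank _ (fun i => g (nth 0 (atoms Q B k) i)))//.
by rewrite /avg (big_nth 0) /index_iota subn0.
Qed.

End random_digits.

(** * Transform of the infinite convolution *)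

Section transform.
Context {R : realType}.

Lemma cvg_norm_le (u : nat -> R) (l c : R) :
  u k @[k --> \oo] --> l -> (forall k, `|u k| <= c) -> `|l| <= c.
Proof.
move=> ul uc; have ul' : `|u k| @[k --> \oo] --> `|l| by exact: cvg_norm.
rewrite -(cvg_lim _ ul')//; apply: limr_le; last exact: nearW.
by apply/cvg_ex; exists `|l|.
Qed.

Lemma cvg_unique_nat (u : nat -> R) (a b : R) :
  u k @[k --> \oo] --> a -> u k @[k --> \oo] --> b -> a = b.
Proof. by move=> ua ub; rewrite -(cvg_lim _ ua)// (cvg_lim _ ub). Qed.

Lemma cvg_natshift (u : nat -> R) m (l : R) :
  u k @[k --> \oo] --> l -> u (m + k)%N @[k --> \oo] --> l.
Proof.
move=> ul; rewrite (_ : (fun k => u (m + k)%N) = (fun k => u (k + m)%N)).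
  by rewrite cvg_shiftn.
by apply/funext => k; rewrite addnC.
Qed.

(** The transform of the infinite convolution, defined without the measure so
    that it applies to all shifts of Q and B. *)
Definition ftl (Q : nat -> nat) (B : nat -> {fset int}) (x : R) : R[i] :=
  (limn (fun k => complex.Re (ft (atoms Q B k) x)) +i*
   limn (fun k => complex.Im (ft (atoms Q B k) x)))%C.

Definition charf (nu : probability R R) (x : R) : R[i] :=
  cRintegral nu (fun t => cexp2pi (x * t)).

Lemma continuous_cos_lin (x : R) : continuous (fun t => cos (2 * pi * (x * t))).
Proof.
move=> t; apply: continuous_comp; last exact: continuous_cos.
apply: cvgM; first exact: cvg_cst.
by apply: cvgM; [exact: cvg_cst|exact: cvg_id].
Qed.

Lemma continuous_sin_lin (x : R) : continuous (fun t => sin (2 * pi * (x * t))).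
Proof.
move=> t; apply: continuous_comp; last exact: continuous_sin.
apply: cvgM; first exact: cvg_cst.
by apply: cvgM; [exact: cvg_cst|exact: cvg_id].
Qed.

Lemma bounded_fun_le (f : R -> R) (c : R) : (forall x, `|f x| <= c) -> bounded_fun f.
Proof.
by move=> fc; exists c; split; [exact: num_real|move=> M /ltW cM x _; exact: le_trans cM].
Qed.

Variables (C : R) (Q : nat -> nat) (B : nat -> {fset int}).

Section weak_limit.
Variable nu : probability R R.
Hypothesis nuP : forall g : R -> R, continuous g -> bounded_fun g ->
  avg (atoms Q B k) g @[k --> \oo] --> \int[nu]_x g x.

Lemma Re_ft_atoms_cvg x :
  complex.Re (ft (atoms Q B k) x) @[k --> \oo] --> complex.Re (charf nu x).
Proof.
under eq_fun do rewrite Re_ft.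
apply: nuP; first exact: continuous_cos_lin.
by apply: (bounded_fun_le (c := 1)) => t; exact: cos_max.
Qed.

Lemma Im_ft_atoms_cvg x :
  complex.Im (ft (atoms Q B k) x) @[k --> \oo] --> complex.Im (charf nu x).
Proof.
under eq_fun do rewrite Im_ft.
apply: nuP; first exact: continuous_sin_lin.
by apply: (bounded_fun_le (c := 1)) => t; exact: sin_max.
Qed.

Lemma charf_ftl x : charf nu x = ftl Q B x.
Proof.
apply: complexP => /=; apply/esym/cvg_lim => //; first exact: Re_ft_atoms_cvg.
exact: Im_ft_atoms_cvg.
Qed.

(** Testing against the continuous function min (1, max (0, - t, t - 2 C)) shows
    that the limit does not charge the complement of an interval containing
    all atoms. *)
Lemma weak_limit_support : hadamard C Q B -> nu (~` `[0, 2 * C]%classic) = 0%E.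
Proof.
move=> QB.
pose g (t : R) := Num.min 1 (Num.max 0 (Num.max (- t) (t - 2 * C))).
have g0 t : 0 <= g t by rewrite /g le_min ler01 le_max lexx.
have g1 t : g t <= 1 by rewrite /g ge_min lexx.
have cg : continuous g.
  move=> t.
  apply: (@continuous_min R R (cst 1)
    (fun t => Num.max 0 (Num.max (- t) (t - 2 * C)))).
    exact: cst_continuous.
  apply: (@continuous_max R R (cst 0) (fun t => Num.max (- t) (t - 2 * C))).
    exact: cst_continuous.
  apply: (@continuous_max R R (fun t => - t) (fun t => t - 2 * C)).
    by apply: cvgN; exact: cvg_id.
  by apply: cvgB; [exact: cvg_id|exact: cvg_cst].
have gb t : `|g t| <= 1 by rewrite ger0_norm.
have mg : measurable_fun setT g by exact: continuous_measurable_fun.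
have ig : \int[nu]_x g x = 0.
  apply: (cvg_unique_nat (nuP cg (bounded_fun_le gb))).
  rewrite (_ : (fun k => _) = cst 0); first exact: cvg_cst.
  apply/funext => k /=; rewrite /avg big_seq big1 ?mulr0// => t tk.
  have /andP[t0 tC] := atoms_bound QB tk.
  rewrite /g max_l ?min_r// ge_max oppr_le0 t0 subr_le0//.
have igE : (\int[nu]_x (g x)%:E = 0)%E.
  rewrite -(@fineK _ (\int[nu]_x (g x)%:E)%E).
    by move: ig; rewrite /Rintegral => ->.
  by apply: integrable_fin_num => //; exact: (bounded_integrable nu mg gb).
have : ae_eq nu setT (EFin \o g) (cst 0%E).
  apply/(ae_eq_integral_abs nu measurableT); first exact/measurable_EFinP.
  by rewrite -[RHS]igE; apply: eq_integral => t _; rewrite gee0_abs// lee_fin.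
move=> [A [mA A0 sA]]; apply/eqP; rewrite -measure_le0 -A0.
apply: le_measure; rewrite ?inE//; first exact: measurableC.
move=> t /= tC; apply: sA => /= /(_ I) [gt0]; apply: tC; rewrite in_itv/=.
move: gt0; rewrite /g; move: (2 * C) => a.
have [//|] := boolP (0 <= t <= a); rewrite negb_and -!ltNge => h.
move=> /eqP; rewrite gt_eqF// lt_min ltr01/= !lt_max.
by case/orP: h => h; rewrite ?oppr_gt0 ?subr_gt0 h ?orbT.
Qed.

End weak_limit.

Section hadamard.
Hypothesis QB : hadamard C Q B.

(** The transforms converge because the measures converge weakly. *)
Lemma Re_ftl_cvg x :
  complex.Re (ft (atoms Q B k) x) @[k --> \oo] --> complex.Re (ftl Q B x).
Proof.
have [nu nuP] := weak_limit_exists QB.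
by rewrite -(charf_ftl nuP); exact: Re_ft_atoms_cvg.
Qed.

Lemma Im_ftl_cvg x :
  complex.Im (ft (atoms Q B k) x) @[k --> \oo] --> complex.Im (ftl Q B x).
Proof.
have [nu nuP] := weak_limit_exists QB.
by rewrite -(charf_ftl nuP); exact: Im_ft_atoms_cvg.
Qed.

Lemma ftl0 : ftl Q B 0 = 1.
Proof.
by apply: complexP => /=; apply: cvg_lim => //;
  under eq_fun do rewrite (ft_atoms0 QB); exact: cvg_cst.
Qed.

Lemma Re_ftl_le1 x : `|complex.Re (ftl Q B x)| <= 1.
Proof. by apply: (cvg_norm_le (Re_ftl_cvg (x := x))) => k; exact: Re_ft_le1. Qed.

Lemma Im_ftl_le1 x : `|complex.Im (ftl Q B x)| <= 1.
Proof. by apply: (cvg_norm_le (Im_ftl_cvg (x := x))) => k; exact: Im_ft_le1. Qed.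

Lemma sqn_ft_ftl_cvg x :
  sqn (ft (atoms Q B k) x) @[k --> \oo] --> sqn (ftl Q B x).
Proof.
rewrite /sqn; under eq_fun do rewrite !expr2.
rewrite !expr2; apply: cvgD; apply: cvgM; first exact: Re_ftl_cvg.
- exact: Re_ftl_cvg.
- exact: Im_ftl_cvg.
- exact: Im_ftl_cvg.
Qed.

Lemma sqn_ftl_le1 x : sqn (ftl Q B x) <= 1.
Proof.
rewrite -[leLHS]ger0_norm ?sqn_ge0//; apply: (cvg_norm_le (sqn_ft_ftl_cvg (x := x))) => k.
by rewrite ger0_norm ?sqn_ge0// sqn_ft_le1.
Qed.

Lemma sqn_ftl_lip x y :
  `|sqn (ftl Q B x) - sqn (ftl Q B y)| <= 16 * pi * C * `|x - y|.
Proof.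
have C0 := hadamard_C QB.
rewrite (_ : 16 * pi * C * _ = 4 * (2 * pi * (2 * C) * `|x - y|)); last by ring.
apply: sqn_lip; rewrite ?Re_ftl_le1 ?Im_ftl_le1//.
  apply: (cvg_norm_le (cvgB (Re_ftl_cvg (x := x)) (Re_ftl_cvg (x := y)))) => k.
  by apply: Re_ft_lip; [exact: atoms_bound|rewrite mulr_ge0].
apply: (cvg_norm_le (cvgB (Im_ftl_cvg (x := x)) (Im_ftl_cvg (x := y)))) => k.
by apply: Im_ft_lip; [exact: atoms_bound|rewrite mulr_ge0].
Qed.

(** The real part of the transform is a mixture of the functions
    x |-> cos (2 pi x t) with t in the support. *)
Lemma Re_ftl_comb (I : Type) (r : seq I) (c z : I -> R) (K : R) : 0 <= K ->
  (forall t, 0 <= t <= 2 * C ->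
     `|\sum_(i <- r) c i * cos (2 * pi * (z i * t))| <= K) ->
  `|\sum_(i <- r) c i * complex.Re (ftl Q B (z i))| <= K.
Proof.
move=> K0 HK.
have : \sum_(i <- r) c i * complex.Re (ft (atoms Q B k) (z i)) @[k --> \oo] -->
       \sum_(i <- r) c i * complex.Re (ftl Q B (z i)).
  elim: r {HK} => [|i r IH].
    by under eq_fun do rewrite big_nil; rewrite big_nil; exact: cvg_cst.
  under eq_fun do rewrite big_cons; rewrite big_cons.
  by apply: cvgD => //; apply: cvgM; [exact: cvg_cst|exact: Re_ftl_cvg].
move=> /cvg_norm_le; apply => k; under eq_bigr do rewrite Re_ft.
rewrite avg_sumZ; apply: norm_avg_le => // t tk; apply: HK; exact: (atoms_bound QB tk).
Qed.

End hadamard.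
End transform.

Lemma ftl_shift (R : realType) (C : R) Q B m (x : R) : hadamard C Q B -> ftl Q B x =
  ft (atoms Q B m) x * ftl (shift m Q) (shift m B) (x / denom Q m).
Proof.
move=> QB; have QBm := hadamard_shift m QB.
apply: complexP.
  have := cvg_natshift m (Re_ftl_cvg QB (x := x)); move/cvg_unique_nat; apply.
  under eq_fun do rewrite (ft_atoms_shift m _ _ QB) ReM.
  rewrite ReM; apply: cvgB; apply: cvgM; do ?exact: cvg_cst.
    exact: (Re_ftl_cvg QBm).
  exact: (Im_ftl_cvg QBm).
have := cvg_natshift m (Im_ftl_cvg QB (x := x)); move/cvg_unique_nat; apply.
under eq_fun do rewrite (ft_atoms_shift m _ _ QB) ImM.
rewrite ImM; apply: cvgD; apply: cvgM; do ?exact: cvg_cst.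
  exact: (Im_ftl_cvg QBm).
exact: (Re_ftl_cvg QBm).
Qed.

(** * Lagrange interpolation of cosines *)

Section interpolation.
Context {R : realType}.

(** Iterated Rolle theorem. *)
Lemma iterated_Rolle (G : nat -> R -> R) (K n : nat) (s : seq R) :
  (forall n (t : R), is_derive t 1 (G n) (G n.+1 t)) ->
  sorted <%R s -> size s = K.+1 -> (forall t, t \in s -> G n t = 0) ->
  exists t, G (n + K)%N t = 0.
Proof.
move=> dG.
have step m x r : path <%R x r -> G m x = 0 -> (forall t, t \in r -> G m t = 0) ->
    exists r', [/\ size r' = size r, path <%R x r' &
      forall t, t \in r' -> G m.+1 t = 0].
  elim: r x => [|y r IH] x /=; first by exists [::].
  move=> /andP[xy yr] Gx Gr.
  have Gy : G m y = 0 by apply: Gr; rewrite mem_head.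
  have [c|||c cxy dc] := @Rolle R (G m) x y xy.
  - by move=> _; exact: ex_derive.
  - apply: derivable_within_continuous => c _; exact: ex_derive.
  - by rewrite Gx Gy.
  have [t tr|r' [sr' yr' Gr']] := IH y yr Gy.
    by apply: Gr; rewrite inE tr orbT.
  move: cxy; rewrite in_itv/= => /andP[xc cy].
  exists (c :: r'); split => /=; first by rewrite sr'.
    rewrite xc /=; move: yr'; rewrite !lt_path_sortedE => /andP[/allP yr' ->].
    by rewrite andbT; apply/allP => t /yr'; exact: lt_trans.
  move=> t; rewrite inE => /predU1P[->|/Gr'//].
  by rewrite -(@derive_val _ _ _ _ _ _ _ (dG m c)) (@derive_val _ _ _ _ _ _ _ dc).
elim: K n s => [|K IH] n [//|x s] /=.
  by case: s => // _ _ /(_ x (mem_head _ _)) Gx; exists x; rewrite addn0.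
move=> xs [sK] Gs.
have Gx : G n x = 0 by apply: Gs; rewrite mem_head.
have [t ts|s' [ss' xs' Gs']] := step n x s xs Gx.
  by apply: Gs; rewrite inE ts orbT.
have [||t Gt] := IH n.+1 s' _ _ Gs'; last by exists t; rewrite addnS -addSn.
- exact: path_sorted xs'.
- by rewrite ss'.
Qed.

Lemma horner_derivn_top (p : {poly R}) K t : (size p <= K.+1)%N ->
  (p^`(K)).[t] = p`_K *+ K`!.
Proof.
move=> pK; rewrite (_ : p^`(K) = (p`_K *+ K`!)%:P) ?hornerC//.
apply/polyP => i; rewrite coef_derivn coefC.
case: i => [|i] /=; first by rewrite addn0 ffactnn.
by rewrite nth_default ?mul0rn// (leq_trans pK)// addnS ltnS leq_addr.
Qed.

(** The value at 0 of the Lagrange basis polynomial of the node x. *)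
Definition lagrange0 (z : seq R) (x : R) : R :=
  \prod_(y <- z | y != x) (y / (y - x)).

(** Up to sign, the interpolation error at 0 is the product of the nodes times
    g^(K)(t) / K! for some t, and |g^(K)| <= |a|^K for g(t) = cos (a t). *)
Lemma interpolation_cos (z : seq R) (a : R) : uniq z ->
  (forall y, y \in z -> 0 <= y <= 1) ->
  `|1 - \sum_(x <- z) lagrange0 z x * cos (a * x)| <=
    `|a| ^+ (size z) / (size z)`!%:R.
Proof.
move=> uz z01; set K := size z.
pose lag x : {poly R} := \prod_(y <- z | y != x) ((y - x)^-1 *: (y%:P - 'X)).
have lagx x : (lag x).[x] = 1.
  rewrite horner_prod big1// => y yx.
  by rewrite !hornerE mulVf// subr_eq0.
have lagy x x' : x' \in z -> x' != x -> (lag x).[x'] = 0.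
  move=> x'z x'x; rewrite horner_prod big_mkcond (bigD1_seq x')//=.
  by rewrite x'x !hornerE subrr mulr0 mul0r.
have lag0 x : (lag x).[0] = lagrange0 z x.
  by rewrite horner_prod; apply: eq_bigr => y _; rewrite !hornerE subr0 mulrC.
have slag x : x \in z -> (size (lag x) <= K)%N.
  move=> xz; rewrite /lag -big_filter.
  have -> : K = (size [seq y <- z | y != x]).+1.
    rewrite /K -(count_predC (pred1 x) z) size_filter count_uniq_mem// xz//.
  elim: [seq y <- z | y != x] => [|y r IH]; first by rewrite big_nil size_poly1.
  rewrite big_cons (leq_trans (size_polyMleq _ _))//.
  have s2 : (size ((y - x)^-1 *: (y%:P - 'X)) <= 2)%N.
    rewrite (leq_trans (size_scale_leq _ _))// -opprB size_polyN.
    by rewrite size_XsubC.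
  by rewrite -subn1 leq_subLR (leq_trans (leq_add s2 IH)).
pose w : {poly R} := \prod_(y <- z) ('X - y%:P).
have sw : size w = K.+1 by rewrite size_prod_XsubC.
have wK : w`_K = 1.
  by have /monicP := monic_prod_XsubC z xpredT id; rewrite /lead_coef sw.
have wz x : x \in z -> w.[x] = 0.
  move=> xz; rewrite horner_prod (bigD1_seq x)//= !hornerE subrr mul0r//.
have w0 : `|w.[0]| <= 1.
  rewrite horner_prod normr_prod big_seq.
  apply: (@le_trans _ _ (\prod_(y <- z | y \in z) 1)); last by rewrite big1.
  apply: ler_prod => y yz.
  by rewrite normr_ge0 /= !hornerE normrN ger0_norm; case/andP: (z01 y yz).
pose p : {poly R} := \sum_(x <- z) cos (a * x) *: lag x.
have sp : (size p <= K)%N.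
  rewrite /p big_seq; elim/big_ind: _ => [|u v su sv|x xz]; first by rewrite size_poly0.
    by rewrite (leq_trans (size_polyD _ _))// geq_max su.
  by rewrite (leq_trans (size_scale_leq _ _))// slag.
have px x : x \in z -> p.[x] = cos (a * x).
  move=> xz; rewrite horner_sum (bigD1_seq x)//= hornerZ lagx mulr1 big1_seq ?addr0//.
  by move=> y /andP[yx yz]; rewrite hornerZ lagy ?mulr0// eq_sym.
have -> : 1 - \sum_(x <- z) lagrange0 z x * cos (a * x) = 1 - p.[0].
  rewrite horner_sum; congr (_ - _); apply: eq_bigr => x _.
  by rewrite hornerZ lag0 mulrC.
have [w00|w0n0] := eqVneq w.[0] 0.
  have z0 : 0 \in z by move: w00 => /rootP; rewrite root_prod_XsubC.
  by rewrite px// mulr0 cos0 subrr normr0 divr_ge0// exprn_ge0.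
pose c := (1 - p.[0]) / w.[0].
have -> : 1 - p.[0] = c * w.[0] by rewrite divfK.
suff ck : `|c| <= `|a| ^+ K / K`!%:R.
  by rewrite normrM (le_trans _ ck)// ler_piMr.
pose q := p + c *: w.
have sq : (size q <= K.+1)%N.
  rewrite (leq_trans (size_polyD _ _))// geq_max (leq_trans sp)//=.
  by rewrite (leq_trans (size_scale_leq _ _))// sw.
pose G n t := a ^+ n * cos (a * t + n%:R * (pi / 2)) - (q^`(n)).[t].
have dG n (t : R) : is_derive t 1 (G n) (G n.+1 t).
  have d1 : is_derive t 1 (fun t => a * t + n%:R * (pi / 2)) a.
    rewrite [X in is_derive _ _ _ X](_ : a = a *: 1 + 0); last by rewrite addr0 /GRing.scale/= mulr1.
    exact: (@is_deriveD _ _ _ (fun t => a * t)).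
  have d2 : is_derive t 1 (fun t => cos (a * t + n%:R * (pi / 2)))
      (- sin (a * t + n%:R * (pi / 2)) * a) by exact: is_derive1_comp.
  have d3 := is_deriveZ (a ^+ n) d2.
  have d4 := is_deriveB d3 (is_derive_poly (q^`(n)) t).
  apply: (is_derive_eq d4); rewrite /G derivnS; congr (_ - _).
  rewrite (_ : a * t + n.+1%:R * (pi / 2) = a * t + n%:R * (pi / 2) + pi / 2).
    by rewrite cosDpihalf exprSr /GRing.scale/=; ring.
  by rewrite -natr1; ring.
have Gz t : t \in 0 :: z -> G 0 t = 0.
  rewrite inE /G derivn0 expr0 mul1r mul0r addr0 hornerD hornerZ.
  move=> /predU1P[->|tz]; last by rewrite px// wz// mulr0 addr0 subrr.
  by rewrite mulr0 cos0 divfK//; ring.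
have u0z : uniq (0 :: z).
  rewrite /= uz andbT; apply: contra w0n0 => z0; apply/eqP/wz; exact: z0.
have [|||t] := @iterated_Rolle G K 0 (sort <=%O (0 :: z)) dG.
- by rewrite sort_lt_sorted.
- by rewrite size_sort.
- by move=> t; rewrite mem_sort; exact: Gz.
rewrite add0n /G horner_derivn_top// coefD coefZ wK mulr1 nth_default// add0r.
move/eqP; rewrite subr_eq0 => /eqP ac.
rewrite ler_pdivlMr ?ltr0n ?fact_gt0//.
rewrite -[X in `|c| * X]ger0_norm// -normrM mulr_natr -ac normrM normrX.
by rewrite ler_piMr ?exprn_ge0// cos_max.
Qed.

End interpolation.

(** * A uniform lower bound modulo 1 / d for the transform *)

Section deficiency.
Context {R : realType}.
Implicit Types s t : R.

(** Half of the squared distance from exp (2 i pi t) to 1. *)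
Definition defi t : R := 1 - cos (2 * pi * t).

Lemma defi_ge0 t : 0 <= defi t.
Proof. by rewrite subr_ge0 cos_le1. Qed.

Lemma defi0 : defi 0 = 0.
Proof. by rewrite /defi mulr0 cos0 subrr. Qed.

Lemma defiN t : defi (- t) = defi t.
Proof. by rewrite /defi mulrN cosN. Qed.

Lemma defi_int t (k : int) : defi (t + k%:~R) = defi t.
Proof. by rewrite /defi cos2pi_int. Qed.

Lemma sqn_defi t : sqn (cexp2pi t - 1) = 2 * defi t.
Proof.
rewrite /sqn ReD ImD ReN ImN /= oppr0 addr0 /defi.
by have := cos2Dsin2 (2 * pi * t); lra.
Qed.

Lemma defiD s t : defi (s + t) <= 2 * defi s + 2 * defi t.
Proof.
have := sqnD (cexp2pi s * (cexp2pi t - 1)) (cexp2pi s - 1).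
rewrite sqnM sqn_cexp2pi mul1r mulrBr mulr1 addrA subrK -cexp2piD !sqn_defi.
by lra.
Qed.

Lemma defiMn (n : nat) t : defi (n%:R * t) <= 4 ^+ n * defi t.
Proof.
elim: n => [|n IH]; first by rewrite mul0r defi0 expr0 mul1r defi_ge0.
rewrite -natr1 mulrDl mul1r (le_trans (defiD _ _))// exprS.
have := defi_ge0 t; have : 1 <= 4 ^+ n :> R by rewrite exprn_ege1// ler1n.
by move: IH; nra.
Qed.

Lemma defiMz (k : int) t : defi (k%:~R * t) <= 4 ^+ `|k|%N * defi t.
Proof.
case: k => n; first by rewrite -pmulrn absz_nat defiMn.
by rewrite NegzE mulrNz mulNr defiN -pmulrn abszN absz_nat defiMn.
Qed.

(** If all x b are near Z, for finitely many integers b, then so are the products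
    of x with the integral combinations of the b. *)
Lemma defi_comb (cs : seq (int * int)) : exists2 W : R, 0 < W &
  forall x eta : R, (forall c, c \in cs -> defi (x * c.2%:~R) <= eta) -> 0 <= eta ->
    defi (x * (\sum_(c <- cs) c.1 * c.2)%:~R) <= W * eta.
Proof.
elim: cs => [|[k b] cs [W W0 IH]].
  by exists 1 => // x eta _ eta0; rewrite big_nil mulr0 defi0 mul1r.
exists (2 * 4 ^+ `|k|%N + 2 * W) => [|x eta He eta0].
  by rewrite addr_gt0 ?mulr_gt0 ?exprn_gt0.
rewrite big_cons intrD mulrDr (le_trans (defiD _ _))//.
rewrite [leRHS](_ : _ = 2 * (4 ^+ `|k|%N * eta) + 2 * (W * eta)); last by ring.
rewrite lerD// ler_pM2l//; last first.
  by apply: IH => // c cs'; apply: He; rewrite inE cs' orbT.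
rewrite /= intrM mulrCA (le_trans (defiMz _ _))// ler_pM2l ?exprn_gt0//.
by have := He (k, b) (mem_head _ _).
Qed.

Lemma defi_near (dl : R) : 0 < dl -> exists2 sg : R, 0 < sg &
  forall t, defi t <= sg -> exists k : int, `|t - k%:~R| <= dl.
Proof.
move=> dl0; pose e := Num.min dl (4^-1).
have e0 : 0 < e by rewrite lt_min dl0 invr_gt0 ltr0n.
have e4 : e <= 4^-1 by rewrite ge_min lexx orbT.
have edl : e <= dl by rewrite ge_min lexx.
have pi0 := pi_gt0 R.
have piE t : 0 <= t <= 2^-1 -> 2 * pi * t \in `[0, pi]%R.
  by move=> t01; rewrite in_itv/=; apply/andP; split; nra.
have mono t : e < t <= 2^-1 -> cos (2 * pi * t) < cos (2 * pi * e).
  move=> /andP[et t2].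
  have tI := piE t; have eI := piE e; rewrite ltr_cos ?ltr_pM2l ?mulr_gt0//.
  - by apply: eI; rewrite (ltW e0)/=; lra.
  - by apply: tI; rewrite t2 (ltW (lt_trans e0 et)).
exists (defi e).
  have e2 : 2 * pi * e \in `[0, pi]%R by apply: piE; rewrite (ltW e0)/=; lra.
  rewrite subr_gt0 -[ltRHS]cos0 ltr_cos ?mulr_gt0//.
  by rewrite in_itv/= lexx ltW.
move=> t; pose k := Num.floor t; pose u := t - k%:~R.
have tu : t = u + k%:~R by rewrite subrK.
have [u0 u1] : 0 <= u /\ u < 1.
  have := Num.Theory.floor_itv t; rewrite -/k => /andP[h1 h2].
  by rewrite subr_ge0 h1 ltrBlDl -[X in _ + X]/(1%:~R) -intrD.
rewrite tu defi_int => du.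
have [ue|eu] := leP u e.
  by exists k; rewrite addrK ger0_norm// (le_trans ue).
have [ue|ue] := leP (1 - e) u.
  exists (k + 1); rewrite (_ : _ - _ = u - 1); last by rewrite intrD; ring.
  by rewrite ler0_norm; lra.
exfalso; have [u2|u2] := leP u 2^-1.
  have := mono u; rewrite eu u2 => /(_ isT); move: du; rewrite /defi; lra.
have := mono (1 - u); have -> : e < 1 - u <= 2^-1 by apply/andP; split; lra.
move=> /(_ isT).
have -> : cos (2 * pi * (1 - u)) = cos (2 * pi * u).
  by rewrite addrC -[1]/(1%:~R) cos2pi_int mulrN cosN.
by move: du; rewrite /defi; lra.
Qed.

End deficiency.

Lemma sum_ge_mem (R : realType) (T : eqType) (s : seq T) (f : T -> R) (S : R) :
  (0 < size s)%N -> S <= \sum_(x <- s) f x ->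
  exists2 x, x \in s & S / (size s)%:R <= f x.
Proof.
move=> s0 SF; apply: contrapT => H.
have Hlt x : x \in s -> f x < S / (size s)%:R.
  by move=> xs; rewrite ltNge; apply/negP => h; apply: H; exists x.
suff : \sum_(x <- s) f x < S by rewrite ltNge SF.
have -> : S = \sum_(x <- s) (S / (size s)%:R).
  rewrite big_const_seq count_predT iter_addr_0 -[RHS]mulr_natr divfK//.
  by rewrite pnatr_eq0 -lt0n.
case: s s0 Hlt {SF H} => // a s _ Hlt.
rewrite !big_cons ltr_leD ?Hlt ?mem_head// big_seq [leRHS]big_seq.
by apply: ler_sum => x xs; rewrite ltW// Hlt// inE xs orbT.
Qed.

Section tree.
Context {R : realType}.
Variables (C : R) (d : int).
Hypothesis d0 : 0 < d.

Let dR0 : 0 < d%:~R :> R. Proof. by rewrite ltr0z. Qed.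
Let dn0 : d%:~R != 0 :> R. Proof. by rewrite gt_eqF. Qed.

(** The points of a spectrum can be moved along Z / d only, after rescaling; a
    bound on every class modulo Z / d is thus all that can be exploited. *)
Definition lower_mod (eps : R) (Q : nat -> nat) (B : nat -> {fset int}) :=
  forall x, exists k : int, eps <= sqn (ftl Q B (x + k%:~R / d%:~R)).

Definition small_mod (eps : R) Q B (x : R) :=
  forall k : int, sqn (ftl Q B (x + k%:~R / d%:~R)) < eps.

Definition denomz (Q : nat -> nat) k : int := \prod_(i < k) (Q i)%:Z.

Lemma denomzE Q k : denom Q k = (denomz Q k)%:~R :> R.
Proof. by rewrite /denom /denomz rmorph_prod. Qed.

Lemma denomz_shift Q m k : denomz Q (m + k) = denomz Q m * denomz (shift m Q) k.
Proof.
by apply: (@intr_inj R); rewrite intrM -!denomzE denom_shift.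
Qed.

Variables (r P q : nat) (cs : seq (int * int)).
Hypothesis csd : \sum_(c <- cs) c.1 * c.2 = d.

(** The bounds P and q make the constants below depend on the number of blocks
    only, not on the position of the block. *)
Definition block (Q : nat -> nat) (B : nat -> {fset int}) :=
  [/\ hadamard C Q B, forall i b, b \in B i -> (d %| b)%Z,
      (\prod_(i < r) Q i <= P)%N, (\prod_(i < r) #|` B i| <= q)%N &
      forall c, c \in cs -> exists2 i, (i < r)%N & c.2 \in B i].

(** Over one block, a point x is either near Z / d, where the transform is
    near 1, or two of the translates x + l give transforms of the block that
    are not small. Indeed the squared transforms add up to 1 over a spectrum
    of the block; if one of them is almost 1, then x b is almost an integer for
    all digits b of the block, hence so is x d. *)
Lemma block_split : exists2 kappa : R, 0 < kappa <= 1 &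
  forall Q B, block Q B -> forall x, small_mod (4^-1) Q B x ->
  exists l l' : int, [/\ kappa <= sqn (ft (atoms Q B r) (x + l%:~R)),
    kappa <= sqn (ft (atoms Q B r) (x + l'%:~R)) & ~~ (denomz Q r %| d * (l - l'))%Z].
Proof.
have [W W0 HW] := @defi_comb R cs.
(* the transform is Lipschitz with constant 16 pi C, hence at least 3 / 4 at
   distance dl from 0 *)
pose dl : R := (64 * pi * (`|C| + 1))^-1.
have dl0 : 0 < dl by rewrite invr_gt0 !mulr_gt0 ?pi_gt0// ltr_wpDl.
have [sg sg0 Hsg] := defi_near dl0.
(* 4 ^ P is the loss when passing from x b / denom Q i.+1 to x b, and the square
   that in sqn_ft_atom *)
pose A : R := 4 ^+ P * ((q%:R + 1) ^+ 2).
have A0 : 0 < A by rewrite mulr_gt0 ?exprn_gt0// ltr_wpDl.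
pose tau : R := Num.min (2^-1) (sg / (W * A)).
have tau0 : 0 < tau by rewrite lt_min invr_gt0 ltr0n divr_gt0// mulr_gt0.
have tau1 : tau <= 2^-1 by rewrite ge_min lexx.
have tausg : W * (A * tau) <= sg.
  by rewrite mulrA -ler_pdivlMl ?mulr_gt0// mulrC ge_min lexx orbT.
exists (tau / (q%:R + 1)).
  rewrite divr_gt0 ?ltr_wpDl//= ler_pdivrMr ?ltr_wpDl// mul1r.
  by have := ler0n R q; lra.
move=> Q B [QB dB QP Bq csB] x xs.
have [s [sz Ss]] := spec_int QB r.
have sz0 : (0 < size s)%N.
  by rewrite sz prodn_gt0// => i; rewrite (leq_trans _ (hadamard_B QB i)).
have Ssx : \sum_(l <- s) sqn (ft (atoms Q B r) (x + l%:~R)) = 1.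
  by rewrite -[RHS](Ss x) big_map.
(* an element of the spectrum carrying almost the whole sum would put x d
   within dl of an integer *)
have [[l ls Hl]|Hl] := pselect (exists2 l, l \in s &
    1 - tau <= sqn (ft (atoms Q B r) (x + l%:~R))).
  exfalso.
  have ftP k : ft (atoms Q B k) (x + l%:~R) =
      \prod_(i < k) ft (digits (B i)) ((x + l%:~R) / denom Q i.+1).
    elim: k => [|k IH]; last by rewrite ft_atomsS IH big_ord_recr.
    by rewrite big_ord0 /ft /= big_seq1 invr1 mulr0 cexp2pi0 mul1r.
  have He c : c \in cs -> defi (x * c.2%:~R) <= A * tau.
    move=> /csB[i ir cB]; set b := c.2 in cB *.
    have h1 : 1 - tau <= sqn (ft (digits (B i)) ((x + l%:~R) / denom Q i.+1)).
      rewrite (le_trans Hl)// ftP sqn_prod (bigD1 (Ordinal ir))//=.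
      rewrite ler_piMr ?sqn_ge0// prodr_ile1// => j _.
      by rewrite sqn_ge0 sqn_ft_le1.
    have bm : (b%:~R : R) \in digits (B i) by apply/mapP; exists b.
    have [_ B0 _] := QB i.
    have := sqn_ft_atom ((x + l%:~R) / denom Q i.+1) (digits_uniq _)
      (digits0 B0) bm.
    rewrite -/(defi _) size_digits => h2.
    rewrite -(defi_int _ (l * b)) intrM -mulrDl.
    have -> : (x + l%:~R) * b%:~R =
        (\prod_(j < i.+1) Q j)%:R * ((x + l%:~R) / denom Q i.+1 * b%:~R).
      by rewrite /denom natr_prod; field; rewrite (denom_neq0 QB).
    rewrite (le_trans (defiMn _ _))// /A -[leRHS]mulrA ler_pM ?exprn_ge0 ?defi_ge0//.
      rewrite ler_weXn2l ?ler1n// (leq_trans _ QP)//.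
      have -> : r = (i.+1 + (r - i.+1))%N by rewrite subnKC.
      rewrite big_split_ord/= leq_pmulr// prodn_gt0// => j.
      by rewrite (leq_trans _ (hadamard_Q QB _)).
    rewrite (le_trans h2)// ler_pM ?exprn_ge0 ?subr_ge0 ?sqn_ft_le1//; last lra.
    rewrite lerXn2r ?nnegrE// ?addr_ge0//; apply: (@le_trans _ _ q%:R); last by rewrite lerDl.
    rewrite ler_nat (leq_trans _ Bq)// (bigD1 (Ordinal ir))//= leq_pmulr//.
    by rewrite prodn_gt0// => j; rewrite (leq_trans _ (hadamard_B QB _)).
  have At0 : 0 <= A * tau by rewrite ltW// mulr_gt0.
  have := HW x _ He At0; rewrite csd => /le_trans/(_ tausg)/Hsg[k xk].
  have := xs (- k); rewrite ltNge => /negP; apply.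
  have C0 := hadamard_C QB.
  have h1 : `|x + (- k)%:~R / d%:~R| <= dl.
    have -> : x + (- k)%:~R / d%:~R = (x * d%:~R - k%:~R) / d%:~R.
      by rewrite intrN; field.
    rewrite normrM normfV (gtr0_norm dR0) ler_pdivrMr// (le_trans xk)//.
    by rewrite ler_peMr ?(ltW dl0)// ler1z -gtz0_ge1.
  have := sqn_ftl_lip QB (x + (- k)%:~R / d%:~R) 0.
  rewrite (ftl0 QB) sqn1 subr0 => h2.
  have h3 : 16 * pi * C * `|x + (- k)%:~R / d%:~R| <= 4^-1.
    apply: (@le_trans _ _ (16 * pi * (`|C| + 1) * dl)).
      apply: ler_pM => //; first by rewrite !mulr_ge0// pi_ge0.
      by rewrite ler_pM2l ?mulr_gt0 ?pi_gt0// ger0_norm// lerDl.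
    rewrite /dl -(mulrA 64) -(mulrA 16); have : 0 < pi * (`|C| + 1).
      by rewrite mulr_gt0 ?pi_gt0 ?ltr_wpDl.
    by move: (pi * _) => p p0; rewrite invfM mulrACA mulfV ?gt_eqF// mulr1; lra.
  by have := ler_norm (- (sqn (ftl Q B (x + (- k)%:~R / d%:~R)) - 1)); rewrite normrN; lra.
have us : uniq s by have := spec_uniq QB Ss; rewrite map_inj_uniq//; exact: intr_inj.
have qs : (size s <= q)%N by rewrite sz.
have sR0 : 0 < (size s)%:R :> R by rewrite ltr0n.
have sq1 : (size s)%:R <= q%:R + 1 :> R by rewrite natr1 ler_nat leqW.
have Ssx1 : 1 <= \sum_(l <- s) sqn (ft (atoms Q B r) (x + l%:~R)) by rewrite Ssx.
have [l ls h1] := sum_ge_mem sz0 Ssx1.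
have lt1 : sqn (ft (atoms Q B r) (x + l%:~R)) < 1 - tau.
  by rewrite ltNge; apply/negP => h; apply: Hl; exists l.
have sums : tau <= \sum_(m <- rem l s) sqn (ft (atoms Q B r) (x + m%:~R)).
  by move: Ssx; rewrite (perm_big _ (perm_to_rem ls))/= big_cons; lra.
have rs0 : (0 < size (rem l s))%N.
  by rewrite lt0n; apply/negP => /nilP rs; move: sums; rewrite rs big_nil; lra.
have [l' l's h2] := sum_ge_mem rs0 sums.
have ll' : l' != l by move: l's; rewrite mem_rem_uniq// inE => /andP[].
exists l', l; split.
- apply: le_trans h2; rewrite ler_pM2l// lef_pV2 ?posrE ?ltr0n// ?ltr_wpDl//.
  by rewrite (le_trans _ sq1)// ler_nat size_rem// leq_pred.
- apply: le_trans h1; apply: ler_pM.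
  + exact: ltW.
  + by rewrite invr_ge0 addr_ge0.
  + by lra.
  + by rewrite lef_pV2 ?posrE ?ltr_wpDl.
apply/negP => /dvdzP[k dk].
(* elements of a spectrum differing by a period would not be orthogonal *)
have := @spec_orthogonal _ _ _ _ QB r [seq l%:~R | l <- s] l'%:~R l%:~R Ss.
have l's' : l' \in s by exact: mem_rem l's.
rewrite !map_f// eqr_int => /(_ isT isT ll').
have -> : l'%:~R - l%:~R = 0 + denom Q r * (k%:~R / d%:~R) :> R.
  by rewrite add0r denomzE mulrA -intrM [denomz Q r * k]mulrC -dk intrM mulrC mulKf// intrB.
rewrite (ft_atoms_periodic QB _ _ _ _ dB) ?(ft_atoms0 QB) ?gt_eqF//.
by move/eqP; rewrite oner_eq0.
Qed.

Lemma small_mod_le e e' Q B x : e <= e' -> small_mod e Q B x -> small_mod e' Q B x.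
Proof. by move=> ee' H k; exact: lt_le_trans (H k) ee'. Qed.

(** Factor the transform through the first r factors: their transform is
    invariant under the translations involved and at least kappa. *)
Lemma small_mod_child (e kappa : R) Q B y (l : int) : 0 < kappa -> hadamard C Q B ->
  small_mod e Q B y -> kappa <= sqn (ft (atoms Q B r) (y + l%:~R)) ->
  (forall i b, b \in B i -> (d %| b)%Z) ->
  small_mod (e / kappa) (shift r Q) (shift r B) ((y + l%:~R) / denom Q r).
Proof.
move=> k0 QB ys kl dB k; set z := (y + l%:~R) / denom Q r.
have M0 : denom Q r != 0 :> R by rewrite (denom_neq0 QB).
have := ys (d * l + denomz Q r * k).
have -> : y + (d * l + denomz Q r * k)%:~R / d%:~R = denom Q r * (z + k%:~R / d%:~R).
  by rewrite /z intrD !intrM -denomzE; field; rewrite M0 dn0.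
have e1 : denom Q r * (z + k%:~R / d%:~R) = (y + l%:~R) + denom Q r * (k%:~R / d%:~R).
  by rewrite /z mulrDr mulrCA mulfV// mulr1.
rewrite (ftl_shift r _ QB) sqnM mulrC [X in ftl _ _ X]mulrC mulKf//.
rewrite e1 (ft_atoms_periodic QB _ _ _ _ dB) ?gt_eqF//.
move=> h; rewrite ltr_pdivlMr//; apply: le_lt_trans h.
by rewrite ler_wpM2l ?sqn_ge0.
Qed.

(** Starting from a point where the transform is small on a whole class modulo
    1 / d, every block yields one more such point for the shifted sequence,
    the classes being distinct. *)
Lemma tree_points (kappa : R) (T : nat) Q B : 0 < kappa <= 1 ->
  (forall Q B, block Q B -> forall x, small_mod (4^-1) Q B x ->
   exists l l' : int, [/\ kappa <= sqn (ft (atoms Q B r) (x + l%:~R)),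
    kappa <= sqn (ft (atoms Q B r) (x + l'%:~R)) & ~~ (denomz Q r %| d * (l - l'))%Z]) ->
  hadamard C Q B ->
  (forall t, (t < T)%N -> block (shift (t * r) Q) (shift (t * r) B)) ->
  forall e x, e <= 4^-1 * kappa ^+ T -> small_mod e Q B x ->
  exists ls : seq int, [/\ size ls = T.+1, uniq ls,
    forall l l', l \in ls -> l' \in ls -> l != l' ->
      ~~ (denomz Q (T * r) %| d * (l - l'))%Z &
    forall l, l \in ls -> small_mod (e / kappa ^+ T) (shift (T * r) Q)
      (shift (T * r) B) ((x + l%:~R) / denom Q (T * r))].
Proof.
move=> /andP[k0 k1] split_block QB blockT e x; elim: T blockT => [_ _ xs|T IH blockT eT xs].
  exists [:: 0]; split => // [l l'|l].
    by rewrite !inE => /eqP -> /eqP ->; rewrite eqxx.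
  by rewrite inE mul0n expr0 divr1 !shift0 denom0 divr1 => /eqP ->; rewrite addr0.
have eT' : e <= 4^-1 * kappa ^+ T.
  rewrite (le_trans eT)// ler_wpM2l ?invr_ge0// exprSr ler_piMr//.
  by rewrite exprn_ge0// ltW.
have [ls [sls uls dls sm]] := IH (fun t tT => blockT t (leqW tT)) eT' xs.
have bT := blockT T (ltnSn T); set QT := shift (T * r) Q in bT sm.
set BT := shift (T * r) B in bT sm.
have [QBT dBT _ _ _] := bT.
have kT : 0 < kappa ^+ T by rewrite exprn_gt0.
have : forall l : int, exists m : int * int, l \in ls ->
    [/\ kappa <= sqn (ft (atoms QT BT r) ((x + l%:~R) / denom Q (T * r) + m.1%:~R)),
      kappa <= sqn (ft (atoms QT BT r) ((x + l%:~R) / denom Q (T * r) + m.2%:~R)) &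
      ~~ (denomz QT r %| d * (m.1 - m.2))%Z].
  move=> l; have [lls|lls] := boolP (l \in ls); last by exists (0, 0).
  have [|m [m' mm']] := split_block _ _ bT ((x + l%:~R) / denom Q (T * r)).
    by apply: small_mod_le (sm l lls); rewrite ler_pdivrMr.
  by exists (m, m').
move=> /choice[f Hf].
pose M := denomz Q (T * r).
have M0 : denom Q (T * r) != 0 :> R by rewrite (denom_neq0 QB).
have Mz0 : M != 0 by apply: contra M0 => /eqP Mz; rewrite denomzE -/M Mz.
have denomzT : denomz Q (T.+1 * r) = M * denomz QT r by rewrite mulSn addnC denomz_shift.
have denomT : denom Q (T.+1 * r) = denom Q (T * r) * denom QT r :> R.
  by rewrite mulSn addnC denom_shift.
have key1 l l' m m' : (denomz Q (T.+1 * r) %| d * (l + M * m - (l' + M * m')))%Z ->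
    (M %| d * (l - l'))%Z.
  rewrite denomzT => h; have {}h := dvdz_trans (dvdz_mulr _ (dvdzz M)) h.
  have -> : d * (l - l') = d * (l + M * m - (l' + M * m')) - M * (d * (m - m')) by ring.
  by rewrite rpredB// dvdz_mulr.
have key2 l m m' : (denomz Q (T.+1 * r) %| d * (l + M * m - (l + M * m')))%Z ->
    (denomz QT r %| d * (m - m'))%Z.
  rewrite denomzT; have -> : d * (l + M * m - (l + M * m')) = M * (d * (m - m')) by ring.
  by rewrite dvdz_mul2l.
have child l m : l \in ls ->
    kappa <= sqn (ft (atoms QT BT r) ((x + l%:~R) / denom Q (T * r) + m%:~R)) ->
    small_mod (e / kappa ^+ T.+1) (shift (T.+1 * r) Q) (shift (T.+1 * r) B)
      ((x + (l + M * m)%:~R) / denom Q (T.+1 * r)).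
  move=> lls km; have := small_mod_child k0 QBT (sm l lls) km dBT.
  rewrite /QT /BT !shiftD addnC -mulSn -mulrA -invfM -exprSr.
  congr (small_mod _ _ _ _).
  have QTr : denom (shift (T * r) Q) r != 0 :> R by rewrite (denom_neq0 QBT).
  by rewrite denomT /QT intrD intrM -denomzE; field; rewrite M0 QTr.
case: ls sls uls dls sm Hf child => // l0 ls sls uls dls sm Hf child.
(* one child of every point, and both children of l0 *)
pose g l := l + M * (f l).1.
have sep l l' : l \in l0 :: ls -> l' \in l0 :: ls -> l != l' ->
    ~~ (denomz Q (T.+1 * r) %| d * (g l - g l'))%Z.
  by move=> ll ll' lnl'; apply: contra (dls _ _ ll ll' lnl'); exact: key1.
have sep0 l : l \in l0 :: ls -> ~~ (denomz Q (T.+1 * r) %| d * (g l - (l0 + M * (f l0).2)))%Z.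
  move=> ll; have [->|ll0] := eqVneq l l0.
    by have [_ _] := Hf l0 (mem_head _ _); apply: contra; exact: key2.
  by apply: contra (dls _ _ ll (mem_head _ _) ll0); exact: key1.
have sepC (u v : int) : ~~ (denomz Q (T.+1 * r) %| d * (u - v))%Z ->
    ~~ (denomz Q (T.+1 * r) %| d * (v - u))%Z.
  by apply: contra => h; rewrite -opprB mulrN rpredN.
exists ((l0 + M * (f l0).2) :: [seq g l | l <- l0 :: ls]); split.
- by rewrite /= size_map -sls.
- rewrite cons_uniq; apply/andP; split.
    apply/negP => /mapP[l ll gl]; have := sep0 l ll.
    by rewrite -gl subrr mulr0 dvdz0.
  rewrite map_inj_in_uniq// => l l' ll ll' gg; apply/eqP/negPn/negP => lnl'.
  by have := sep l l' ll ll' lnl'; rewrite gg subrr mulr0 dvdz0.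
- move=> u v; rewrite [u \in _]in_cons [v \in _]in_cons.
  move=> /predU1P[->|/mapP[l ll ->]] /predU1P[->|/mapP[l' ll' ->]].
  + by rewrite eqxx.
  + by move=> _; apply: sepC; exact: sep0.
  + by move=> _; exact: sep0.
  + by move=> gg; apply: sep => //; apply: contra gg => /eqP ->.
- move=> u; rewrite in_cons => /predU1P[->|/mapP[l ll ->]].
    by apply: child; [exact: mem_head|have [] := Hf l0 (mem_head _ _)].
  by apply: child => //; have [] := Hf l ll.
Qed.

(** More separated points where the transform of a measure of bounded support
    is tiny than interpolation of the value 1 at 0 allows. *)
Lemma lower_mod_blocks : exists (T : nat) (eps : R), 0 < eps /\
  forall Q B, (forall t, (t <= T)%N -> block (shift (t * r) Q) (shift (t * r) B)) ->
  lower_mod eps Q B.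
Proof.
have [kappa k01 split_block] := block_split; have [k0 k1] := andP k01.
pose A : R := 4 * pi * `|C|.
have [T AT] : exists T, A ^+ T.+1 / T.+1`!%:R <= 2^-1.
  have /cvgrPdist_le/(_ 2^-1) := @cvg_exp_coeff R A.
  rewrite invr_gt0 ltr0n => /(_ isT)[n _ /(_ n.+1 (leqnSn n))].
  by rewrite /= sub0r normrN => /(le_trans (ler_norm _)); exists n.
(* the points found below are distinct elements of Z / (d denom Q (T r)) up to a
   common translation, hence separated by 1 / G *)
pose G : R := (d * (P ^ T)%:Z)%:~R + 1.
have PT0 : 0 <= (d * (P ^ T)%:Z)%:~R :> R by rewrite ler0z mulr_ge0// ltW.
have G1 : 1 <= G by rewrite lerDr.
have G0 : 0 < G by rewrite (lt_le_trans _ G1).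
(* T + 1 terms of modulus at most eta, with coefficients at most G ^ T.+1, add
   up to at most 1 / 4 *)
pose eta : R := (4 * T.+1%:R * G ^+ T.+1)^-1.
have eta0 : 0 < eta by rewrite invr_gt0 !mulr_gt0// exprn_gt0.
have kT : 0 < kappa ^+ T by rewrite exprn_gt0.
pose e' := Num.min (eta ^+ 2) 4^-1.
exists T, (e' * kappa ^+ T); split.
  by rewrite mulr_gt0// lt_min exprn_gt0//= invr_gt0.
move=> Q B blockT x; apply: contrapT => Hx.
have xs : small_mod (e' * kappa ^+ T) Q B x.
  by move=> k; rewrite ltNge; apply/negP => h; apply: Hx; exists k.
have [QB dB _ _ _] := blockT 0%N (leq0n T).
rewrite mul0n !shift0 in QB dB.
have eT : e' * kappa ^+ T <= 4^-1 * kappa ^+ T.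
  by rewrite ler_pM2r// ge_min lexx orbT.
have [ls [sls uls dls sm]] := tree_points k01 split_block QB
  (fun t tT => blockT t (ltnW tT)) eT xs.
rewrite mulfK ?gt_eqF// in sm.
have [QBT dBT _ _ _] := blockT T (leqnn T).
set QT := shift _ Q in QBT sm; set BT := shift _ B in QBT dBT sm.
have M0 : 0 < denom Q (T * r) :> R by rewrite (denom_gt0 QB).
have MG : d%:~R * denom Q (T * r) <= G.
  rewrite /G; apply: (@le_trans _ _ (d * (P ^ T)%:Z)%:~R); last by rewrite lerDl.
  rewrite intrM ler_pM2l// -pmulrn.
  rewrite /denom -natr_prod ler_nat; clear -blockT.
  elim: T blockT => [|T IH] blockT; first by rewrite mul0n big_ord0 expn0.
  rewrite mulSn addnC big_split_ord/= expnSr leq_mul//.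
    by apply: IH => t tT; apply: blockT; rewrite (leq_trans tT).
  by have [_ _] := blockT T (leqnSn T).
pose y l : R := (x + l%:~R) / denom Q (T * r).
(* representatives in [0, 1] of the classes of the y l modulo Z / d *)
pose z l : R := y l - (Num.floor (d%:~R * y l))%:~R / d%:~R.
have z01 l : 0 <= z l <= 1.
  have := Num.Theory.floor_itv (d%:~R * y l); set k := Num.floor _ => /andP[h1 h2].
  have -> : z l = (d%:~R * y l - k%:~R) / d%:~R by rewrite /z -/k; field.
  rewrite divr_ge0 ?subr_ge0 ?(ltW dR0)//= ler_pdivrMr// mul1r.
  rewrite (@le_trans _ _ 1)// ?ler1z -?gtz0_ge1//.
  by rewrite lerBlDl ltW// -[X in _ + X]/(1%:~R) -intrD.
have zsmall l : l \in ls -> `|complex.Re (ftl QT BT (z l))| <= eta.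
  move=> lls; have := sm l lls (- Num.floor (d%:~R * y l)).
  rewrite intrN mulNr -/(y l) -/(z l) => h.
  have {}h : complex.Re (ftl QT BT (z l)) ^+ 2 <= eta ^+ 2.
    rewrite (@le_trans _ _ (sqn (ftl QT BT (z l))))// ?lerDl ?sqr_ge0//.
    by rewrite (le_trans (ltW h))// ge_min lexx.
  by rewrite -ler_sqr ?nnegrE ?normr_ge0 ?(ltW eta0)// real_normK ?num_real.
have zsep l l' : l \in ls -> l' \in ls -> l != l' -> G^-1 <= `|z l - z l'|.
  move=> ll ll' lnl'; set k := Num.floor (d%:~R * y l) - Num.floor (d%:~R * y l').
  have -> : z l - z l' =
      (d * (l - l') - k * denomz Q (T * r))%:~R / (d%:~R * denom Q (T * r)).
    rewrite intrB !intrM -denomzE /k !intrB /z /y.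
    by field; rewrite dn0 gt_eqF.
  have dM0 : 0 < d%:~R * denom Q (T * r) :> R by rewrite mulr_gt0.
  rewrite normrM normfV (gtr0_norm dM0) ler_pdivlMr//.
  apply: (@le_trans _ _ 1); first by rewrite mulrC ler_pdivrMr// mul1r.
  rewrite -intr_norm ler1z -gtz0_ge1 normr_gt0 subr_eq0.
  by apply: contra (dls _ _ ll ll' lnl') => /eqP ->; rewrite dvdz_mull.
pose zs := [seq z l | l <- ls].
have uz : uniq zs.
  rewrite map_inj_in_uniq// => l l' ll ll' zz; apply/eqP/negPn/negP => lnl'.
  have := zsep l l' ll ll' lnl'; rewrite zz subrr normr0 leNgt invr_gt0.
  by rewrite G0.
have szs : size zs = T.+1 by rewrite size_map.
have lag v : v \in zs -> `|lagrange0 zs v| <= G ^+ T.+1.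
  move=> /mapP[l ll ->]; rewrite /lagrange0 normr_prod.
  have -> : G ^+ T.+1 = \prod_(w <- zs) G by rewrite big_const_seq count_predT iter_mulr_1 szs.
  rewrite big_mkcond big_seq [leRHS]big_seq; apply: ler_prod => w /mapP[l' ll' ->].
  case: ifPn => [zz|_]; last by rewrite ler01.
  rewrite normr_ge0 /= normrM normfV.
  have lnl' : l' != l by apply: contra zz => /eqP ->.
  have zz0 : 0 < `|z l' - z l| by rewrite normr_gt0 subr_eq0.
  rewrite ler_pdivrMr// (@le_trans _ _ 1)//.
    by have /andP[z0 z1] := z01 l'; rewrite ger0_norm.
  by rewrite -ler_pdivrMl// mulr1 zsep.
have sumz : `|\sum_(v <- zs) lagrange0 zs v * complex.Re (ftl QT BT v)| <= 4^-1.
  rewrite (le_trans (ler_norm_sum _ _ _))//.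
  apply: (@le_trans _ _ (\sum_(v <- zs) G ^+ T.+1 * eta)).
    rewrite big_seq [leRHS]big_seq; apply: ler_sum => v vz.
    rewrite normrM ler_pM//; first exact: lag.
    by move: vz => /mapP[l ll ->]; exact: zsmall.
  rewrite big_const_seq count_predT iter_addr_0 szs -[_ *+ _]mulr_natl /eta.
  have X0 : G ^+ T.+1 != 0 by rewrite expf_neq0// gt_eqF.
  have n0 : T.+1%:R != 0 :> R by rewrite pnatr_eq0.
  move: (G ^+ T.+1) (T.+1%:R) X0 n0 => X n X0 n0.
  by rewrite le_eqVlt; apply/orP; left; apply/eqP; field; rewrite X0 n0.
have comb : `|\sum_(cv <- (1, 0) :: [seq (- lagrange0 zs v, v) | v <- zs])
    cv.1 * complex.Re (ftl QT BT cv.2)| <= 2^-1.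
  apply: (Re_ftl_comb QBT); first by rewrite invr_ge0.
  move=> t /andP[t0 tC]; rewrite big_cons big_map /= mul0r mulr0 cos0 mulr1.
  rewrite (eq_bigr (fun v => - (lagrange0 zs v * cos ((2 * pi * t) * v)))); last first.
    by move=> v _; rewrite mulNr; congr (- (_ * cos _)); ring.
  rewrite sumrN (le_trans (interpolation_cos _ uz _))//.
    by move=> _ /mapP[l _ ->].
  rewrite szs (le_trans _ AT)// ler_wpM2r ?invr_ge0// lerXn2r ?nnegrE//.
    by rewrite /A !mulr_ge0// pi_ge0.
  rewrite ger0_norm ?mulr_ge0 ?pi_ge0// /A.
  have := pi_gt0 R; have := ler_norm C; move: pi => p h1 h2; nra.
move: comb; rewrite big_cons big_map.
rewrite (_ : _ * _ = 1); last by rewrite [X in complex.Re X](ftl0 QBT) mulr1.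
rewrite (eq_bigr (fun v => - (lagrange0 zs v * complex.Re (ftl QT BT v)))); last first.
  by move=> v _; exact: mulNr.
rewrite sumrN => /(le_trans (ler_norm _)).
by have := ler_norm (\sum_(v <- zs) lagrange0 zs v * complex.Re (ftl QT BT v)); lra.
Qed.

End tree.

(** * Trigonometric polynomials are dense in L2 of a compactly supported law *)

Section L2_approximation.
Context {R : realType} (nu : probability R R).
Implicit Types (f g : R -> R[i]) (ps qs : seq (R * R[i])) (D : set R).

Definition cmeas f := measurable_fun setT (fun x => complex.Re (f x)) /\
  measurable_fun setT (fun x => complex.Im (f x)).

Definition I2 f : \bar R := (\int[nu]_x (sqn (f x))%:E)%E.

Definition trig ps (x : R) : R[i] := \sum_(p <- ps) p.2 * cexp2pi (p.1 * x).

Lemma cmeas_sqn f : cmeas f -> measurable_fun setT (fun x => sqn (f x)).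
Proof. by move=> [mr mi]; apply: measurable_funD; apply: measurable_funX. Qed.

Lemma cmeasD f g : cmeas f -> cmeas g -> cmeas (fun x => f x + g x).
Proof.
move=> [fr fi] [gr gi]; split.
  by under eq_fun do rewrite ReD; exact: measurable_funD.
by under eq_fun do rewrite ImD; exact: measurable_funD.
Qed.

Lemma cmeasM f g : cmeas f -> cmeas g -> cmeas (fun x => f x * g x).
Proof.
move=> [fr fi] [gr gi]; split.
  under eq_fun do rewrite ReM.
  by apply: measurable_funB; exact: measurable_funM.
under eq_fun do rewrite ImM.
by apply: measurable_funD; exact: measurable_funM.
Qed.

Lemma cmeas_cst (c : R[i]) : cmeas (fun=> c).
Proof. by split; exact: measurable_cst. Qed.

Lemma cmeasN f : cmeas f -> cmeas (fun x => - f x).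
Proof.
move=> mf; under eq_fun do rewrite -mulN1r.
by apply: cmeasM => //; exact: cmeas_cst.
Qed.

Lemma cmeasB f g : cmeas f -> cmeas g -> cmeas (fun x => f x - g x).
Proof. by move=> mf mg; apply: cmeasD => //; exact: cmeasN. Qed.

Lemma cmeas_real (g : R -> R) : measurable_fun setT g ->
  cmeas (fun x => (g x)%:C%C).
Proof. by move=> mg; split => //; exact: measurable_cst. Qed.

Lemma cmeas_cexp2pi (t : R) : cmeas (fun x => cexp2pi (t * x)).
Proof.
split; apply: continuous_measurable_fun.
  exact: continuous_cos_lin.
exact: continuous_sin_lin.
Qed.

Lemma cmeas_trig ps : cmeas (trig ps).
Proof.
elim: ps => [|p ps IH].
  rewrite (_ : trig _ = fun=> 0); first exact: cmeas_cst.
  by apply/funext => x; rewrite /trig big_nil.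
rewrite (_ : trig _ = fun x => p.2 * cexp2pi (p.1 * x) + trig ps x).
  apply: cmeasD => //; apply: cmeasM; [exact: cmeas_cst|exact: cmeas_cexp2pi].
by apply/funext => x; rewrite /trig big_cons.
Qed.

Lemma trig_bounded ps : exists2 K, 0 <= K & forall x, sqn (trig ps x) <= K.
Proof.
elim: ps => [|p ps [K K0 HK]].
  by exists 0 => // x; rewrite /trig big_nil sqn0.
exists (2 * sqn p.2 + 2 * K) => [|x].
  by rewrite addr_ge0// mulr_ge0// sqn_ge0.
rewrite /trig big_cons (le_trans (sqnD _ _))// sqnM sqn_cexp2pi mulr1 lerD2l.
by rewrite ler_pM2l//; exact: HK.
Qed.

Lemma trigD ps qs x : trig (ps ++ qs) x = trig ps x + trig qs x.
Proof. by rewrite /trig big_cat. Qed.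

Lemma trigZ (c : R[i]) ps x : trig [seq (p.1, c * p.2) | p <- ps] x = c * trig ps x.
Proof.
by rewrite /trig big_map big_distrr/=; apply: eq_bigr => p _; rewrite mulrA.
Qed.

Lemma trigM ps qs x :
  trig [seq (p.1 + q.1, p.2 * q.2) | p <- ps, q <- qs] x = trig ps x * trig qs x.
Proof.
rewrite /trig big_allpairs_dep big_distrl; apply: eq_bigr => p _ /=.
rewrite big_distrr; apply: eq_bigr => q _ /=.
by rewrite mulrDl cexp2piD mulrACA.
Qed.

Lemma I2_ge0 f : (0 <= I2 f)%E.
Proof. by apply: integral_ge0 => x _; rewrite lee_fin sqn_ge0. Qed.

Lemma I2_scale (K : R) f : 0 <= K -> cmeas f ->
  (\int[nu]_x (K * sqn (f x))%:E = K%:E * I2 f)%E.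
Proof.
move=> K0 mf; rewrite /I2 -ge0_integralZl//.
  apply/measurable_EFinP; exact: cmeas_sqn.
by move=> x _; rewrite lee_fin sqn_ge0.
Qed.

Lemma I2D f g : cmeas f -> cmeas g ->
  (I2 (fun x => (f x + g x)%R) <= 2%:E * I2 f + 2%:E * I2 g)%E.
Proof.
move=> mf mg; rewrite -!I2_scale// -ge0_integralD//; first last.
- by apply/measurable_EFinP; apply: measurable_funM => //; exact: cmeas_sqn.
- by move=> x _; rewrite lee_fin mulr_ge0// sqn_ge0.
- by apply/measurable_EFinP; apply: measurable_funM => //; exact: cmeas_sqn.
- by move=> x _; rewrite lee_fin mulr_ge0// sqn_ge0.
apply: ge0_le_integral => //.
- by move=> x _; rewrite lee_fin sqn_ge0.
- by apply/measurable_EFinP; apply: cmeas_sqn; exact: cmeasD.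
- by apply/measurable_EFinP; apply: measurable_funD; apply: measurable_funM => //;
    exact: cmeas_sqn.
- by move=> x _; rewrite -EFinD lee_fin sqnD.
Qed.

Lemma I2M f g (K : R) : cmeas f -> cmeas g -> 0 <= K ->
  (forall x, sqn (f x) <= K) -> (I2 (fun x => (f x * g x)%R) <= K%:E * I2 g)%E.
Proof.
move=> mf mg K0 fK; rewrite -I2_scale//; apply: ge0_le_integral => //.
- by move=> x _; rewrite lee_fin sqn_ge0.
- by apply/measurable_EFinP; apply: cmeas_sqn; exact: cmeasM.
- by apply/measurable_EFinP; apply: measurable_funM => //; exact: cmeas_sqn.
- by move=> x _; rewrite lee_fin sqnM ler_wpM2r// sqn_ge0.
Qed.

Lemma lte_2D2 (a b : \bar R) (e : R) : (0 <= a)%E -> (0 <= b)%E ->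
  (a < (e / 4)%:E)%E -> (b < (e / 4)%:E)%E -> (2%:E * a + 2%:E * b < e%:E)%E.
Proof.
case: a b => [a| |] [b| |]//; rewrite !lee_fin !lte_fin => a0 b0 ae be.
by lra.
Qed.

Lemma lte_Kmul (a : \bar R) (K e : R) : 0 <= K -> (0 <= a)%E ->
  (a < (e / (K + 1))%:E)%E -> 0 < e -> (K%:E * a < e%:E)%E.
Proof.
case: a => [a| |]// K0; rewrite lee_fin !lte_fin => a0 ae e0.
have K1 : 0 < K + 1 by lra.
move: ae; rewrite ltr_pdivlMr// => ae.
by nra.
Qed.

(** The L2-closure of the trigonometric polynomials with frequencies in D. *)
Definition tapprox D f := forall eps : R, 0 < eps -> exists ps,
  (forall p, p \in ps -> D p.1) /\ (I2 (fun x => (f x - trig ps x)%R) < eps%:E)%E.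

Lemma approx_close D f : cmeas f ->
  (forall eps : R, 0 < eps -> exists g, [/\ cmeas g, tapprox D g &
     (I2 (fun x => (f x - g x)%R) < eps%:E)%E]) -> tapprox D f.
Proof.
move=> mf H e e0; have e4 : 0 < e / 4 by rewrite divr_gt0.
have [g [mg ag fg]] := H _ e4; have [ps [Dps gps]] := ag _ e4.
exists ps; split=> //.
rewrite (_ : (fun x => f x - trig ps x) = fun x => (f x - g x) + (g x - trig ps x)).
  apply: le_lt_trans (I2D (cmeasB mf mg) (cmeasB mg (cmeas_trig ps))) _.
  by apply: lte_2D2 => //; exact: I2_ge0.
by apply/funext => x; rewrite addrA subrK.
Qed.

Lemma approxD D f g : cmeas f -> cmeas g -> tapprox D f -> tapprox D g ->
  tapprox D (fun x => f x + g x).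
Proof.
move=> mf mg af ag e e0; have e4 : 0 < e / 4 by rewrite divr_gt0.
have [ps [Dps fps]] := af _ e4; have [qs [Dqs gqs]] := ag _ e4.
exists (ps ++ qs); split.
  by move=> p; rewrite mem_cat => /orP[/Dps|/Dqs].
rewrite (_ : (fun x => _) = fun x => (f x - trig ps x) + (g x - trig qs x)).
  apply: le_lt_trans (I2D (cmeasB mf (cmeas_trig ps)) (cmeasB mg (cmeas_trig qs))) _.
  by apply: lte_2D2 => //; exact: I2_ge0.
by apply/funext => x; rewrite trigD opprD addrACA.
Qed.

Lemma approxZ D (c : R[i]) f : cmeas f -> tapprox D f -> tapprox D (fun x => c * f x).
Proof.
move=> mf af e e0; have c0 := sqn_ge0 c.
have [|ps [Dps fps]] := af (e / (sqn c + 1)); first by rewrite divr_gt0// ltr_wpDl.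
exists [seq (p.1, c * p.2) | p <- ps]; split.
  by move=> _ /mapP[p pps ->]; exact: (Dps _ pps).
rewrite (_ : (fun x => _) = fun x => c * (f x - trig ps x)); last first.
  by apply/funext => x; rewrite trigZ mulrBr.
apply: le_lt_trans (I2M (cmeas_cst c) (cmeasB mf (cmeas_trig ps)) c0 _) _ => //.
by apply: lte_Kmul => //; exact: I2_ge0.
Qed.

Lemma I2_0 : I2 (fun=> 0) = 0%E.
Proof. by rewrite /I2; under eq_integral do rewrite sqn0; rewrite integral0. Qed.

Lemma approx_trig D ps : (forall t, tapprox D (fun x => cexp2pi (t * x))) ->
  tapprox D (trig ps).
Proof.
move=> aD; elim: ps => [|p ps IH].
  move=> e e0; exists [::]; split => //.
  rewrite (_ : (fun x => _) = fun=> 0); first by rewrite I2_0 lte_fin.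
  by apply/funext => x; rewrite subrr.
rewrite (_ : trig _ = fun x => p.2 * cexp2pi (p.1 * x) + trig ps x); last first.
  by apply/funext => x; rewrite /trig big_cons.
have me := cmeas_cexp2pi p.1.
apply: approxD => //; first by apply: cmeasM => //; exact: cmeas_cst.
- exact: cmeas_trig.
- exact: approxZ.
Qed.

Lemma approx_sub D f : cmeas f -> (forall t, tapprox D (fun x => cexp2pi (t * x))) ->
  tapprox setT f -> tapprox D f.
Proof.
move=> mf aD af; apply: approx_close => // e e0; have [ps [_ fps]] := af e e0.
by exists (trig ps); split => //; [exact: cmeas_trig|exact: approx_trig].
Qed.

Lemma approx_setT_trig ps : tapprox setT (trig ps).
Proof.
move=> e e0; exists ps; split => //.
rewrite (_ : (fun x => _) = fun=> 0); first by rewrite I2_0 lte_fin.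
by apply/funext => x; rewrite subrr.
Qed.

Lemma approxM f g (K : R) : cmeas f -> cmeas g -> 0 <= K ->
  (forall x, sqn (f x) <= K) -> tapprox setT f -> tapprox setT g ->
  tapprox setT (fun x => f x * g x).
Proof.
move=> mf mg K0 fK af ag; apply: approx_close; first exact: cmeasM.
move=> e e0; have e4 : 0 < e / 4 by rewrite divr_gt0.
have [|qs [_ gqs]] := ag (e / 4 / (K + 1)); first by rewrite divr_gt0// ltr_wpDl.
have [L L0 qL] := trig_bounded qs.
have [|ps [_ fps]] := af (e / 4 / (L + 1)); first by rewrite divr_gt0// ltr_wpDl.
exists (fun x => trig ps x * trig qs x); split.
- by apply: cmeasM; exact: cmeas_trig.
- rewrite (_ : (fun x => _) = trig [seq (p.1 + q.1, p.2 * q.2) | p <- ps, q <- qs]).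
    exact: approx_setT_trig.
  by apply/funext => x; rewrite trigM.
have mgq := cmeasB mg (cmeas_trig qs); have mfp := cmeasB mf (cmeas_trig ps).
rewrite (_ : (fun x => _) = fun x => f x * (g x - trig qs x) +
    trig qs x * (f x - trig ps x)); last by apply/funext => x; ring.
apply: le_lt_trans (I2D (cmeasM mf mgq) (cmeasM (cmeas_trig qs) mfp)) _.
apply: lte_2D2; [exact: I2_ge0|exact: I2_ge0|..].
  by apply: le_lt_trans (I2M mf mgq K0 fK) _; apply: lte_Kmul => //; exact: I2_ge0.
by apply: le_lt_trans (I2M (cmeas_trig qs) mfp L0 qL) _; apply: lte_Kmul => //; exact: I2_ge0.
Qed.

(** Dominated convergence in L2. *)
Lemma approx_dominated (g_ : nat -> R -> R) (g h : R -> R) :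
  (forall n, measurable_fun setT (g_ n)) -> measurable_fun setT g ->
  measurable_fun setT h -> (\int[nu]_x (h x ^+ 2)%:E < +oo)%E ->
  (forall n x, `|g_ n x| <= h x) -> (forall x, g_ n x @[n --> \oo] --> g x) ->
  (forall n, tapprox setT (fun x => (g_ n x)%:C%C)) ->
  tapprox setT (fun x => (g x)%:C%C).
Proof.
move=> mg_ mg mh h2 g_h g_g ag.
have gh x : `|g x| <= h x by apply: (cvg_norm_le (g_g x)) => n; exact: g_h.
apply: approx_close; first exact: cmeas_real.
move=> e e0.
pose F n (x : R) : \bar R := ((g x - g_ n x) ^+ 2)%:E.
have [|||||_ _ cF] := @dominated_convergence _ _ _ nu setT measurableT
    F (cst 0%E) (fun x => (4 * h x ^+ 2)%:E).
- by move=> n; apply/measurable_EFinP; apply: measurable_funX; exact: measurable_funB.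
- exact: measurable_cst.
- apply: aeW => x _; apply/cvg_EFin; first exact: nearW.
  have H : (g x - g_ n x) * (g x - g_ n x) @[n --> \oo] -->
      (g x - g x) * (g x - g x).
    by apply: cvgM; apply: cvgB => //; exact: cvg_cst.
  rewrite subrr mulr0 in H.
  rewrite (_ : fine \o _ = fun n => (g x - g_ n x) * (g x - g_ n x)) //.
- rewrite (_ : (fun x => _) = fun x => 4%:E * (h x ^+ 2)%:E)%E//.
  apply: integrableZl => //; apply/integrableP; split.
    by apply/measurable_EFinP; exact: measurable_funX.
  by under eq_integral do rewrite gee0_abs ?lee_fin ?sqr_ge0//.
- apply: aeW => x n _; rewrite /F gee0_abs ?lee_fin ?sqr_ge0//.
  have : `|g x - g_ n x| <= 2 * h x.
    by rewrite (le_trans (ler_normB _ _))// mulrDl mul1r lerD.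
  rewrite -[(g x - _) ^+ 2]real_normK ?num_real// => H.
  rewrite (_ : 4 * h x ^+ 2 = (2 * h x) ^+ 2); last by ring.
  by rewrite lerXn2r ?nnegrE ?(le_trans _ H).
have [n Fn] : exists n, (\int[nu]_x F n x < e%:E)%E.
  move: cF; rewrite integral0 => /fine_cvgP[[n1 _ F1] /cvgrPdist_lt/(_ _ e0)[n2 _ F2]].
  exists (maxn n1 n2); have := F1 _ (leq_maxl n1 n2); have := F2 _ (leq_maxr n1 n2).
  rewrite /= sub0r normrN => /(le_lt_trans (ler_norm _)) hh /fineK <-.
  by rewrite lte_fin.
exists (fun x => (g_ n x)%:C%C); split; [exact: cmeas_real|exact: ag|].
rewrite /I2; under eq_integral do rewrite -rmorphB/= /sqn/= expr0n/= addr0.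
exact: Fn.
Qed.

End L2_approximation.

Section density.
Context {R : realType} (nu : probability R R).
Implicit Types (g h : R -> R) (ps : seq (R * R[i])).
Local Notation tapprox := (tapprox nu).
Local Notation I2 := (I2 nu).

(** Bounded measurable functions in the closure of the trigonometric
    polynomials: an algebra closed under bounded pointwise limits. *)
Definition good (g : R -> R) := [/\ measurable_fun setT g,
  exists C, forall x, `|g x| <= C & tapprox setT (fun x => (g x)%:C%C)].

Lemma good_trig g ps : measurable_fun setT g -> (exists C, forall x, `|g x| <= C) ->
  (forall x, (g x)%:C%C = trig ps x) -> good g.
Proof.
move=> mg gC E; split=> //; rewrite (_ : (fun x => _) = trig ps).
  exact: approx_setT_trig.
by apply/funext.
Qed.

Lemma good_cst (c : R) : good (fun=> c).
Proof.
apply: (@good_trig _ [:: (0, c%:C%C)]); first exact: measurable_cst.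
  by exists `|c|.
by move=> x; rewrite /trig big_seq1 mul0r cexp2pi0 mulr1.
Qed.

Lemma good_cos (t : R) : good (fun x => cos (2 * pi * (t * x))).
Proof.
apply: (@good_trig _ [:: (t, (2^-1)%:C%C); (- t, (2^-1)%:C%C)]).
- by apply: continuous_measurable_fun; exact: continuous_cos_lin.
- by exists 1 => x; exact: cos_max.
- move=> x; rewrite /trig !big_cons big_nil addr0 mulNr cexp2piN.
  by apply: complexP; rewrite ?ReD ?ImD ?ReZ ?ImZ /=; lra.
Qed.

Lemma good_sin (t : R) : good (fun x => sin (2 * pi * (t * x))).
Proof.
apply: (@good_trig _ [:: (t, (0 +i* - 2^-1)%C); (- t, (0 +i* 2^-1)%C)]).
- by apply: continuous_measurable_fun; exact: continuous_sin_lin.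
- by exists 1 => x; exact: sin_max.
- move=> x; rewrite /trig !big_cons big_nil addr0 mulNr cexp2piN.
  by apply: complexP; rewrite ?ReD ?ImD ?ReM ?ImM /=; lra.
Qed.

Lemma goodD g h : good g -> good h -> good (fun x => g x + h x).
Proof.
move=> [mg [C gC] ag] [mh [D hD] ah]; split; first exact: measurable_funD.
  by exists (C + D) => x; rewrite (le_trans (ler_normD _ _))// lerD.
under eq_fun do rewrite rmorphD.
by apply: approxD => //; exact: cmeas_real.
Qed.

Lemma goodM g h : good g -> good h -> good (fun x => g x * h x).
Proof.
move=> [mg [C gC] ag] [mh [D hD] ah]; split; first exact: measurable_funM.
  by exists (C * D) => x; rewrite normrM ler_pM.
under eq_fun do rewrite rmorphM.
apply: (@approxM _ _ _ _ (C ^+ 2)); rewrite ?sqr_ge0//; do ?exact: cmeas_real.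
move=> x; rewrite /sqn /= expr0n/= addr0 -[_ ^+ 2]real_normK ?num_real//.
by rewrite lerXn2r ?nnegrE// (le_trans _ (gC x)).
Qed.

Lemma goodZ (c : R) g : good g -> good (fun x => c * g x).
Proof. by move=> gg; apply: goodM => //; exact: good_cst. Qed.

Lemma good_lim (g_ : nat -> R -> R) g (C : R) : (forall n, good (g_ n)) ->
  (forall n x, `|g_ n x| <= C) -> (forall x, g_ n x @[n --> \oo] --> g x) -> good g.
Proof.
move=> gg gC cg.
have mg_ n : measurable_fun setT (g_ n) by have [] := gg n.
have mg : measurable_fun setT g by apply: (measurable_fun_cvg mg_) => x _; exact: cg.
split => //; first by exists C => x; apply: (cvg_norm_le (cg x)).
apply: (@approx_dominated _ _ g_ g (fun=> C)) => //.
- rewrite integral_cst//; apply: lte_mul_pinfty; rewrite ?lee_fin ?sqr_ge0//.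
  by rewrite ltey_eq fin_num_measure.
- by move=> n; have [] := gg n.
Qed.

(** The iterates tend to the sign of y on [-1, 1]: the fixed points -1 and 1 are
    attracting and 0 is repelling. *)
Let sgstep (y : R) := (3 * y - y ^+ 3) / 2.

Let sgstep_itv y : `|y| <= 1 -> `|sgstep y| <= 1.
Proof.
rewrite !ler_norml => /andP[h1 h2].
have e1 : 1 - sgstep y = (1 - y) ^+ 2 * (2 + y) / 2 by rewrite /sgstep; field.
have e2 : sgstep y + 1 = (1 + y) ^+ 2 * (2 - y) / 2 by rewrite /sgstep; field.
have p1 : 0 <= 1 - sgstep y by rewrite e1 divr_ge0// mulr_ge0 ?sqr_ge0//; lra.
have p2 : 0 <= sgstep y + 1 by rewrite e2 divr_ge0// mulr_ge0 ?sqr_ge0//; lra.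
by apply/andP; split; lra.
Qed.

Let iter_sgstep_itv n y : `|y| <= 1 -> `|iter n sgstep y| <= 1.
Proof. by move=> y1; elim: n => //= n; exact: sgstep_itv. Qed.

Let iter_sgstep_gt0 y : 0 < y <= 1 -> iter n sgstep y @[n --> \oo] --> (1 : R).
Proof.
move=> /andP[y0 y1].
have H n : [/\ y <= iter n sgstep y, iter n sgstep y <= 1 &
    1 - iter n sgstep y <= (1 - y / 2) ^+ n].
  elim: n => [|n] /=; first by rewrite expr0 lexx y1; split => //; lra.
  rewrite exprS; move: ((1 - y / 2) ^+ n) (iter n sgstep y) => E z [yz z1 zE].
  have z0 : 0 < z by exact: lt_le_trans yz.
  have e1 : sgstep z - z = z * ((1 - z) * (1 + z)) / 2 by rewrite /sgstep; field.
  have p1 : 0 <= sgstep z - z.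
    by rewrite e1 divr_ge0// !mulr_ge0//; lra.
  have e2 : 1 - sgstep z = (1 - z) * (1 - z / 2 - z ^+ 2 / 2) by rewrite /sgstep; field.
  have z2 : 0 <= z ^+ 2 / 2 by rewrite divr_ge0// sqr_ge0.
  have z21 : z ^+ 2 <= 1 by rewrite expr_le1// ltW.
  split; first lra.
    by rewrite -subr_ge0 e2 mulr_ge0//; lra.
  rewrite e2 mulrC; apply: ler_pM => //; lra.
have cE : (1 - y / 2) ^+ n @[n --> \oo] --> (0 : R).
  by apply: cvg_expr; rewrite ger0_norm; lra.
rewrite -[X in _ --> X]subr0.
rewrite (_ : (fun n => _) = fun n => 1 - (1 - iter n sgstep y)); last first.
  by apply/funext => n; rewrite opprB addrC subrK.
apply: cvgB; first exact: cvg_cst.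
apply: (squeeze_cvgr _ (cvg_cst 0) cE); apply: nearW => n.
by have [h1 h2 h3] := H n; rewrite subr_ge0 h2.
Qed.

Let iter_sgstepN n y : iter n sgstep (- y) = - iter n sgstep y.
Proof. by elim: n => //= n ->; rewrite /sgstep; lra. Qed.

Let iter_sgstep y : `|y| <= 1 -> iter n sgstep y @[n --> \oo] --> (Num.sg y : R).
Proof.
move=> y1; have [y0|y0|->] := ltgtP y 0.
- rewrite ltr0_sg// (_ : (fun n => _) = fun n => - iter n sgstep (- y)); last first.
    by apply/funext => n; rewrite iter_sgstepN opprK.
  apply: cvgN; apply: iter_sgstep_gt0; rewrite oppr_gt0 y0/=.
  by rewrite -(ltr0_norm y0).
- by rewrite gtr0_sg//; apply: iter_sgstep_gt0; rewrite y0/= -(gtr0_norm y0).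
- rewrite sgr0 (_ : (fun n => _) = fun=> 0); first exact: cvg_cst.
  by apply/funext; elim=> //= n ->; rewrite /sgstep mulr0 expr0n/= subrr mul0r.
Qed.

(** The sign is a pointwise limit of polynomials, and good functions form an
    algebra. *)
Lemma good_sg g : good g -> (forall x, `|g x| <= 1) -> good (fun x => Num.sg (g x)).
Proof.
move=> gg g1.
apply: (@good_lim (fun n x => iter n sgstep (g x)) _ 1).
- elim=> // n gn /=; rewrite /sgstep.
  rewrite (_ : (fun x => _) = fun x => (3 / 2) * iter n sgstep (g x) +
      (- 2^-1) * (iter n sgstep (g x) * (iter n sgstep (g x) * iter n sgstep (g x)))).
    apply: goodD; first exact: goodZ.
    by apply: goodZ; apply: goodM => //; exact: goodM.
  by apply/funext => x; rewrite -/sgstep; field.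
- by move=> n x; exact: iter_sgstep_itv.
- by move=> x; exact: iter_sgstep.
Qed.

Import HBNNSimple.

Section support.
Variable A : R.
Hypothesis nuA : nu (~` `[0, A]%classic) = 0%E.

Lemma good_supp g h : good g -> measurable_fun setT h ->
  (exists C, forall x, `|h x| <= C) -> (forall x, 0 <= x <= A -> g x = h x) -> good h.
Proof.
move=> [mg gC ag] mh hC gh; split => // e e0; have [ps [Dps fps]] := ag e e0.
exists ps; split => //; apply: le_lt_trans fps; rewrite le_eqVlt; apply/orP; left.
apply/eqP; apply: ae_eq_integral => //.
- by apply/measurable_EFinP; apply: cmeas_sqn; apply: cmeasB; [exact: cmeas_real|exact: cmeas_trig].
- by apply/measurable_EFinP; apply: cmeas_sqn; apply: cmeasB; [exact: cmeas_real|exact: cmeas_trig].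
exists (~` `[0, A]%classic); split => //; first exact: measurableC.
move=> x /= H; rewrite in_itv/= => /gh ghx; apply: H => _.
by rewrite ghx.
Qed.

(** On the support, the sign of sin (2 pi t (x - a)) is that of x - a once the
    half period 1 / (2 t) exceeds A. *)
Lemma good_ray (a : R) : good \1_(`]-oo, a[%classic : set R).
Proof.
have m1 : measurable_fun setT (\1_(`]-oo, a[%classic : set R) : R -> R).
  exact: measurable_indic.
have b1 : exists C, forall x, `|(\1_(`]-oo, a[%classic : set R) : R -> R) x| <= C.
  by exists 1 => x; rewrite indicE; case: (_ \in _); rewrite ?normr1 ?normr0.
have E x : (\1_(`]-oo, a[%classic : set R) : R -> R) x = (x < a)%R%:R :> R.
  by rewrite indicE mem_setE in_itv.
have [a0|a0] := leP a 0.
  apply: (good_supp (good_cst 0)) => // x /andP[x0 _]; rewrite E.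
  by rewrite ltNge (le_trans a0 x0).
have [aA|aA] := ltP A a.
  by apply: (good_supp (good_cst 1)) => // x /andP[_ xA]; rewrite E (le_lt_trans xA).
pose t : R := (2 * (A + 1))^-1.
have A0 : 0 < A by exact: lt_le_trans aA.
have t0 : 0 < t by rewrite invr_gt0; lra.
pose s x := sin (2 * pi * (t * x)) * cos (2 * pi * (t * a)) +
  (- sin (2 * pi * (t * a))) * cos (2 * pi * (t * x)).
have sE x : s x = sin (2 * pi * (t * (x - a))).
  by rewrite /s mulrBr [in RHS]mulrBr sinB; ring.
have gs : good s.
  apply: goodD; last by apply: goodZ; exact: good_cos.
  by apply: goodM; [exact: good_sin|exact: good_cst].
have gsg := good_sg gs (fun x => eq_ind_r (fun z => `|z| <= 1) (sin_max _) (sE x)).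
have : good (fun x => 2^-1 * (Num.sg (s x) * Num.sg (s x) + (-1) * Num.sg (s x))).
  by apply: goodZ; apply: goodD; [exact: goodM|exact: goodZ].
move=> /good_supp; apply => // x /andP[x0 xA]; rewrite E.
have pos y : 0 < y <= A -> 0 < sin (2 * pi * (t * y)).
  move=> /andP[y0 yA]; apply: sin_gt0_pi; rewrite !mulr_gt0 ?pi_gt0//=.
  rewrite mulrAC -[ltRHS]mul1r ltr_pM2r ?pi_gt0// /t invfM.
  by rewrite mulrA mulVKf// mulrC ltr_pdivrMr; lra.
case: (ltgtP x a) => [xa|ax|->].
- have : 0 < sin (2 * pi * (t * (a - x))) by apply: pos; lra.
  rewrite -opprB !mulrN sinN -sE oppr_gt0 => h; rewrite ltr0_sg//=; lra.
- have : 0 < sin (2 * pi * (t * (x - a))) by apply: pos; lra.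
  by rewrite -sE => h; rewrite gtr0_sg//=; lra.
- by rewrite sE subrr !mulr0 sin0 sgr0 /=; lra.
Qed.

(** Rays generate the Borel sets, and good indicators form a sigma-algebra. *)
Lemma good_indic (E : set R) : measurable E -> good \1_E.
Proof.
have -> : @measurable _ R = <<s @RGenInftyO.G R >> by exact: RGenInftyO.measurableE.
move: E; apply: (@smallest_sub _ _ _ [set E | good \1_E]); last first.
  by move=> _ [a ->]; exact: good_ray.
split => /=.
- by rewrite indic0; exact: good_cst.
- move=> E gE; rewrite setTD (_ : \1_(~` E) = fun x => 1 + (-1) * \1_E x).
    by apply: goodD; [exact: good_cst|exact: goodZ].
  apply/funext => x; rewrite !indicE in_setC; case: (x \in E) => /=; lra.
- move=> F gF.
  apply: (@good_lim (fun n => \1_(\big[setU/set0]_(k < n) F k)) _ 1).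
  + elim=> [|n IH]; first by rewrite big_ord0 indic0; exact: good_cst.
    rewrite big_ord_recr/= (_ : \1_(_ `|` _) = fun x =>
       \1_(\big[setU/set0]_(k < n) F k) x + \1_(F n) x +
       (-1) * (\1_(\big[setU/set0]_(k < n) F k) x * \1_(F n) x)).
      by apply: goodD; [exact: goodD|apply: goodZ; exact: goodM].
    apply/funext => x; rewrite !indicE in_setU.
    by case: (x \in _); case: (x \in _) => /=; lra.
  + by move=> n x; rewrite indicE; case: (_ \in _); rewrite ?normr1 ?normr0.
  + move=> x; rewrite indicE; have [|] := boolP (x \in _).
      rewrite inE => -[k _ Fkx]; apply: cvg_near_cst; exists k.+1 => // n /= kn.
      by rewrite indicE mem_set// -bigcup_mkord; exists k.
    move=> /negP xF; apply: cvg_near_cst; apply: nearW => n.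
    rewrite indicE memNset// -bigcup_mkord => -[k _ Fkx]; apply: xF.
    by rewrite inE; exists k.
Qed.

Lemma good_nnsfun (g : {nnsfun R >-> R}) : good (g : R -> R).
Proof.
rewrite (_ : (g : R -> R) =
    fun x => \sum_(y <- fset_set (range g)) y * \1_(g @^-1` [set y]) x); last first.
  by apply/funext => x; rewrite fimfunE fsbig_finite.
elim: (fset_set _ : seq R) => [|y r IH].
  by under eq_fun do rewrite big_nil; exact: good_cst.
under eq_fun do rewrite big_cons.
by apply: goodD => //; apply: goodZ; exact: good_indic.
Qed.

Lemma approx_nonneg (g : R -> R) : measurable_fun setT g -> (forall x, 0 <= g x) ->
  (\int[nu]_x (g x ^+ 2)%:E < +oo)%E -> tapprox setT (fun x => (g x)%:C%C).
Proof.
move=> mg g0 g2.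
have mE : measurable_fun setT (EFin \o g) by exact/measurable_EFinP.
pose g_ := nnsfun_approx measurableT mE.
have cg x : (g_ n : R -> R) x @[n --> \oo] --> g x.
  have := cvg_nnsfun_approx measurableT mE (fun x _ => g0 x : (0 <= (EFin \o g) x)%E) (I : setT x).
  by move=> /fine_cvgP[_].
apply: (@approx_dominated _ _ (fun n => g_ n : R -> R) g g) => //.
- move=> n x; rewrite ger0_norm//.
  have nd : nondecreasing_seq (fun n => (g_ n : R -> R) x).
    by move=> m k mk; have /lefP := nd_nnsfun_approx measurableT mE mk.
  have := nondecreasing_cvgn_le nd (cvgP _ (cg x)) n.
  by rewrite (cvg_lim _ (cg x)).
- by move=> n; have [] := good_nnsfun (g_ n).
Qed.

Lemma approx_real (g : R -> R) : measurable_fun setT g ->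
  (\int[nu]_x (g x ^+ 2)%:E < +oo)%E -> tapprox setT (fun x => (g x)%:C%C).
Proof.
move=> mg g2.
have aux (h : R -> R) : measurable_fun setT h -> (forall x, h x ^+ 2 = g x ^+ 2) ->
    tapprox setT (fun x => (Num.max (h x) 0)%:C%C).
  move=> mh hg; apply: approx_nonneg.
  - exact: measurable_maxr.
  - by move=> x; rewrite le_max lexx orbT.
  apply: le_lt_trans g2; apply: ge0_le_integral => //.
  - by move=> x _; rewrite lee_fin sqr_ge0.
  - by apply/measurable_EFinP; apply: measurable_funX; exact: measurable_maxr.
  - by apply/measurable_EFinP; exact: measurable_funX.
  - move=> x _; rewrite lee_fin -hg /Num.max; case: ifP => // _.
    by rewrite expr0n sqr_ge0.
rewrite (_ : (fun x => _) = fun x => (Num.max (g x) 0)%:C%C +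
    (-1) * (Num.max (- g x) 0)%:C%C); last first.
  apply/funext => x; rewrite mulN1r -rmorphB; congr (_%:C%C).
  have [h|h] := leP 0 (g x).
    have h' : - g x <= 0 by rewrite oppr_le0.
    by rewrite (max_r h') subr0.
  have h' : 0 <= - g x by rewrite oppr_ge0 ltW.
  by rewrite (max_l h') sub0r opprK.
have mN : measurable_fun setT (fun x => - g x) by exact: measurable_funN.
have cm (h : R -> R) : measurable_fun setT h -> cmeas (fun x => (Num.max (h x) 0)%:C%C).
  by move=> mh; apply: cmeas_real; exact: measurable_maxr.
apply: approxD; [exact: cm| |exact: aux|].
  by apply: cmeasM; [exact: cmeas_cst|exact: cm].
by apply: approxZ; [exact: cm|apply: aux => // x; rewrite sqrrN].
Qed.

Lemma approx_I2 (f : R -> R[i]) : cmeas f -> (I2 f < +oo)%E -> tapprox setT f.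
Proof.
move=> [mr mi] f2.
rewrite (_ : f = fun x => (complex.Re (f x))%:C%C + 'i%C * (complex.Im (f x))%:C%C).
  have fin (h : R -> R) : measurable_fun setT h -> (forall x, h x ^+ 2 <= sqn (f x)) ->
      (\int[nu]_x (h x ^+ 2)%:E < +oo)%E.
    move=> mh hf; apply: le_lt_trans f2; apply: ge0_le_integral => //.
    - by move=> x _; rewrite lee_fin sqr_ge0.
    - by apply/measurable_EFinP; exact: measurable_funX.
    - by apply/measurable_EFinP; exact: cmeas_sqn.
    - by move=> x _; rewrite lee_fin.
  have ar : tapprox setT (fun x => (complex.Re (f x))%:C%C).
    by apply: approx_real => //; apply: fin => // x; rewrite lerDl sqr_ge0.
  have ai : tapprox setT (fun x => (complex.Im (f x))%:C%C).
    by apply: approx_real => //; apply: fin => // x; rewrite lerDr sqr_ge0.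
  have cr := cmeas_real mr; have ci := cmeas_real mi.
  apply: approxD => //; last exact: approxZ.
  by apply: cmeasM => //; exact: cmeas_cst.
by apply/funext => x; rewrite -complexE.
Qed.

End support.

End density.

(** * Spectrality from lower bounds at infinitely many levels *)

Section plancherel.
Context {R : realType} (nu : probability R R).
Local Notation e := (@cexp2pi R).

Lemma cLnorm2E (f : R -> R[i]) : cLnorm2 nu f = ((I2 nu f) `^ 2^-1)%E.
Proof.
rewrite /cLnorm2 unlock /I2; congr (_ `^ _)%E; apply: eq_integral => x _ /=.
rewrite normc_sqn ger0_norm ?sqrtr_ge0// ?poweR_EFin.
by rewrite powR_mulrn ?sqrtr_ge0// sqr_sqrtr ?sqn_ge0.
Qed.

Lemma cLnorm2_lt (f : R -> R[i]) (eps : R) : 0 < eps ->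
  (I2 nu f < (eps ^+ 2)%:E)%E -> (cLnorm2 nu f < eps%:E)%E.
Proof.
move=> e0; rewrite cLnorm2E; have := I2_ge0 nu f.
case: (I2 nu f) => [a| |]//; rewrite lee_fin lte_fin => a0 ae.
rewrite poweR_EFin lte_fin powR12_sqrt//.
by rewrite -(gtr0_norm e0) -sqrtr_sqr ltr_sqrt// exprn_gt0.
Qed.

Lemma cL2_I2 (f : R -> R[i]) : cL2 nu f -> cmeas f /\ (I2 nu f < +oo)%E.
Proof.
move=> [mr mi f2]; split => //.
by move: f2; rewrite cLnorm2E => /lty_poweRy; apply; rewrite invr_eq0.
Qed.

Lemma I2_cL2 (f : R -> R[i]) : cmeas f -> (I2 nu f < +oo)%E -> cL2 nu f.
Proof. by move=> [mr mi] f2; split => //; rewrite cLnorm2E poweR_lty. Qed.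

Lemma bounded_Rintegral_sum (I : Type) (r : seq I) (F : I -> R -> R) :
  (forall i, measurable_fun setT (F i) /\ exists C, forall x, `|F i x| <= C) ->
  \int[nu]_x (\sum_(i <- r) F i x) = \sum_(i <- r) \int[nu]_x F i x /\
  nu.-integrable setT (EFin \o (fun x => \sum_(i <- r) F i x)).
Proof.
move=> HF; have intF i : nu.-integrable setT (EFin \o F i).
  by have [mF [C FC]] := HF i; exact: (bounded_integrable nu mF FC).
elim: r => [|i r [IH IH']].
  rewrite big_nil; under eq_Rintegral do rewrite big_nil.
  rewrite Rintegral_cst_prob; split => //.
  rewrite (_ : _ \o _ = cst 0%E); first exact: integrable0.
  by apply/funext => x /=; rewrite big_nil.
rewrite big_cons -IH -RintegralD//; split.
  by apply: eq_Rintegral => x _; rewrite big_cons.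
rewrite (_ : _ \o _ = (EFin \o F i) \+ (EFin \o (fun x => (\sum_(i <- r) F i x)%R)))%E.
  exact: integrableD.
by apply/funext => x /=; rewrite big_cons EFinD.
Qed.

Lemma conjcM (z w : R[i]) : (z * w)^*%C = z^*%C * w^*%C.
Proof. by case: z w => [a b] [c d]; apply: complexP; rewrite /=; ring. Qed.

Lemma sqn_sum (I : Type) (r : seq I) (F : I -> R[i]) :
  sqn (\sum_(i <- r) F i) = \sum_(i <- r) \sum_(j <- r) complex.Re (F i * (F j)^*%C).
Proof.
rewrite /sqn Re_sum Im_sum !expr2 !big_distrlr /= -big_split /=.
apply: eq_bigr => i _; rewrite -big_split /=; apply: eq_bigr => j _.
by case: (F i) (F j) => [a b] [c d] /=; ring.
Qed.

Lemma Rintegral_Re_cexp2pi (z : R[i]) (t : R) :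
  \int[nu]_x complex.Re (z * e (t * x)) = complex.Re (z * charf nu t).
Proof.
have ic : nu.-integrable setT (EFin \o (fun x => cos (2 * pi * (t * x)))).
  apply: (bounded_integrable nu (C := 1)) => [|x]; last exact: cos_max.
  by apply: continuous_measurable_fun; exact: continuous_cos_lin.
have is_ : nu.-integrable setT (EFin \o (fun x => sin (2 * pi * (t * x)))).
  apply: (bounded_integrable nu (C := 1)) => [|x]; last exact: sin_max.
  by apply: continuous_measurable_fun; exact: continuous_sin_lin.
under eq_Rintegral do rewrite ReM /=.
rewrite RintegralB//; last 2 first.
- rewrite (_ : _ \o _ = fun x => (complex.Re z)%:E * (EFin \o (fun x => cos (2 * pi * (t * x)))) x)%E//.
  exact: integrableZl.
- rewrite (_ : _ \o _ = fun x => (complex.Im z)%:E * (EFin \o (fun x => sin (2 * pi * (t * x)))) x)%E//.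
  exact: integrableZl.
by rewrite !RintegralZl// ReM.
Qed.

Lemma I2_trig (ps : seq (R * R[i])) : I2 nu (trig ps) =
  (\sum_(p <- ps) \sum_(q <- ps)
     complex.Re (p.2 * (q.2)^*%C * charf nu (p.1 - q.1)))%:E.
Proof.
pose F (p q : R * R[i]) x := complex.Re (p.2 * (q.2)^*%C * e ((p.1 - q.1) * x)).
have HF p q : measurable_fun setT (F p q) /\ exists C, forall x, `|F p q x| <= C.
  have cm := cmeasM (cmeas_cst (p.2 * (q.2)^*%C)) (cmeas_cexp2pi (p.1 - q.1)).
  split; first by have [] := cm.
  exists (sqn (p.2 * (q.2)^*%C) + 1) => x; rewrite /F.
  have : complex.Re (p.2 * (q.2)^*%C * e ((p.1 - q.1) * x)) ^+ 2 <=
      sqn (p.2 * (q.2)^*%C).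
    by rewrite -[leRHS]mulr1 -(sqn_cexp2pi ((p.1 - q.1) * x)) -sqnM lerDl sqr_ge0.
  move: (complex.Re _) (sqn _) => a b ab; rewrite ler_norml.
  by apply/andP; split; nra.
have E x : sqn (trig ps x) = \sum_(p <- ps) \sum_(q <- ps) F p q x.
  rewrite /trig sqn_sum; apply: eq_bigr => p _; apply: eq_bigr => q _.
  rewrite /F; congr complex.Re; rewrite conjcM. rewrite -cexp2piN mulrACA -cexp2piD.
  by rewrite mulrBl.
have HF1 p : measurable_fun setT (fun x => \sum_(q <- ps) F p q x) /\
    exists C, forall x, `|\sum_(q <- ps) F p q x| <= C.
  split; first by apply: measurable_sum => q; have [] := HF p q.
  have /choice[C HC] : forall q, exists C, forall x, `|F p q x| <= C.
    by move=> q; have [_] := HF p q.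
  exists (\sum_(q <- ps) C q) => x; rewrite (le_trans (ler_norm_sum _ _ _))//.
  by apply: ler_sum => q _.
have [E1 int1] := bounded_Rintegral_sum ps HF1.
rewrite /I2; under eq_integral do rewrite E.
rewrite -[LHS]fineK; last exact: (integrable_fin_num measurableT int1).
congr (_%:E); rewrite -/(Rintegral _ _ _) E1; apply: eq_bigr => p _.
have [-> _] := bounded_Rintegral_sum ps (HF p); apply: eq_bigr => q _.
exact: Rintegral_Re_cexp2pi.
Qed.

Lemma charf0 : charf nu 0 = 1.
Proof.
apply: complexP; rewrite /charf /=; under eq_Rintegral do rewrite mul0r mulr0 ?cos0 ?sin0.
  by rewrite Rintegral_cst_prob.
by rewrite Rintegral_cst_prob.
Qed.

Lemma charfN (t : R) : charf nu (- t) = (charf nu t)^*%C.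
Proof.
apply: complexP; rewrite /charf /=.
  by apply: eq_Rintegral => x _; rewrite mulNr mulrN cosN.
under eq_Rintegral do rewrite mulNr mulrN sinN -mulN1r.
rewrite RintegralZl// ?mulN1r//.
apply: (bounded_integrable nu (C := 1)) => [|x]; last exact: sin_max.
by apply: continuous_measurable_fun; exact: continuous_sin_lin.
Qed.

(** Bessel identity for the projection of a character on orthonormal ones. *)
Lemma I2_projection (s : seq R) (x : R) : uniq s ->
  (forall l l', l \in s -> l' \in s -> l != l' -> charf nu (l - l') = 0) ->
  I2 nu (trig ((x, 1) :: [seq (l, - charf nu (x - l)) | l <- s])) =
  (1 - \sum_(l <- s) sqn (charf nu (x - l)))%:E.
Proof.
move=> us os; rewrite I2_trig; congr (_%:E).
have := charfN; have := charf0; move: (charf nu) os => c os c0 cN.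
rewrite !big_cons !big_map /= subrr c0 /=.
have -> : \sum_(l <- s) complex.Re (1 * (- c (x - l))^*%C * c (x - l)) =
    - \sum_(l <- s) sqn (c (x - l)).
  rewrite -sumrN; apply: eq_bigr => l _.
  by case: (c (x - l)) => a b; rewrite /sqn /=; ring.
rewrite [X in _ + X = _]big_seq [X in _ + X = _]big1 => [|l ls]; first by ring.
rewrite big_cons big_map (bigD1_seq l)//= subrr c0 big_seq_cond big1 ?addr0; last first.
  move=> l' /andP[l's l'l]; rewrite eq_sym in l'l.
  by rewrite (os _ _ ls l's l'l) mulr0.
rewrite -(opprB x) cN.
by case: (c (x - l)) => a b /=; ring.
Qed.

End plancherel.

Section spectrality.
Context {R : realType} (nu : probability R R).
Local Notation e := (@cexp2pi R).
Variables (C : R) (Q : nat -> nat) (B : nat -> {fset int}) (d : int) (eps : R).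
Hypothesis QB : hadamard C Q B.
Hypothesis nuQB : forall x, charf nu x = ftl Q B x.
Hypothesis nu_supp : nu (~` `[0, 2 * C]%classic) = 0%E.
Hypothesis d0 : d != 0.
Hypothesis dB : forall i b, b \in B i -> (d %| b)%Z.
Hypothesis eps0 : 0 < eps.
Hypothesis low : forall M, exists2 m, (M <= m)%N &
  lower_mod d eps (shift m Q) (shift m B).

(** The transform varies by at most eps / 2 over a distance 2 dl. *)
Let dl : R := eps / (64 * pi * (C + 1)).

Let C0 : 0 <= C. Proof. exact: hadamard_C QB. Qed.

Let dl0 : 0 < dl.
Proof. by rewrite divr_gt0// !mulr_gt0 ?pi_gt0// ltr_wpDl. Qed.

Let dlE : 16 * pi * C * (2 * dl) <= eps / 2.
Proof.
have p0 := pi_gt0 R.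
have h : 0 < 64 * pi * (C + 1) :> R by rewrite !mulr_gt0// ltr_wpDl.
rewrite /dl mulrA mulrA ler_pdivrMr//; move: p0; move: pi => p p0.
have : 0 <= p * eps by rewrite mulr_ge0// ltW.
have : 0 <= C * (p * eps) by rewrite !mulr_ge0// ltW.
by nra.
Qed.

Let eps1 : eps <= 1.
Proof.
have [m _ /(_ 0)[k /le_trans]] := low 0; apply; apply: sqn_ftl_le1.
exact: (hadamard_shift m QB).
Qed.

(** The lower bound on the remaining factors is required in a neighbourhood of
    l / denom Q m, of fixed size: x / denom Q m belongs to it for large m, whatever x. *)
Let stage (ms : nat * seq R) := spec Q B ms.1 ms.2 /\
  forall l, l \in ms.2 -> forall y, `|y| <= dl ->
    eps / 2 <= sqn (ftl (shift ms.1 Q) (shift ms.1 B) (l / denom Q ms.1 + y)).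

Let near0 m y : `|y| <= 2 * dl -> eps / 2 <= sqn (ftl (shift m Q) (shift m B) y).
Proof.
move=> y2; have QBm := hadamard_shift m QB.
have := sqn_ftl_lip QBm y 0; rewrite (ftl0 QBm) sqn1 subr0 => h.
have h2 : 16 * pi * C * `|y| <= eps / 2.
  by apply: le_trans dlE; rewrite ler_wpM2l// !mulr_ge0// pi_ge0.
have := ler_norm (- (sqn (ftl (shift m Q) (shift m B) y) - 1)); rewrite normrN.
by move: h h2 eps1; lra.
Qed.

Let stage0 : stage (0%N, [:: 0]).
Proof.
split; first exact: spec0.
move=> l; rewrite inE => /eqP -> y yd; rewrite mul0r add0r; apply: near0.
by rewrite (le_trans yd)//; have := dl0; lra.
Qed.

Let denom_large (c : R) : exists M, forall m, (M <= m)%N -> c <= dl * denom Q m.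
Proof.
exists (Num.truncn (`|c| / dl)).+1 => m Mm.
rewrite mulrC -ler_pdivrMr//; apply: (@le_trans _ _ (`|c| / dl)).
  by rewrite ler_pM2r ?invr_gt0// ler_norm.
apply: le_trans (denom_ge QB m); apply: (@le_trans _ _ m%:R).
  by rewrite (le_trans (ltW (truncnS_gt _)))// ler_nat.
by rewrite -natrX ler_nat ltnW// ltn_expl.
Qed.

(** Extend the spectrum, leave the old points in place, as denom Q m' is so large
    that the remaining factors have a transform near 1 at l / denom Q m', and
    translate the new points by multiples of denom Q m' / d chosen through the lower
    bound. *)
Let step ms : stage ms -> exists ms', [/\ stage ms', (ms.1 < ms'.1)%N &
  {subset ms.2 <= ms'.2}].
Proof.
case: ms => m s [/= sm _].
have [M HM] := denom_large (\sum_(l <- s) `|l|).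
have [m' Mm' lowm'] := low (maxn M m.+1).
have [s1 [ss1 sm']] := spec_extend QB (m' - m) sm.
have mm' : (m < m')%N by rewrite (leq_trans _ Mm')// leq_maxr.
rewrite subnKC ?(ltnW mm')// in sm'.
have P0 : 0 < denom Q m' :> R by rewrite (denom_gt0 QB).
have /choice[g Hg] : forall l : R, exists k : int, if l \in s then k = 0 else
    eps <= sqn (ftl (shift m' Q) (shift m' B) (l / denom Q m' + k%:~R / d%:~R)).
  by move=> l; have [_|_] := boolP (l \in s); [exists 0|exact: lowm'].
have QBm := hadamard_shift m' QB.
exists (m', [seq l + denom Q m' * ((g l)%:~R / d%:~R) | l <- s1]); split => //=; last first.
  move=> l ls; apply/mapP; exists l; first exact: ss1.
  by have := Hg l; rewrite ls => ->; rewrite mul0r mulr0 addr0.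
split => /=; first exact: (spec_translate QB _ d0 dB sm').
move=> _ /mapP[l ls1 ->] y yd; have := Hg l; case: ifPn => ls.
  move=> ->; rewrite mul0r mulr0 addr0; apply: near0.
  rewrite (le_trans (ler_normD _ _))// mulrDl mul1r lerD//.
  rewrite normrM normfV (gtr0_norm P0) ler_pdivrMr//.
  apply: le_trans (HM m' _); last by rewrite (leq_trans _ Mm')// leq_maxl.
  rewrite (big_rem l)//= lerDl; apply: sumr_ge0 => *; exact: normr_ge0.
have -> : (l + denom Q m' * ((g l)%:~R / d%:~R)) / denom Q m' =
    l / denom Q m' + (g l)%:~R / d%:~R.
  by rewrite mulrDl; congr (_ + _); rewrite mulrC mulKf// gt_eqF.
set z := l / _ + _ => h.
have h2 := sqn_ftl_lip QBm (z + y) z.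
have h3 : 16 * pi * C * `|z + y - z| <= eps / 2.
  apply: le_trans dlE; rewrite addrC addKr.
  by rewrite ler_wpM2l ?mulr_ge0 ?pi_ge0//; have := dl0; lra.
have := ler_norm (- (sqn (ftl (shift m' Q) (shift m' B) (z + y)) -
  sqn (ftl (shift m' Q) (shift m' B) z))); rewrite normrN.
by move: h h2 h3; lra.
Qed.

Lemma sum_subset (s s' : seq R) (f : R -> R) : uniq s -> uniq s' ->
  {subset s <= s'} ->
  \sum_(l <- s') f l = \sum_(l <- s) f l + \sum_(l <- s' | l \notin s) f l.
Proof.
move=> us us' ss'; rewrite (bigID (mem s))/=; congr (_ + _).
rewrite -big_filter; apply: perm_big; apply: uniq_perm => //.
  exact: filter_uniq.
by move=> l; rewrite mem_filter; case: (boolP (l \in s)) => // /ss' ->.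
Qed.

Lemma stage_chain : exists ms : nat -> nat * seq R, [/\ forall j, stage (ms j),
  forall i j, (i <= j)%N -> ((ms i).1 <= (ms j).1)%N /\ {subset (ms i).2 <= (ms j).2} &
  forall j, (j <= (ms j).1)%N].
Proof.
pose T := {ms | stage ms}.
have stepT (u : T) : exists v : T, ((sval u).1 < (sval v).1)%N /\
    {subset (sval u).2 <= (sval v).2}.
  case: u => ms sms /=; have [ms' [sms' h1 h2]] := step sms.
  by exists (exist _ ms' sms').
have [f Hf] := choice stepT.
pose u j : T := iter j f (exist _ _ stage0).
have lt j : ((sval (u j)).1 < (sval (u j.+1)).1)%N by have [] := Hf (u j).
have sub j : {subset (sval (u j)).2 <= (sval (u j.+1)).2} by have [] := Hf (u j).
exists (fun j => sval (u j)); split.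
- by move=> j; exact: svalP.
- move=> i j /subnKC <-; elim: (j - i)%N => [|k [IH1 IH2]].
    by rewrite addn0; split.
  rewrite addnS; split; first exact: leq_trans IH1 (ltnW (lt _)).
  by move=> l /IH2/sub.
- by elim=> // j IH; exact: leq_ltn_trans IH (lt j).
Qed.

Section chain.
Variable ms : nat -> nat * seq R.
Hypothesis ms_stage : forall j, stage (ms j).
Hypothesis ms_le : forall i j, (i <= j)%N ->
  ((ms i).1 <= (ms j).1)%N /\ {subset (ms i).2 <= (ms j).2}.
Hypothesis ms_ge : forall j, (j <= (ms j).1)%N.

Let us j : uniq (ms j).2.
Proof. by have [/(spec_uniq QB)] := ms_stage j. Qed.

(** At stage j the sum of the |ft (atoms Q B m_j) (x + l)|^2 is exactly 1. The
    points present at stage i contribute the limiting sum up to eta / 2, and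
    for the others the squared transforms of atoms Q B m_j and of the limit differ
    by a factor at most 2 / eps, so that they contribute at most 2 / eps times
    a Cauchy difference of the limiting sums. *)
Lemma parseval_chain (x eta : R) : 0 < eta ->
  exists j, 1 - eta <= \sum_(l <- (ms j).2) sqn (ftl Q B (x + l)).
Proof.
move=> eta0; pose q j := \sum_(l <- (ms j).2) sqn (ftl Q B (x + l)).
have q_nd : nondecreasing_seq q.
  move=> i j ij; have [_ sij] := ms_le ij.
  by rewrite /q (sum_subset _ (us i) (us j) sij) lerDl sumr_ge0// => l _; exact: sqn_ge0.
have q1 j : q j <= 1.
  have [sj _] := ms_stage j; rewrite -[leRHS](sj x); apply: ler_sum => l _.
  rewrite (ftl_shift (ms j).1 _ QB) sqnM ler_piMr ?sqn_ge0//.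
  exact: (sqn_ftl_le1 (hadamard_shift _ QB)).
have cq : cvgn q.
  by apply: nondecreasing_is_cvgn => //; exists 1 => _ [j _ <-].
have e4 : 0 < eta * eps / 4 by rewrite divr_gt0// mulr_gt0.
have [i Hi] : exists i, forall j, (i <= j)%N -> q j - q i <= eta * eps / 4.
  have /cvgrPdist_le/(_ _ e4)[i _ Hi] := cq.
  exists i => j ij; have := Hi i (leqnn i) => /=.
  have := nondecreasing_cvgn_le q_nd cq j; have := ler_norm (limn q - q i); lra.
have [K HK] : exists K, forall k, (K <= k)%N ->
    \sum_(l <- (ms i).2) sqn (ft (atoms Q B k) (x + l)) <= q i + eta / 2.
  have : \sum_(l <- (ms i).2) sqn (ft (atoms Q B k) (x + l)) @[k --> \oo] --> q i.
    rewrite /q; elim: ((ms i).2) => [|l s IH].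
      by under eq_fun do rewrite big_nil; rewrite big_nil; exact: cvg_cst.
    under eq_fun do rewrite big_cons; rewrite big_cons.
    by apply: cvgD => //; exact: (sqn_ft_ftl_cvg QB).
  move=> /cvgrPdist_le/(_ (eta / 2)); rewrite divr_gt0// => /(_ isT)[K _ HK].
  exists K => k /HK /=; rewrite distrC => /(le_trans (ler_norm _)); lra.
have [M HM] := denom_large `|x|.
exists i; set j := maxn i (maxn K M).
have ij : (i <= j)%N by exact: leq_maxl.
have [_ sij] := ms_le ij; have [sj lowj] := ms_stage j.
have := sj x; rewrite (sum_subset _ (us i) (us j) sij) => E.
have h1 : \sum_(l <- (ms i).2) sqn (ft (atoms Q B (ms j).1) (x + l)) <= q i + eta / 2.
  by apply: HK; rewrite (leq_trans _ (ms_ge j))// /j !leq_max leqnn orbT.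
have h2 : \sum_(l <- (ms j).2 | l \notin (ms i).2) sqn (ft (atoms Q B (ms j).1) (x + l))
    <= 2 / eps * (q j - q i).
  have -> : q j - q i = \sum_(l <- (ms j).2 | l \notin (ms i).2) sqn (ftl Q B (x + l)).
    by rewrite {1}/q (sum_subset _ (us i) (us j) sij) addrC addKr.
  rewrite big_distrr/= big_seq_cond [leRHS]big_seq_cond.
  apply: ler_sum => l /andP[lj _].
  rewrite (ftl_shift (ms j).1 (x + l) QB) sqnM mulrCA ler_peMr ?sqn_ge0//.
  rewrite mulrC mulrA ler_pdivlMr// mul1r mulrC.
  have P0 : 0 < denom Q (ms j).1 :> R by rewrite (denom_gt0 QB).
  have := lowj l lj (x / denom Q (ms j).1); rewrite -mulrDl [l + x]addrC.
  rewrite normrM normfV (gtr0_norm P0) ler_pdivrMr// HM//; last first.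
    by rewrite (leq_trans _ (ms_ge j))// /j !leq_max leqnn !orbT.
  by move=> /(_ isT); lra.
have h3 : 2 / eps * (q j - q i) <= eta / 2.
  rewrite -ler_pdivlMl ?divr_gt0// (le_trans (Hi j ij))//.
  by rewrite le_eqVlt; apply/orP; left; apply/eqP; field; rewrite gt_eqF.
by rewrite -/(q i); lra.
Qed.

End chain.

(** The characters indexed by the union of the stages are orthonormal, and by the
    limiting Parseval identity they approximate all characters, hence all
    trigonometric polynomials, hence all of L2. *)
Theorem spectral_of_lower_mod : spectral_measure nu.
Proof.
have [ms [ms_stage ms_le ms_ge]] := stage_chain.
split; first exact: probability_setT.
pose Lam : set R := [set l | exists j, l \in (ms j).2].
have ort l l' : Lam l -> Lam l' -> l != l' -> charf nu (l - l') = 0.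
  move=> [i li] [j l'j] ll'.
  have [_ /(_ _ li) lk] := ms_le i (maxn i j) (leq_maxl _ _).
  have [_ /(_ _ l'j) l'k] := ms_le j (maxn i j) (leq_maxr _ _).
  have [sk _] := ms_stage (maxn i j).
  rewrite nuQB (ftl_shift (ms (maxn i j)).1 _ QB).
  by rewrite (spec_orthogonal QB sk lk l'k ll') mul0r.
have I2e t : I2 nu (fun x => e (t * x)) = 1%E.
  rewrite /I2; under eq_integral do rewrite sqn_cexp2pi.
  by rewrite integral_cst// mul1e; exact: probability_setT.
have aLam x : tapprox nu Lam (fun t => e (x * t)).
  move=> eta eta0; have eta2 : 0 < eta / 2 by rewrite divr_gt0.
  have [j Hj] := parseval_chain ms_stage ms_le ms_ge (- x) eta2.
  exists [seq (l, charf nu (x - l)) | l <- (ms j).2]; split.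
    by move=> _ /mapP[l lj ->]; exists j.
  rewrite (_ : (fun t => _) =
      trig ((x, 1) :: [seq (l, - charf nu (x - l)) | l <- (ms j).2])); last first.
    apply/funext => t; rewrite /trig big_cons !big_map mul1r; congr (_ + _).
    by rewrite -sumrN; apply: eq_bigr => l _; rewrite mulNr.
  have usj : uniq (ms j).2 by have [/(spec_uniq QB)] := ms_stage j.
  rewrite I2_projection// => [|l l' lj l'j]; last by apply: ort; exists j.
  rewrite lte_fin (eq_bigr (fun l => sqn (ftl Q B (- x + l)))) => [|l _].
    by lra.
  by rewrite -nuQB (_ : - x + l = - (x - l)) ?charfN ?sqnJ// opprB addrC.
exists Lam; split.
- move=> l _; apply: I2_cL2; first exact: cmeas_cexp2pi.
  by rewrite I2e ltry.
- move=> l l' Ll Ll'.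
  have -> : cinner nu (fun x => e (l * x)) (fun x => e (l' * x)) = charf nu (l - l').
    rewrite /cinner /charf; congr cRintegral; apply/funext => x.
    by rewrite -cexp2piN -cexp2piD mulrBl.
  have [->|ll'] := eqVneq l l'; first by rewrite subrr charf0.
  exact: ort.
- move=> f /cL2_I2[mf f2] eta eta0.
  have [ps [Dps fps]] := approx_sub mf aLam (approx_I2 nu_supp mf f2) (exprn_gt0 2 eta0).
  exists (undup [seq p.1 | p <- ps]), (fun l => \sum_(p <- ps | p.1 == l) p.2); split.
    by move=> l; rewrite mem_undup => /mapP[p pps ->]; exact: Dps.
  apply: cLnorm2_lt => //; apply: le_lt_trans fps; rewrite le_eqVlt; apply/orP; left.
  apply/eqP; congr I2; apply/funext => x; congr (_ - _).
  under eq_bigr do rewrite big_distrl/=.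
  rewrite (exchange_big_dep xpredT)//= /trig big_seq [RHS]big_seq.
  apply: eq_bigr => p pps; rewrite big_mkcond.
  rewrite (bigD1_seq p.1) ?undup_uniq ?mem_undup ?map_f//= eqxx big1 ?addr0// => l lp.
  by rewrite eq_sym (negbTE lp).
Qed.

End spectrality.

(** * Partial convolutions and measurable dependence on the word *)

Section integral_convolution.
Context {R : realType}.

Lemma ge0_integral_convolution (mu nu : {finite_measure set R -> \bar R})
    (f : R -> \bar R) : measurable_fun setT f -> (forall x, (0 <= f x)%E) ->
  (\int[convolution mu nu]_x f x = \int[mu]_x \int[nu]_y f (x + y)%R)%E.
Proof.
move=> mf f0.
have madd : measurable_fun setT (fun xy : R * R => xy.1 + xy.2).
  exact: measurable_funD.
have := @ge0_integral_pushforward _ _ _ _ _ _ madd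
  (product_measure1 mu nu) setT f measurableT mf (fun x _ => f0 x).
rewrite preimage_setT => E; rewrite [LHS]E.
have mfa : measurable_fun setT (f \o (fun xy : R * R => xy.1 + xy.2)).
  exact: (measurableT_comp mf madd).
by rewrite fubini_tonelli1// => xy; exact: f0.
Qed.

Lemma ge0_integral_uniform_fset (A : {fset R}) (g : R -> R) :
  measurable_fun setT g -> (forall x, 0 <= g x) ->
  (\int[uniform_fset A]_x (g x)%:E = (avg A g)%:E)%E.
Proof.
move=> mg g0; have mE : measurable_fun setT (EFin \o g) by exact/measurable_EFinP.
have r0 : 0 <= (#|` A|%:R : R)^-1 by rewrite invr_ge0.
have -> : uniform_fset A = mscale (NngNum r0)
    (msum (fun k => [the {measure set R -> \bar R} of \d_(nth 0 A k)]) #|` A|).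
  apply/funext => E; rewrite /uniform_fset /mscale /= /msum.
  by rewrite (big_nth 0) big_mkord.
rewrite ge0_integral_mscale//; last by move=> x _; rewrite lee_fin.
rewrite ge0_integral_measure_sum//; last by move=> x _; rewrite lee_fin.
rewrite /avg EFinM; congr (_ * _)%E.
rewrite [X in _ = X%:E](big_nth 0) big_mkord -sumEFin; apply: eq_bigr => i _.
by rewrite integral_dirac// diracT mul1e.
Qed.

Lemma avg_allpairs (s r : seq R) (g : R -> R) :
  avg [seq x + y | x <- s, y <- r] g = avg s (fun x => avg r (fun y => g (x + y))).
Proof.
rewrite /avg size_allpairs natrM invfM big_allpairs_dep -mulrA; congr (_ * _).
by rewrite mulr_sumr.
Qed.

Variables (N : nat -> nat) (B : nat -> {fset int}) (n : nat -> nat).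
Hypothesis N0 : forall i, (0 < N i)%N.

Definition wpow (w : nat -> nat) i := (N (w i) ^ n i)%N.
Definition wdig (w : nat -> nat) i := B (w i).

Lemma avg_digit_set (w : words R) k (g : R -> R) :
  avg (digit_set N B n w k) g =
  avg [seq b / denom (wpow w) k.+1 | b <- digits (wdig w k)] g.
Proof.
have pE : \prod_(i < k.+1) ((N (w i))%:R : R) ^- n i = (denom (wpow w) k.+1)^-1.
  by rewrite /denom -prodfV; apply: eq_bigr => i _; rewrite natrX.
have p0 : (denom (wpow w) k.+1 : R) != 0.
  rewrite /denom prodf_seq_neq0; apply/allP => i _ /=.
  by rewrite pnatr_eq0 -lt0n expn_gt0 N0.
have inj : injective (fun b : int => \prod_(i < k.+1) ((N (w i))%:R : R) ^- n i * b%:~R).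
  by move=> b b'; rewrite pE => /(mulfI (invr_neq0 p0))/intr_inj.
rewrite /avg /digit_set size_map size_digits card_imfset//=; congr (_ * _).
rewrite big_imfset/=; last by move=> b b' _ _; exact: inj.
by rewrite !big_map; apply: eq_bigr => b _; rewrite pE mulrC.
Qed.

Lemma ge0_integral_partial_convolution (w : words R) k (g : R -> R) :
  measurable_fun setT g -> (forall x, 0 <= g x) ->
  (\int[partial_convolution N B n w k]_x (g x)%:E =
    (avg (atoms (wpow w) (wdig w) k) g)%:E)%E.
Proof.
elim: k g => [|k IH] g mg g0.
  rewrite /= integral_dirac//; last exact/measurable_EFinP.
  by rewrite diracT mul1e /avg big_seq1 invr1 mul1r.
rewrite [LHS]ge0_integral_convolution//; last exact/measurable_EFinP.
have mgx (x : R) : measurable_fun setT (fun y : R => g (x + y)).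
  by apply: measurableT_comp => //; exact: measurable_funD.
under eq_integral do rewrite (ge0_integral_uniform_fset _ (mgx _))//.
rewrite IH; first by congr (_%:E); rewrite /= avg_allpairs; congr avg;
    apply/funext => x; exact: avg_digit_set.
- apply: measurable_funM => //; apply: measurable_sum => a.
  by apply: measurableT_comp => //; exact: measurable_funD.
- by move=> x; rewrite mulr_ge0 ?invr_ge0// sumr_ge0.
Qed.

Lemma Rintegral_partial_convolution (w : words R) k (g : R -> R) (C : R) :
  measurable_fun setT g -> (forall x, `|g x| <= C) -> (0 < size (atoms (R := R) (wpow w) (wdig w) k))%N ->
  \int[partial_convolution N B n w k]_x g x = avg (atoms (wpow w) (wdig w) k) g.
Proof.
move=> mg gC s0.
have intb (h : R -> R) : measurable_fun setT h -> (exists D : R, forall x, `|h x| <= D) ->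
    (partial_convolution N B n w k).-integrable setT (EFin \o h).
  move=> mh [D hD]; apply: measurable_bounded_integrable => //.
    by rewrite ltey_eq fin_num_measure.
  exists D; split; first exact: num_real.
  by move=> M DM x _; exact: le_trans (hD x) (ltW DM).
have gC0 x : 0 <= g x + C by have := gC x; rewrite ler_norml; lra.
have mgC : measurable_fun setT (fun x => g x + C) by exact: measurable_funD.
have E1 : \int[partial_convolution N B n w k]_x (g x + C) =
    avg (atoms (wpow w) (wdig w) k) (fun x => g x + C).
  by rewrite /Rintegral ge0_integral_partial_convolution.
have E2 : \int[partial_convolution N B n w k]_x C = C.
  have C0 : 0 <= C by apply: le_trans (gC 0).
  rewrite /Rintegral (@ge0_integral_partial_convolution w k (fun=> C))//=.
  exact: avg_cst.
have : \int[partial_convolution N B n w k]_x (g x + C) =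
    \int[partial_convolution N B n w k]_x g x + C.
  rewrite RintegralD//; first by rewrite E2.
    by apply: intb => //; exists C.
  by apply: intb => //; exists `|C|.
rewrite E1 => /esym/(canRL (addrK C)) ->.
by rewrite -[X in _ - X](avg_cst C s0) avgB; congr avg; apply/funext => x; rewrite addrK.
Qed.

End integral_convolution.

Section words_measurable.
Context {R : realType}.

Definition prefix_dep k (S : set (words R)) :=
  forall w w', (forall i, (i < k)%N -> w i = w' i) -> S w -> S w'.

Lemma words_dist_lt (w w' : words R) k : words_dist w w' < (2 ^- k : R) ->
  forall i, (i < k)%N -> w i = w' i.
Proof.
rewrite /words_dist; case: pselect => [ex|nex] h i ik; last first.
  by apply/eqP/negPn/negP => ne; apply: nex; exists i.
move: h; case: ex_minnP => p _ pmin.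
rewrite ltf_pV2 ?posrE ?exprn_gt0// ltr_eXn2l ?ltr1n// => kp.
apply/eqP/negPn/negP => /pmin; rewrite leqNgt => /negP; apply.
exact: ltn_trans kp.
Qed.

Lemma prefix_dep_measurable k (S : set (borel_words R)) :
  prefix_dep k S -> measurable S.
Proof.
move=> Sk; apply: sub_sigma_algebra; rewrite /= openE => w Sw.
apply/nbhs_ballP; exists (2 ^- k) => /=; first by rewrite invr_gt0 exprn_gt0.
move=> w'; rewrite ballEmdist /= => /words_dist_lt H.
by apply: Sk Sw => i /H.
Qed.

Lemma prefix_dep_measurable_fun d (T : measurableType d) k (F : words R -> T) :
  (forall w w', (forall i, (i < k)%N -> w i = w' i) -> F w = F w') ->
  measurable_fun [set: borel_words R] F.
Proof.
move=> Fk _ Y mY; rewrite setTI; apply: (@prefix_dep_measurable k).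
by move=> w w' ww' /=; rewrite (Fk _ _ ww').
Qed.

Lemma eq_atoms (Q Q' : nat -> nat) (B B' : nat -> {fset int}) k :
  (forall i, (i < k)%N -> Q i = Q' i) -> (forall i, (i < k)%N -> B i = B' i) ->
  atoms Q B k = atoms Q' B' k :> seq R.
Proof.
elim: k => //= k IH QQ BB; rewrite IH => [|i ik|i ik]; last 2 first.
- by apply: QQ; rewrite ltnW.
- by apply: BB; rewrite ltnW.
congr allpairs; rewrite BB//; congr map; apply/funext => b; congr (_ / _).
by apply: eq_bigr => i _; rewrite QQ.
Qed.

(** The integral of a continuous function against the limit is a pointwise
    limit of functions of finitely many letters, an indicator of a ray is a
    limit of continuous functions, and rays generate the Borel sets. *)
Lemma measurable_weak_limit (M : words R -> probability R R)
    (s : nat -> words R -> seq R) :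
  (forall k w w', (forall i, (i < k)%N -> w i = w' i) -> s k w = s k w') ->
  (forall w (g : R -> R), continuous g -> bounded_fun g ->
     avg (s k w) g @[k --> \oo] --> \int[M w]_x g x) ->
  forall A, measurable A -> measurable_fun [set: borel_words R] (fun w => M w A).
Proof.
move=> sk Ms.
have mcont (g : R -> R) (C : R) : continuous g -> (forall x, `|g x| <= C) ->
    measurable_fun [set: borel_words R] (fun w => \int[M w]_x g x).
  move=> cg gC.
  apply: (@measurable_fun_cvg _ _ _ _ (fun k (w : borel_words R) => avg (s k w) g)).
    by move=> k; apply: (@prefix_dep_measurable_fun _ _ k) => w w' /sk ->.
  by move=> w _; apply: Ms => //; exact: bounded_fun_le gC.
have mray (a : R) : measurable_fun [set: borel_words R] (fun w => M w `]-oo, a[%classic).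
  pose g (j : nat) (x : R) : R := Num.min 1 (Num.max 0 (j%:R * (a - x))).
  have g0 j x : 0 <= g j x by rewrite /g le_min ler01 le_max lexx.
  have g1 j x : g j x <= 1 by rewrite /g ge_min lexx.
  have gb j x : `|g j x| <= 1 by rewrite ger0_norm.
  have cg j : continuous (g j).
    move=> x; apply: (@continuous_min R R (cst 1) (fun x => Num.max 0 (j%:R * (a - x)))).
      exact: cst_continuous.
    apply: (@continuous_max R R (cst 0) (fun x => j%:R * (a - x))).
      exact: cst_continuous.
    apply: cvgM; first exact: cvg_cst.
    by apply: cvgB; [exact: cvg_cst|exact: cvg_id].
  have gl x : g j x @[j --> \oo] --> (\1_(`]-oo, a[%classic : set R) x : R).
    rewrite indicE mem_setE in_itv/=; have [xa|ax] := ltP x a.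
      apply: cvg_near_cst; exists (Num.truncn (a - x)^-1).+1 => // j /= jx.
      rewrite /g max_r; last by rewrite mulr_ge0// subr_ge0 ltW.
      rewrite min_l// -ler_pdivrMr ?subr_gt0// mul1r.
      by rewrite (le_trans (ltW (truncnS_gt _)))// ler_nat.
    apply: cvg_near_cst; apply: nearW => j; rewrite /g max_l ?min_r//.
    by rewrite mulr_ge0_le0// subr_le0.
  have mind : measurable (`]-oo, a[%classic : set R) by exact: measurable_itv.
  have E (w : words R) : \int[M w]_x g j x @[j --> \oo] --> fine (M w `]-oo, a[%classic).
    have [_ +] := @bounded_cvg_Rintegral _ _ _ (M w) g _ 1
      (fun j => continuous_measurable_fun (cg j)) gb gl.
    by rewrite {2}/Rintegral integral_indic// setIT.
  rewrite (_ : (fun w => _) = fun w => (fine (M w `]-oo, a[%classic))%:E); last first.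
    by apply/funext => w; rewrite fineK// fin_num_measure.
  apply/measurable_EFinP.
  apply: (@measurable_fun_cvg _ _ _ _ (fun j (w : borel_words R) => \int[M w]_x g j x)).
    by move=> j; exact: mcont (cg j) (gb j).
  by move=> w _; exact: E.
have GE : @measurable _ R = <<s @RGenInftyO.G R >> by exact: RGenInftyO.measurableE.
move=> A; rewrite GE; move: A.
apply: (@dynkin_induction _ _ _ (fun A => measurable_fun [set: borel_words R] (fun w => M w A)) GE).
- move=> _ _ [a ->] [b ->]; exists (Num.min a b).
  by apply/seteqP; split => x /=; rewrite !in_itv/= lt_min => /andP.
- rewrite (_ : (fun w => _) = cst 1%E); first exact: measurable_cst.
  by apply/funext => w; exact: probability_setT.
- by move=> _ [a ->]; exact: mray.
- move=> S mS MS; rewrite (_ : (fun w => _) = fun w => (1 - M w S)%E).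
    by apply: emeasurable_funB => //; exact: measurable_cst.
  by apply/funext => w; rewrite probability_setC.
- move=> F mF tF MF.
  rewrite (_ : (fun w => _) = fun w => (\sum_(0 <= k <oo) M w (F k))%E).
    by apply: ge0_emeasurable_sum => // k w _ _; exact: measure_ge0.
  apply/funext => w; apply/esym/cvg_lim => //.
  by apply: measure_semi_sigma_additive => //; exact: bigcup_measurable.
Qed.

End words_measurable.

(** * Words under a Bernoulli measure *)

Section bernoulli.
Context {R : realType} (p : nat -> R) (P : probability (borel_words R) R).
Hypothesis p_ge0 : forall j, 0 <= p j.
Hypothesis Pp : bernoulli_measure p P.

Definition occurs (u : seq nat) k : set (borel_words R) :=
  [set w | forall i, (i < size u)%N -> w (k + i)%N = nth 0%N u i].

Lemma occurs_prefix u k : @prefix_dep R (k + size u) (occurs u k).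
Proof. by move=> w w' ww' wu i iu; rewrite -ww' ?wu// ltn_add2l. Qed.

Lemma prefix_depS k k' (S : set (words R)) : (k <= k')%N ->
  prefix_dep k S -> prefix_dep k' S.
Proof.
by move=> kk' Sk w w' ww'; apply: Sk => i ik; apply: ww'; exact: leq_trans kk'.
Qed.

Let dec (m : nat) : seq nat := odflt [::] (choice.unpickle m : option (seq nat)).

(** An event depending on the first k letters is a countable disjoint union of
    cylinders of length k. *)
Lemma bernoulli_indep k (S : set (borel_words R)) (u : seq nat) : @prefix_dep R k S ->
  P (S `&` occurs u k) = ((\prod_(j <- u) p j)%:E * P S)%E.
Proof.
move=> Sk.
pose D := [set m | [/\ choice.pickle (dec m) = m, size (dec m) = k & S (nth 0%N (dec m))]].
have cylm (s : seq nat) : measurable (@cylinder R s).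
  by apply: (@prefix_dep_measurable _ (size s)) => w w' ww' ws i ik; rewrite -ww'// ws.
have decS (w : borel_words R) : S w -> exists2 m, D m & dec m = mkseq w k.
  move=> Sw; exists (choice.pickle (mkseq w k)); last by rewrite /dec choice.pickleK.
  rewrite /D /= /dec choice.pickleK /= size_mkseq; split => //.
  by apply: Sk Sw => i ik; rewrite nth_mkseq.
have SE : S = \bigcup_(m in D) @cylinder R (dec m).
  apply/seteqP; split => w.
    move=> /decS[m Dm mE]; exists m => //; rewrite mE => i.
    by rewrite size_mkseq => ik; rewrite nth_mkseq.
  move=> [m [_ sm Sm] wm]; apply: Sk Sm => i ik.
  by rewrite wm// sm.
have SuE : S `&` occurs u k = \bigcup_(m in D) @cylinder R (dec m ++ u).
  apply/seteqP; split => w.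
    move=> [/decS[m Dm mE] wu]; exists m => //; rewrite mE => i.
    rewrite size_cat size_mkseq nth_cat size_mkseq => iku.
    case: ltnP => ik; first by rewrite nth_mkseq.
    by rewrite -{1}(subnKC ik) wu// ltn_subLR.
  move=> [m [_ sm Sm] wm]; split.
    apply: Sk Sm => i ik.
    by rewrite wm ?size_cat ?sm ?ltn_addr// nth_cat sm ik.
  move=> i iu; rewrite wm ?size_cat ?sm ?ltn_add2l//.
  by rewrite nth_cat sm ltnNge leq_addr/= addKn.
have triv (v : seq nat) : trivIset D (fun m => @cylinder R (dec m ++ v)).
  move=> m m' [pm sm _] [pm' sm' _] [w [wm wm']].
  rewrite -pm -pm'; congr choice.pickle; apply: (@eq_from_nth _ 0%N); rewrite ?sm'// => i.
  rewrite sm => ik; have := wm i; rewrite size_cat sm ltn_addr// nth_cat sm ik => <-//.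
  by have := wm' i; rewrite size_cat sm' ltn_addr// nth_cat sm' ik => <-.
have triv0 : trivIset D (fun m => @cylinder R (dec m)).
  by have := triv [::]; under eq_fun do rewrite cats0.
rewrite SuE [in RHS]SE !measure_bigcup//.
rewrite -nneseriesZl => [|m _]; last exact: measure_ge0.
apply: eq_eseriesr => m _.
by rewrite [LHS]Pp [X in (_ * X)%E]Pp big_cat/= mulrC EFinM.
Qed.

Lemma negligible_null_letter k : P.-negligible [set w | p (w k) = 0].
Proof.
apply: (@negligibleS _ _ _ _ (\bigcup_j [set w : borel_words R | w k = j /\ p j = 0])).
  by move=> w /= pw; exists (w k).
apply: negligible_bigcup => j; have [pj|pj] := eqVneq (p j) 0; last first.
  apply: negligibleS (negligible_set0 _) => w /= [_ pj0].
  by move: pj; rewrite pj0 eqxx.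
have mj : measurable (occurs [:: j] k : set (borel_words R)).
  exact: (prefix_dep_measurable (@occurs_prefix _ _)).
apply: (@negligibleS _ _ _ _ (occurs [:: j] k)).
  by move=> w /= [wk _] [|//] _; rewrite addn0.
have E := @bernoulli_indep k setT [:: j] (fun _ _ _ _ => I).
rewrite setTI big_seq1 pj mul0e in E.
exact/negligibleP.
Qed.

(** The occurrences of u at the positions i #u, i >= M, are independent of
    positive probability, so almost surely one of them happens. *)
Lemma negligible_never (u : seq nat) M : (forall j, j \in u -> p j != 0) ->
  P.-negligible [set w | forall i, (M <= i)%N -> ~ occurs u (i * size u) w].
Proof.
move=> pu; pose pi_u := \prod_(j <- u) p j.
have pu0 : 0 < pi_u.
  by rewrite /pi_u big_seq prodr_gt0// => j /pu; rewrite lt0r p_ge0 andbT.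
pose E q : set (borel_words R) := [set w | forall i, (M <= i < M + q)%N ->
  ~ occurs u (i * size u) w].
have Edep q : @prefix_dep R ((M + q) * size u) (E q).
  move=> w w' ww' wE i iq wi; apply: (wE i iq).
  apply: (@prefix_depS _ ((M + q) * size u) _ _ (@occurs_prefix u (i * size u)) w' w _ wi).
    by rewrite addnC -mulSn leq_mul//; case/andP: iq.
  by move=> k /ww'.
have mE q : measurable (E q).
  by apply: (@prefix_dep_measurable R ((M + q) * size u)); exact: Edep.
have mO k : measurable (occurs u k) by exact: (prefix_dep_measurable (@occurs_prefix _ _)).
have PE q : P (E q) = ((1 - pi_u) ^+ q)%:E.
  elim: q => [|q IH].
    rewrite (_ : E 0%N = setT); first by rewrite expr0; exact: probability_setT.
    apply/seteqP; split => // w _ i; rewrite addn0 => /andP[Mi].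
    by rewrite ltnNge Mi.
  have -> : E q.+1 = E q `\` occurs u ((M + q) * size u).
    apply/seteqP; split => w.
      move=> wE; split.
        by move=> i /andP[Mi iq]; apply: wE; rewrite Mi addnS ltnS ltnW.
      by apply: wE; rewrite leq_addr addnS ltnS /=.
    move=> [wE wq] i; rewrite addnS ltnS [(i <= _)%N]leq_eqVlt => /andP[Mi /orP[/eqP->//|iq]].
    by apply: wE; rewrite Mi.
  have : P (E q) = (P (E q `\` occurs u ((M + q) * size u)) +
      P (E q `&` occurs u ((M + q) * size u)))%E by exact: measureDI.
  rewrite (bernoulli_indep u (@Edep q)) IH -EFinM => /esym.
  have : P (E q `\` occurs u ((M + q) * size u)) \is a fin_num.
    by rewrite fin_num_measure//; exact: measurableD.
  case: (P _) => // r _; rewrite -EFinD => -[h]; congr (_%:E).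
  by rewrite exprS -/pi_u in h *; lra.
pose N0 : set (borel_words R) := \bigcap_q E q.
have mN : measurable N0 by apply: bigcapT_measurable => q.
exists N0; split => //; last first.
  by move=> w /= H q _ i /andP[Mi _]; exact: H.
have pu1 : pi_u <= 1.
  have : (0 <= P (E 1%N))%E by exact: measure_ge0.
  by rewrite PE lee_fin expr1 subr_ge0.
have PN q : (P N0 <= ((1 - pi_u) ^+ q)%:E)%E.
  rewrite -PE; apply: le_measure; rewrite ?inE//.
  by move=> w; apply.
have : P N0 \is a fin_num by rewrite fin_num_measure.
have : (0 <= P N0)%E by exact: measure_ge0.
case: (P N0) PN => // a aq; rewrite lee_fin => a0 _.
congr (_%:E); apply/eqP; rewrite eq_le a0 andbT leNgt; apply/negP => a_gt0.
have : (1 - pi_u) ^+ q @[q --> \oo] --> (0 : R).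
  by apply: cvg_expr; rewrite ger0_norm; lra.
move=> /cvgrPdist_lt/(_ _ a_gt0)[q _ /(_ q (leqnn q))] /=.
rewrite sub0r normrN ltNge => /negP; apply.
by rewrite (le_trans _ (ler_norm _))// -lee_fin.
Qed.

Lemma ae_words (u : seq nat) : (forall j, j \in u -> p j != 0) ->
  {ae P, forall w, (forall k, p (w k) != 0) /\
    (forall M, exists2 m, (M <= m)%N & occurs u m w)}.
Proof.
move=> pu; apply: (@negligibleS _ _ _ _
  ((\bigcup_k [set w : borel_words R | p (w k) = 0]) `|`
   (\bigcup_M [set w : borel_words R | forall i, (M <= i)%N -> ~ occurs u (i * size u) w]))).
  move=> w /= H; apply: contrapT => /not_orP[H1 H2]; apply: H; split.
    by move=> k; apply/eqP => pk; apply: H1; exists k.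
  move=> M; apply: contrapT => HM; apply: H2; exists M => // i Mi ui; apply: HM.
  have [u0|u0] := posnP (size u); first by exists M => // j; rewrite u0.
  by exists (i * size u)%N => //; rewrite (leq_trans Mi)// leq_pmulr.
apply: negligibleU; apply: negligible_bigcup => k.
  exact: negligible_null_letter.
exact: negligible_never.
Qed.

End bernoulli.

(** * Greatest common divisors and concentrated measures *)

(** The least positive integral combination d of elements of G; the remainder of
    b modulo d is a smaller one. *)
Lemma gcd_comb (G : set int) (b0 : int) : G b0 -> 0 < b0 ->
  exists d (cs : seq (int * int)), [/\ 0 < d, forall c, c \in cs -> G c.2,
    \sum_(c <- cs) c.1 * c.2 = d & forall b, G b -> (d %| b)%Z].
Proof.
move=> Gb0 b00.
pose comb (z : int) := exists cs : seq (int * int),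
  (forall c, c \in cs -> G c.2) /\ \sum_(c <- cs) c.1 * c.2 = z.
have ex : exists k, `[< (0 < k)%N /\ comb k%:Z >].
  exists `|b0|%N; apply/asboolP; split; first by lia.
  exists [:: (1, b0)]; split; first by move=> c; rewrite inE => /eqP ->.
  by rewrite big_seq1 /= mul1r gez0_abs// ltW.
case: (ex_minnP ex) => d /asboolP[d0 [cs [Gcs csd]]] dmin.
exists d%:Z, cs; split => // b Gb; apply/dvdz_mod0P.
have r0 : 0 <= (b %% d)%Z by rewrite modz_ge0//; lia.
have rd : (b %% d)%Z < d by rewrite ltz_pmod//; lia.
apply/eqP; apply: contraT => rn0.
have /dmin : `[< (0 < `|(b %% d)%Z|)%N /\ comb `|(b %% d)%Z|%N%:Z >].
  apply/asboolP; split; first by lia.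
  exists ((1, b) :: [seq (- (b %/ d)%Z * c.1, c.2) | c <- cs]); split.
    by move=> c; rewrite inE => /predU1P[->//|/mapP[c' /Gcs Gc ->]].
  rewrite big_cons big_map /= gez0_abs// mul1r.
  under eq_bigr do rewrite -mulrA.
  by rewrite -big_distrr/= csd /modz mulNr.
by lia.
Qed.

(** If the first contraction ratio is tiny, the whole measure is concentrated
    near 0 and its transform is bounded below on [0, 1[. *)
Lemma lower_mod_large (R : realType) (C : R) Q B (K : nat) : hadamard C Q B ->
  32 * pi * C <= 2 ^+ K -> (forall b, b \in B 0%N -> b%:~R * 2 ^+ K <= C * (Q 0%N)%:R) ->
  2 ^+ K <= (Q 0%N)%:R :> R -> lower_mod 1 (4^-1 : R) Q B.
Proof.
move=> QB KC KB KQ x; have C0 := hadamard_C QB; have pi0 := pi_gt0 R.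
have K0 : 0 < 2 ^+ K :> R by rewrite exprn_gt0.
have Q0 : 0 < (Q 0%N)%:R :> R by exact: lt_le_trans KQ.
exists (- Num.floor x); rewrite intrN divr1; set y := x - _.
have [y0 y1] : 0 <= y /\ y < 1.
  have := Num.Theory.floor_itv x => /andP[h1 h2].
  by rewrite subr_ge0 h1 ltrBlDl -[X in _ + X]/(1%:~R) -intrD.
have denom1 : denom Q 1 = (Q 0%N)%:R :> R by rewrite denomS denom0 mul1r.
rewrite (ftl_shift 1 y QB) sqnM denom1.
have QB1 := hadamard_shift 1 QB.
pose c := C / 2 ^+ K.
have c0 : 0 <= c by rewrite divr_ge0// ltW.
have cK : 32 * pi * c <= 1 by rewrite /c mulrA ler_pdivrMr// mul1r.
have ptsc t : t \in atoms Q B 1 -> 0 <= t <= c.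
  move=> /mem_atomsS[z [b [+ bB ->]]]; rewrite inE => /eqP ->; rewrite add0r denom1.
  have [_ _ /(_ _ bB)[b0 _]] := QB 0%N.
  rewrite divr_ge0 ?ler0z ?(ltW Q0)//= ler_pdivrMr// /c mulrAC ler_pdivlMr//.
  exact: KB.
have pc1 : 2 * pi * c * `|y - 0| <= 16^-1.
  rewrite subr0 ger0_norm//.
  apply: (@le_trans _ _ (2 * pi * c * 1)); first by rewrite ler_wpM2l ?(ltW y1)// !mulr_ge0// ltW.
  by rewrite mulr1; move: pi cK => q cK; lra.
have h1 : 2^-1 <= sqn (ft (atoms Q B 1) y).
  have : `|sqn (ft (atoms Q B 1) y) - sqn (ft (atoms Q B 1) 0)| <= 4 * 16^-1.
    apply: sqn_lip; rewrite ?Re_ft_le1 ?Im_ft_le1//.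
      exact: le_trans (Re_ft_lip ptsc c0 y 0) pc1.
    exact: le_trans (Im_ft_lip ptsc c0 y 0) pc1.
  rewrite (ft_atoms0 QB) sqn1 => h.
  by have := ler_norm (- (sqn (ft (atoms Q B 1) y) - 1)); rewrite normrN; lra.
have h2 : 2^-1 <= sqn (ftl (shift 1 Q) (shift 1 B) (y / (Q 0%N)%:R)).
  have := sqn_ftl_lip QB1 (y / (Q 0%N)%:R) 0; rewrite (ftl0 QB1) sqn1 subr0 => h.
  have h3 : 16 * pi * C * `|y / (Q 0%N)%:R| <= 2^-1.
    rewrite ger0_norm ?divr_ge0 ?(ltW Q0)// mulrA ler_pdivrMr//.
    apply: (@le_trans _ _ (2^-1 * 2 ^+ K)); last by rewrite ler_pM2l ?invr_gt0.
    apply: (@le_trans _ _ (16 * pi * C * 1)).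
      by rewrite ler_wpM2l ?(ltW y1)// !mulr_ge0// ltW.
    by rewrite mulr1; move: pi (2 ^+ K) KC => q Z KC; lra.
  have := ler_norm (- (sqn (ftl (shift 1 Q) (shift 1 B) (y / (Q 0%N)%:R)) - 1)).
  by rewrite normrN; lra.
by rewrite (_ : 4^-1 = 2^-1 * 2^-1) ?ler_pM//; lra.
Qed.

(** * Infinite convolutions along a word *)

Section random_convolution.
Context {R : realType}.
Variables (N : nat -> nat) (B : nat -> {fset int}) (n : nat -> nat) (C : R).
Hypothesis N2 : forall j, (2 <= N j)%N.
Hypothesis NB : forall w, hadamard C (wpow N n w) (wdig B w).

Let weak_cvg_atoms (w : words R) (nu : probability R R) :
  weak_cvg (partial_convolution N B n w) nu <->
  forall g : R -> R, continuous g -> bounded_fun g ->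
    avg (atoms (wpow N n w) (wdig B w) k) g @[k --> \oo] --> \int[nu]_x g x.
Proof.
have E (g : R -> R) : continuous g -> bounded_fun g ->
    (fun k => \int[partial_convolution N B n w k]_x g x) =
    (fun k => avg (atoms (wpow N n w) (wdig B w) k) g).
  move=> cg [D [_ gD]]; apply/funext => k.
  have N0 i : (0 < N i)%N by exact: ltnW.
  apply: (@Rintegral_partial_convolution _ _ _ _ N0 w k g (D + 1)).
  - exact: continuous_measurable_fun.
  - by move=> x; apply: gD => //; rewrite ltrDl.
  - exact: (size_atoms_gt0 (NB w)).
by split=> H g cg bg; have := H g cg bg; rewrite E.
Qed.

Lemma infinite_convolution_existsT (w : words R) : infinite_convolution_exists N B n w.
Proof. by have [nu /weak_cvg_atoms] := weak_limit_exists (NB w); exists nu. Qed.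

Lemma infinite_convolution_cvg (w : words R) (g : R -> R) :
  continuous g -> bounded_fun g ->
  avg (atoms (wpow N n w) (wdig B w) k) g @[k --> \oo] -->
    \int[infinite_convolution N B n w]_x g x.
Proof.
move: g; apply/weak_cvg_atoms.
exact: (getPex (infinite_convolution_existsT w)).
Qed.

Lemma random_measure_infinite_convolution :
  random_measure (fun w : borel_words R => infinite_convolution N B n w).
Proof.
move=> A mA.
apply: (@measurable_weak_limit R (fun w => infinite_convolution N B n w)
  (fun k w => atoms (wpow N n w) (wdig B w) k)) mA => [k w w' ww'|w g].
  by apply: eq_atoms => i ik; rewrite /wpow /wdig ww'.
exact: infinite_convolution_cvg.
Qed.

Lemma spectral_infinite_convolution (w : words R) (d : int) (eps : R) : d != 0 ->
  (forall i b, b \in B (w i) -> (d %| b)%Z) -> 0 < eps ->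
  (forall M, exists2 m, (M <= m)%N &
    lower_mod d eps (shift m (wpow N n w)) (shift m (wdig B w))) ->
  spectral_measure (infinite_convolution N B n w).
Proof.
move=> d0 dB eps0 low; have nuP := @infinite_convolution_cvg w.
exact: (spectral_of_lower_mod (NB w) (charf_ftl nuP) (weak_limit_support nuP (NB w))
  d0 dB eps0 low).
Qed.

Hypothesis BN : forall j b, b \in B j -> b%:~R <= C * (N j)%:R.

(** At infinitely many positions m, the digits of the m-th factor are tiny
    compared to N ^ n m, so the remaining convolution is concentrated near 0. *)
Lemma spectral_unbounded : ~ (exists D, forall k, (n k <= D)%N) ->
  forall w : words R, spectral_measure (infinite_convolution N B n w).
Proof.
move=> n_unb w; have C0 := hadamard_C (NB w).
pose K := (Num.truncn (32 * pi * C)).+1.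
have KC : 32 * pi * C <= 2 ^+ K.
  rewrite (le_trans (ltW (truncnS_gt _)))//.
  by rewrite -natrX ler_nat ltnW// ltn_expl.
apply: (@spectral_infinite_convolution w 1 4^-1) => [//|i b _||]; rewrite ?dvd1z ?invr_gt0//.
move=> M; have [m Mm nm] : exists2 m, (M <= m)%N & (K < n m)%N.
  apply: contrapT => H; apply: n_unb; exists (maxn K (\max_(k < M) n k)) => k.
  rewrite leq_max; have [Mk|kM] := leqP M k.
    by apply/orP; left; rewrite leqNgt; apply/negP => nk; apply: H; exists k.
  by rewrite orbC (leq_bigmax (Ordinal kM)).
exists m => //; apply: (@lower_mod_large _ C _ _ K) => //; first exact: hadamard_shift.
  rewrite /shift addn0 /wdig /wpow => b bB.
  rewrite -(prednK (leq_trans (ltn0Sn _) nm)) expnS natrM mulrA.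
  apply: ler_pM; rewrite ?exprn_ge0 ?BN//.
    by have [_ _ /(_ b bB)[]] := NB w m; rewrite ler0z.
  rewrite -natrX ler_nat; apply: (@leq_trans (2 ^ (n m).-1)); last by rewrite leq_exp2r ?N2 //; lia.
  by rewrite leq_exp2l//; lia.
rewrite /shift addn0 /wpow -natrX ler_nat.
apply: (@leq_trans (2 ^ n m)); first by rewrite leq_exp2l// ltnW.
by rewrite leq_exp2r ?N2//; lia.
Qed.

(** Let d be the gcd of the digits of the letters of positive probability.
    Almost surely, some word whose letters carry digits combining to d is
    repeated T + 1 times in a row, at arbitrarily large positions. *)
Lemma ae_spectral_bounded (D : nat) (p : nat -> R) (P : probability (borel_words R) R) :
  (forall k, (n k <= D)%N) -> probability_vector p -> bernoulli_measure p P ->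
  {ae P, forall w, spectral_measure (infinite_convolution N B n w)}.
Proof.
move=> nD [p0 p1] Pp.
have [j pj] : exists j, p j != 0.
  apply: contrapT => H; move: p1; rewrite eseries0 => [|i _ _].
    by move=> /esym/eqP; rewrite onee_eq0.
  by congr (_%:E); apply/eqP/negPn/negP => pi0; apply: H; exists i.
have [b0 b0B b00] : exists2 b, b \in B j & 0 < b.
  apply: contrapT => H; have := hadamard_B (NB (fun=> j)) 0; rewrite /wdig.
  have /fsubset_leq_card : (B j `<=` [fset 0])%fset.
    apply/fsubsetP => b bB; rewrite inE; apply/negPn/negP => bn0; apply: H; exists b => //.
    by have [_ _ /(_ b bB)[]] := NB (fun=> j) 0; rewrite lt0r bn0.
  by rewrite cardfs1 => h1 /leq_trans/(_ h1).
have [d [cs [d0 Gcs csd dG]]] := @gcd_comb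
  [set b | exists2 j, p j != 0 & b \in B j] b0 (ex_intro2 _ _ j pj b0B) b00.
have [f Hf] : exists f, forall c, c \in cs -> p (f c) != 0 /\ c.2 \in B (f c).
  have /boolp.choice[f Hf] : forall c, exists j, c \in cs -> p j != 0 /\ c.2 \in B j.
    move=> c; have [ccs|_] := boolP (c \in cs); last by exists 0%N.
    by have [i pi0 cB] := Gcs c ccs; exists i.
  by exists f.
pose r := size cs; pose jl := [seq f c | c <- cs].
have r0 : (0 < r)%N.
  rewrite lt0n; apply/eqP => /size0nil cs0.
  by move: d0; rewrite -csd cs0 big_nil.
have sjl : size jl = r by rewrite size_map.
have [T [eps [eps0 low]]] := lower_mod_blocks C d0 r
  (\prod_(i < r) N (nth 0 jl i) ^ D) (\prod_(i < r) #|` B (nth 0%N jl i)|) csd.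
pose u := mkseq (fun x => nth 0 jl (x %% r)) (T.+1 * r).
have pu i : i \in u -> p i != 0.
  move=> /mapP[x _ ->]; have : nth 0 jl (x %% r) \in jl by rewrite mem_nth// sjl ltn_mod.
  by move=> /mapP[c ccs ->]; have [] := Hf c ccs.
apply: negligibleS (ae_words p0 Pp pu) => w; apply: contra_not => -[wp wu].
apply: (@spectral_infinite_convolution w d eps) => //; first by rewrite gt_eqF.
  by move=> i b bB; apply: dG; exists (w i).
move=> M; have [m Mm um] := wu M; exists m => //; apply: low => t tT.
have wE i : (i < r)%N -> w (m + (t * r + i))%N = nth 0%N jl i.
  move=> ir; have tri : (t * r + i < T.+1 * r)%N.
    by rewrite (@leq_trans (t.+1 * r))// ?leq_mul// mulSn addnC ltn_add2r.
  by rewrite um ?size_mkseq// nth_mkseq// modnMDl modn_small.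
split.
- by apply: hadamard_shift; apply: hadamard_shift.
- by move=> i b bB; apply: dG; exists (w (m + (t * r + i)))%N.
- apply: leq_prod => i _; rewrite /shift /wpow wE//.
  by rewrite leq_pexp2l// ltnW.
- by apply: leq_prod => i _; rewrite /shift /wdig wE.
- move=> c ccs; have ir : (index c cs < r)%N by rewrite index_mem.
  exists (index c cs) => //; rewrite /shift /wdig wE// (nth_map c)// nth_index//.
  by have [] := Hf c ccs.
Qed.

End random_convolution.

Theorem corollary1p6 (R : realType) (N : nat -> nat) (B : nat -> {fset int})
  (hadm : forall k, admissible_pair R (N k) (B k))
  (h0 : forall k, 0 \in B k)
  (hB : forall k b, b \in B k -> 0 <= b)
  (hsup : (ereal_sup [set x : \bar R |
     exists k b, b \in B k /\ x = ((N k)%:R^-1 * b%:~R)%:E] < +oo)%E)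
  (n : nat -> nat) (hn : forall k, (0 < n k)%N) :
  [/\ (forall w : words R, infinite_convolution_exists N B n w) /\
      random_measure (fun w : borel_words R => infinite_convolution N B n w),
      forall p : nat -> R, probability_vector p ->
      forall P : probability (borel_words R) R, bernoulli_measure p P ->
        {ae P, forall w, spectral_measure (infinite_convolution N B n w)} &
      ~ (exists C : nat, forall k, (n k <= C)%N) ->
        spectral_random_measure
          (fun w : borel_words R => infinite_convolution N B n w)].
Proof.
have [C0 HC] : exists C0 : R, forall k b, b \in B k -> b%:~R <= C0 * (N k)%:R.
  move: hsup; set S := (X in ereal_sup X) => hS.
  have H k b : b \in B k -> (((N k)%:R^-1 * b%:~R)%:E <= ereal_sup S)%E.
    by move=> bB; apply: ereal_sup_ubound; exists k, b.
  case E : (ereal_sup S) hS H => [c| |] // _ H; last first.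
    by have := H 0%N 0 (h0 0%N); rewrite leeNy_eq.
  exists c => k b /H; rewrite lee_fin ler_pdivrMl ?[c * _]mulrC//.
  by have [N2 _ _] := hadm k; rewrite ltr0n ltnW.
have N2 j : (2 <= N j)%N by have [] := hadm j.
have C00 : 0 <= C0.
  have := HC 0%N 0 (h0 0%N); rewrite pmulr_lge0// ltr0n.
  exact: ltnW (N2 _).
have NB w : hadamard C0 (wpow N n w) (wdig B w).
  move=> i; split; [|exact: h0|move=> b bB; split; first exact: hB bB].
    by apply: spectral_digits_expn => //; exact: admissible_spectral.
  rewrite (le_trans (HC _ _ bB))// ler_wpM2l// ler_nat.
  by rewrite -{1}(expn1 (N (w i))) leq_pexp2l// ltnW.
have rm := random_measure_infinite_convolution N2 NB.
split.
- by split=> // w; exact: infinite_convolution_existsT N2 NB w.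
- move=> p p01 P Pp.
  have [[D nD]|nu] := pselect (exists D, forall k, (n k <= D)%N).
    exact: (ae_spectral_bounded N2 NB nD p01 Pp).
  apply: aeW => w; exact: (spectral_unbounded N2 NB HC nu).
- by move=> nu; split=> // w; exact: (spectral_unbounded N2 NB HC nu).
Qed.
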